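(* Let $q,\tilde q\in L_2(0,2\pi)$ be complex-valued, and let $\{\lambda_n\}_{n=1}^\infty$ and $\{\tilde\lambda_n\}_{n=1}^\infty$ be the spectra of the Dirichlet boundary value problems $$-y''(x)+q(x)y(x)=\lambda y(x),\quad x\in(0,2\pi),\qquad y(0)=y(2\pi)=0,$$ with potentials $q$ and $\tilde q$, respectively. Suppose that $q(x)=\tilde q(x)$ a.e. on $(\pi,2\pi)$ and $\lambda_n=\tilde\lambda_n$ for all $n\ge1$. Then $q(x)=\tilde q(x)$ a.e. on $(0,\pi)$.
   Context: The spectrum is the sequence of eigenvalues counted with multiplicities and numbered according to the asymptotics $\sqrt{\lambda_n}=\frac n2+\frac{\Omega}{\pi n}+o(n^{-1})$, $n\to\infty$, where $\Omega=\frac12\int_0^{2\pi}q(x)\,dx$. The multiplicity of an eigenvalue is its multiplicity as a zero of the entire function $\Delta(\lambda)=\psi(\pi,\lambda)S'(\pi,\lambda)-\psi'(\pi,\lambda)S(\pi,\lambda)$, where $S$ and $\psi$ are the solutions of the equation with $S(0,\lambda)=0$, $S'(0,\lambda)=1$, $\psi(2\pi,\lambda)=0$, $\psi'(2\pi,\lambda)=-1$ (prime is the derivative in $x$). *)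

(* Defs.v *)
From mathcomp Require Import all_boot all_order all_algebra.
From mathcomp Require Import all_classical all_reals all_analysis.
From mathcomp Require Import complex.

Set Implicit Arguments.
Unset Strict Implicit.
Unset Printing Implicit Defensive.

Import Order.TTheory GRing.Theory Num.Theory.
Import numFieldNormedType.Exports.

Local Open Scope classical_set_scope.
Local Open Scope ring_scope.
Local Open Scope card_scope.
Local Open Scope complex_scope.

Section Defs.
Context {R : realType}.
Local Notation C := R[i].
Local Notation mu := (@lebesgue_measure R).
Local Notation ReF f := (fun t : R => complex.Re (f t)).
Local Notation ImF f := (fun t : R => complex.Im (f t)).

(* Borel representatives of classes in L_2(a, b); every class has one. *)
Definition square_integrable (a b : R) (q : R -> C) : Prop :=
  [/\ measurable_fun `]a, b[ (ReF q),
      measurable_fun `]a, b[ (ImF q) &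
      mu.-integrable `]a, b[
        (fun x => (complex.Re (q x) ^+ 2 + complex.Im (q x) ^+ 2)%:E)].

Definition cintegral (a b : R) (q : R -> C) : C :=
  (\int[mu]_(x in `]a, b[) complex.Re (q x)) +i*
  (\int[mu]_(x in `]a, b[) complex.Im (q x)).

Definition abs_continuous (a b : R) (f : R -> R) : Prop :=
  forall e : R, 0 < e -> exists2 d : R, 0 < d &
    forall (n : nat) (u v : 'I_n -> R),
      (forall i, a <= u i <= v i /\ v i <= b) ->
      trivIset setT (fun i => `]u i, v i[%classic) ->
      \sum_(i < n) (v i - u i) < d ->
      \sum_(i < n) `|f (v i) - f (u i)| < e.

Definition is_cderive (f : R -> C) (x : R) (l : C) : Prop :=
  is_derive x 1 (ReF f) (complex.Re l) /\ is_derive x 1 (ImF f) (complex.Im l).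

(* The pair (y, y') for a solution y of -y'' + q y = l y on [0, 2 pi], with y'
   absolutely continuous and the equation holding almost everywhere.  As y is
   continuous on [0, 2 pi] and y1 is too, y1 0 and y1 (2 pi) are the one-sided
   derivatives of y at the endpoints. *)
Definition is_solution (q : R -> C) (l : C) (y y1 : R -> C) : Prop :=
  [/\ {within `[0, 2 * pi], continuous (ReF y)} /\
      {within `[0, 2 * pi], continuous (ImF y)},
      forall x, 0 < x < 2 * pi -> is_cderive y x (y1 x),
      abs_continuous 0 (2 * pi) (ReF y1) /\
      abs_continuous 0 (2 * pi) (ImF y1) &
      {ae mu, forall x, 0 < x < 2 * pi ->
        exists2 y2 : C, is_cderive y1 x y2 & - y2 + q x * y x = l * y x}].

Definition dirichlet_eigenvalue (q : R -> C) (l : C) : Prop :=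
  exists y y1 : R -> C,
    [/\ is_solution q l y y1, y 0 = 0, y (2 * pi) = 0 &
        exists2 x, 0 <= x <= 2 * pi & y x != 0].

Definition characteristic_function (q : R -> C) (D : C -> C) : Prop :=
  exists S S1 psi psi1 : R -> C -> C,
    (forall l,
      [/\ is_solution q l (S ^~ l) (S1 ^~ l), S 0 l = 0, S1 0 l = 1 &
      [/\ is_solution q l (psi ^~ l) (psi1 ^~ l),
          psi (2 * pi) l = 0 & psi1 (2 * pi) l = -1]]) /\
    (forall l, D l = psi pi l * S1 pi l - psi1 pi l * S pi l).

Definition entire (g : C -> C) : Prop :=
  forall z : C, derivable (g : C^o -> C^o) z 1.

Definition zero_multiplicity (D : C -> C) (z : C) (m : nat) : Prop :=
  exists g : C -> C,
    [/\ entire g, g z != 0 & forall w, D w = (w - z) ^+ m * g w].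

(* The value lam 0 is irrelevant; sqrtc is the principal square root, with
   nonnegative real part (unlike sqrtC). *)
Definition dirichlet_spectrum (q : R -> C) (lam : nat -> C) : Prop :=
  [/\ forall n, (0 < n)%N -> dirichlet_eigenvalue q (lam n),
      exists2 D : C -> C, characteristic_function q D &
        forall z, dirichlet_eigenvalue q z ->
          exists2 m : nat, zero_multiplicity D z m &
            [set n | (0 < n)%N /\ lam n = z] #= `I_m &
      let Omega := cintegral 0 (2 * pi) q / 2 in
      (fun n : nat =>
         sqrtc (lam n) - (n%:R / 2 + Omega / (pi%:C * n%:R)) : C^o)
        =o_\oo (fun n : nat => n%:R^-1 : C^o)].

End Defs.

(* Main.v *)
Require Import Defs.
From mathcomp Require Import all_boot all_order all_algebra.
From mathcomp Require Import all_classical all_reals all_analysis.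
From mathcomp Require Import measurable_realfun complex.
From mathcomp Require Import ring lra.

Set Implicit Arguments.
Unset Strict Implicit.
Unset Printing Implicit Defensive.

Import Order.TTheory GRing.Theory Num.Theory.
Import numFieldNormedType.Exports.

Local Open Scope classical_set_scope.
Local Open Scope ring_scope.

(** Write S and psi for the solutions of the first equation with data (0, 1) at
    0 and (0, -1) at 2 pi, and St and psit for those of the second one. The
    Wronskian of psi and S does not depend on x, so the characteristic function
    is D = S (2 pi), and the problem becomes one about entire functions of l
    that are to be compared with D.

    The heart of the proof is one growth argument, used three times
    (char_vanish). Let l = rho^2 with Im rho >= 0. By comparison with
    sin (2 pi rho) / rho, the modulus of D is at least a constant times
    e^(2 pi Im rho) / |rho| on a sequence of circles that tend to infinity. So
    an entire function N which is O(e^(2 pi Im rho) / |rho|^2), and such that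
    N / D has a limit at each zero of D, must be 0: the quotient extends to an
    entire function that tends to 0 on the circles (liouville). It is applied
    to the following functions.
    - N = St (2 pi) - S (2 pi). The two characteristic functions have the same
      zeros with the same multiplicities, since these are counted by the common
      spectrum; so they are equal (char_eq).
    - N = the Wronskian of S and St at pi. The two equations agree on
      (pi, 2 pi), hence N = D (St' - S') (2 pi) is divisible by D. So N = 0, and
      the derivatives at 2 pi agree too (mixed_wronskian0).
    - N = psi St - S psit at a fixed x. If eta and etat are the solutions with
      data (1, 0) at 2 pi, then D eta = S' (2 pi) psi + S, similarly for etat,
      and N = D (psi etat - eta psit). So N = 0 (cross_zero).

    The identity psi St = S psit for all x, differentiated once, gives
    S^2 = St^2 (squares_eq); two more derivatives give (q - qt) S^2 = 0 almost
    everywhere (potential_eq_of_squares). For l = - n^2 with n large, S does not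
    vanish at a given x > 0, whence q = qt (half_potential).

    The analysis behind this is elementary. An absolutely continuous function
    with nonpositive derivative almost everywhere is nonincreasing
    (abs_continuous_nonincreasing); this gives Gronwall inequalities for the
    energy |y'|^2 + |rho|^2 |y|^2, and every estimate on solutions follows from
    them: exponential growth, comparison of two potentials, uniqueness and
    Lipschitz dependence on l. Solutions are entire in l because their divided
    differences in l solve the same equation with a forcing term (fam_divided,
    fam_holo). In Liouville's theorem the mean of the function over the circle
    of radius r is shown to be constant in r, even though the circles may run
    through countably many points where only continuity is known. *)


(** * Cousin's lemma *)

Section Cousin.
Context {R : realType}.
Local Notation mu := (@lebesgue_measure R).

(** The classical statement about tagged partitions, phrased for an additive
    property of intervals: what holds for all short intervals around each
    point holds for [a, b]. It is used below in place of compactness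
    arguments. *)
Lemma cousin (a b : R) (P : R -> R -> Prop) : a <= b ->
  (forall u v w, a <= u -> u <= v -> v <= w -> w <= b ->
     P u v -> P v w -> P u w) ->
  (forall x, a <= x <= b -> exists2 d, 0 < d &
     forall u v, a <= u -> u <= x -> x <= v -> v <= b ->
       x - d < u -> v < x + d -> P u v) ->
  P a b.
Proof.
move=> ab Padd Ploc.
pose A := [set x | a <= x <= b /\ P a x].
have Aa : A a.
  have [d d0 H] := Ploc a ltac:(by rewrite lexx ab).
  by split; [rewrite lexx ab|apply: H => //; lra].
have supA : has_sup A.
  by split; [exists a|exists b => x [/andP[]]].
pose s := sup A.
have as_ : a <= s by apply: ub_le_sup => //; exact: supA.2.
have sb : s <= b by apply: ge_sup; [exists a|move=> x [/andP[]]].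
have [d d0 H] := Ploc s ltac:(by rewrite as_ sb).
have [x [/andP[ax xb] Pax] sx] := sup_adherent d0 supA.
have xs : x <= s by apply: ub_le_sup; [exact: supA.2|split=> //; rewrite ax xb].
pose s' := Num.min b (s + d / 2).
have ss' : s <= s' by rewrite le_min sb /=; lra.
have s'b : s' <= b by rewrite ge_min lexx.
have s'd : s' < s + d by rewrite gt_min; apply/orP; right; lra.
have Pxs' : P x s' by apply: H.
have Pas' : P a s' by apply: (Padd a x s') => //; lra.
have : s' <= s by apply: ub_le_sup; [exact: supA.2|split=> //; rewrite s'b andbT; lra].
rewrite /s' ge_min => /orP[bs|]; last by lra.
suff -> : b = s' by [].
by lra.
Qed.

Lemma is_derive_eps (f : R -> R) (x l : R) : is_derive x 1 f l ->
  forall e : R, 0 < e -> exists2 d : R, 0 < d &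
    forall y, `|y - x| < d -> `|f y - f x - l * (y - x)| <= e * `|y - x|.
Proof.
move=> [df dl] e e0.
have : (fun h => h^-1 *: ((f \o shift x) (h *: 1) - f x)) @ 0^' --> l.
  by rewrite -dl; exact: df.
move=> /cvgrPdist_le/(_ _ e0).
rewrite near_withinE => /nbhs_ballP[d /= d0 H].
exists d => // y yd.
have [->|yx] := eqVneq y x; first by rewrite !subrr mulr0 subr0 normr0 mulr0.
have yx0 : y - x != 0 by rewrite subr_eq0.
have := H (y - x); rewrite /ball /= sub0r normrN => /(_ yd yx0).
rewrite /GRing.scale /= mulr1 subrK => le.
have -> : f y - f x - l * (y - x) = - ((l - (y - x)^-1 * (f y - f x)) * (y - x)).
  by field.
by rewrite normrN normrM ler_wpM2r.
Qed.

Lemma eps_is_derive (f : R -> R) (x l : R) :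
  (forall e : R, 0 < e -> exists2 d : R, 0 < d &
    forall y, `|y - x| < d -> `|f y - f x - l * (y - x)| <= e * `|y - x|) ->
  is_derive x 1 f l.
Proof.
move=> H.
have L : (fun h => h^-1 *: ((f \o shift x) (h *: 1) - f x)) @ 0^' --> l.
  apply/cvgrPdist_le => e e0; have [d d0 {}H] := H _ e0.
  rewrite near_withinE; apply/nbhs_ballP; exists d => //= h.
  rewrite /ball /= sub0r normrN => hd h0.
  rewrite /GRing.scale /= mulr1.
  have := H (h + x); rewrite addrK => /(_ hd) {}H.
  have -> : l - h^-1 * (f (h + x) - f x) = - (h^-1 * (f (h + x) - f x - l * h)).
    by field.
  by rewrite normrN normrM normfV ler_pdivrMl ?normr_gt0// (mulrC `|h|).
by split; [apply/cvg_ex; exists l|apply/cvg_lim].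
Qed.

End Cousin.

(** * Absolutely continuous functions *)

Section AbsCont.
Context {R : realType}.
Local Notation mu := (@lebesgue_measure R).
Implicit Types f g : R -> R.

(** Families of intervals in increasing order; unlike disjoint families, they
    can be concatenated, which is what Cousin's lemma asks for. *)
Fixpoint chain (s : seq (R * R)) (u v : R) : Prop :=
  if s is p :: s' then [/\ u <= p.1, p.1 <= p.2 & chain s' p.2 v]
  else u <= v.

Lemma chain_le s u v : chain s u v -> u <= v.
Proof.
elim: s u => [//|p s IH] u /= [up pp /IH pv].
exact: le_trans up (le_trans pp pv).
Qed.

Lemma chain_cat s t u v w : chain s u v -> chain t v w -> chain (s ++ t) u w.
Proof.
elim: s u => [|p s IH] u /=; last by move=> [? ? h] /(IH _ h).
case: t => [|p t] /= uv; first exact: le_trans.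
by move=> [vp ? ?]; split => //; exact: le_trans vp.
Qed.

Lemma chain_nth s u v i : chain s u v -> (i < size s)%N ->
  [/\ u <= (nth (0, 0) s i).1, (nth (0, 0) s i).1 <= (nth (0, 0) s i).2
    & (nth (0, 0) s i).2 <= v].
Proof.
elim: s u i => [//|p s IH] u [|i] /= [up pp ch] si.
  by split=> //; exact: chain_le ch.
have [h1 h2 h3] := IH _ i ch si.
by split=> //; exact: le_trans up (le_trans pp h1).
Qed.

Lemma chain_sep s u v i j : chain s u v -> (i < j)%N -> (j < size s)%N ->
  (nth (0, 0) s i).2 <= (nth (0, 0) s j).1.
Proof.
elim: s u i j => [//|p s IH] u [|i] [|j] //= [up pp ch] ij sj.
  by have [] := chain_nth ch sj.
exact: (IH p.2 i j ch ij sj).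
Qed.

Lemma abs_continuous_chain a b f : abs_continuous a b f ->
  forall e : R, 0 < e -> exists2 d : R, 0 < d & forall s, chain s a b ->
    \sum_(p <- s) (p.2 - p.1) < d -> \sum_(p <- s) `|f p.2 - f p.1| < e.
Proof.
move=> acf e e0; have [d d0 H] := acf e e0.
exists d => // s ch.
rewrite !(big_nth (0, 0)) !big_mkord => sd.
apply: (H _ (fun i : 'I_(size s) => (nth (0, 0) s i).1)) => //.
  by move=> i; have [-> -> ->] := chain_nth ch (ltn_ord i).
apply/trivIsetP => i j _ _ ij.
wlog lij : i j ij / (i < j)%N.
  move=> W; have [|ji|] := ltngtP i j; first exact: W.
    by rewrite setIC; apply: W => //; rewrite eq_sym.
  by move=> /val_inj ijE; rewrite ijE eqxx in ij.
have h := chain_sep ch lij (ltn_ord j).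
apply/seteqP; split => // x /=; rewrite !in_itv /= => -[/andP[_ h1] /andP[h2 _]].
have := lt_le_trans h1 (le_trans h (ltW h2)); by rewrite ltxx.
Qed.

(** The total length of a chain is controlled by the measure of any set that
    covers it, by induction from the right. *)
Lemma chain_measure (U : set R) s u v : measurable U -> chain s u v ->
  (forall p, p \in s -> `]p.1, p.2[ `<=` U) ->
  ((\sum_(p <- s) (p.2 - p.1))%:E <= mu (U `&` `]u, v[))%E.
Proof.
move=> mU; elim: s u => [|p s IH] u /=.
  by rewrite big_nil => _ _; exact: measure_ge0.
move=> [up pp ch] sU; rewrite big_cons EFinD.
have pv := chain_le ch.
have h1 : ((p.2 - p.1)%:E <= mu `]p.1, p.2[)%E.
  rewrite lebesgue_measure_itv /= lte_fin; case: ltP => [|h]; first by rewrite EFinB.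
  by rewrite lee_fin subr_le0.
have h2 := IH _ ch (fun x xs => sU x ltac:(by rewrite inE xs orbT)).
apply: (le_trans (leeD h1 h2)).
rewrite -measureU; last 3 first.
- exact: measurable_itv.
- by apply: measurableI.
- apply/seteqP; split => // x /=; rewrite !in_itv /=.
  by move=> [/andP[_ xp] [_ /andP[px _]]]; have := lt_trans xp px; rewrite ltxx.
apply: le_measure; rewrite ?inE.
- by apply: measurableU => //; apply: measurableI.
- by apply: measurableI.
move=> x [xp|[Ux]] /=; last first.
  by rewrite !in_itv /= => /andP[h ->]; rewrite andbT (le_lt_trans _ h)// (le_trans up).
split; first by apply: (sU p (mem_head _ _)).
move: xp => /=; rewrite !in_itv /= => /andP[h k].
by rewrite (le_lt_trans up h) (lt_le_trans k pv).
Qed.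

(** Cousin's lemma with two kinds of tags. Around a point where the derivative
    is nonpositive, increments are bounded by e times the length of the
    interval. The remaining points form a null set; it is covered by an open
    set so small that absolute continuity bounds the sum of the increments
    over it. *)
Lemma abs_continuous_nonincreasing a b f : a <= b -> abs_continuous a b f ->
  {ae mu, forall x, a < x < b -> exists2 l, is_derive x 1 f l & l <= 0} ->
  f b <= f a.
Proof.
move=> ab acf [A [mA A0 sA]].
suff H (e : R) : 0 < e -> f b - f a <= e * (b - a) + e.
  rewrite -subr_le0; apply/ler_addgt0Pr => e e0; rewrite add0r.
  have p : 0 < b - a + 1 by lra.
  have := H (e / (b - a + 1)) (divr_gt0 e0 p).
  have -> : e / (b - a + 1) * (b - a) + e / (b - a + 1) = e by field; lra.
  by [].
move=> e0; have [d d0 Hd] := abs_continuous_chain acf e0.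
(* The derivative is only known in the open interval: the endpoints join the
   null set. *)
pose A' := A `|` [set a; b].
have mA' : measurable A' by apply: measurableU => //; apply: measurableU.
have A'0 : mu A' = 0%E.
  apply: null_set_setU => //; first by apply: measurableU.
  by apply: null_set_setU => //; exact: lebesgue_measure_set1.
have [U [oU A'U Ud]] : exists U, [/\ open U, A' `<=` U & (mu U < d%:E)%E].
  have fA' : (mu A' < +oo)%E by rewrite A'0.
  have [U [oU AU Ud]] := lebesgue_regularity_outer mA' fA' d0.
  exists U; split => //.
  have mU := open_measurable oU.
  rewrite -(setDUK AU) measureU //; last 2 first.
  - exact: measurableD.
  - by rewrite setDE setICA setICr setI0.
  have E : (mu A' <= 0)%E by rewrite A'0.
  by apply: le_lt_trans (leeD2r _ E) _; rewrite add0e.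
have mU := open_measurable oU.
pose P u v := exists s, [/\ chain s u v,
  (forall p, p \in s -> `]p.1, p.2[ `<=` U) &
  f v - f u <= e * (v - u) + \sum_(p <- s) `|f p.2 - f p.1|].
have [s [ch sU fs]] : P a b.
  apply: cousin => //.
  - move=> u v w _ uv vw _ [s [cs sU fs]] [t [ct tU ft]]; exists (s ++ t); split.
    + exact: chain_cat cs ct.
    + by move=> p; rewrite mem_cat => /orP[/sU|/tU].
    + rewrite big_cat /=; lra.
  - move=> x axb; have [Ax|nAx] := pselect (A' x).
    + have /nbhs_ballP[r /= r0 xr] : nbhs x U by apply: open_nbhs_nbhs; split=> //;
      exact: A'U.
      exists r => // u v au ux xv vb ru rv; exists [:: (u, v)]; split => /=.
      * by rewrite !lexx (le_trans ux xv).
      * move=> p; rewrite inE => /eqP -> /= y /=; rewrite in_itv /= => /andP[uy yv].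
        by apply: xr; rewrite /ball /= ltr_distlC; lra.
      * rewrite big_seq1 /=; have := ler_norm (f v - f u).
        have : 0 <= e * (v - u) by apply: mulr_ge0; lra.
        lra.
    + have axb' : a < x < b.
        by rewrite !lt_neqAle; case/andP: axb => -> ->; rewrite !andbT;
          apply/andP; split; apply/eqP => E; apply: nAx; right => /=; [left|right].
      have [l dl l0] : exists2 l, is_derive x 1 f l & l <= 0.
        apply: contrapT => h; apply: nAx; left; apply: sA => /= H.
        exact: h (H axb').
      have [r r0 Hr] := is_derive_eps dl e0.
      exists r => // u v au ux xv vb ru rv; exists [::]; split => //=.
        exact: le_trans ux xv.
      rewrite big_nil addr0.
      have hu : `|u - x| < r by rewrite ltr_distlC; lra.
      have hv : `|v - x| < r by rewrite ltr_distlC; lra.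
      have := Hr _ hu; have := Hr _ hv.
      rewrite (ger0_norm (x := v - x)) ?subr_ge0// (ler0_norm (x := u - x)) ?subr_le0//.
      rewrite !ler_norml => /andP[_ h1] /andP[h2 _].
      have : l * (v - u) <= 0 by rewrite mulr_le0_ge0// subr_ge0; lra.
      lra.
apply: (le_trans fs); rewrite lerD2l; apply/ltW/Hd => //.
rewrite -lte_fin; apply: (le_lt_trans (chain_measure mU ch sU)).
apply: le_lt_trans Ud; apply: le_measure; rewrite ?inE //; exact: measurableI.
Qed.

End AbsCont.

Section AC2.
Context {R : realType}.
Local Notation mu := (@lebesgue_measure R).
Implicit Types f g h : R -> R.

Lemma aeS (P Q : R -> Prop) : {ae mu, forall x, P x} ->
  (forall x, P x -> Q x) -> {ae mu, forall x, Q x}.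
Proof. by move=> HP PQ; apply: (@filterS _ _ (ae_filter_ringOfSetsType mu)) HP. Qed.

Lemma aeS2 (P Q S : R -> Prop) : {ae mu, forall x, P x} ->
  {ae mu, forall x, Q x} -> (forall x, P x -> Q x -> S x) ->
  {ae mu, forall x, S x}.
Proof.
by move=> HP HQ PQ; apply: (@filterS2 _ _ (ae_filter_ringOfSetsType mu)) HP HQ.
Qed.

(** The closure properties of absolute continuity all come from an estimate of
    increments of this form. *)
Lemma ac_dominated a b f g h (L : R) : 0 <= L ->
  abs_continuous a b g -> abs_continuous a b h ->
  (forall u v, a <= u -> u <= v -> v <= b ->
     `|f v - f u| <= L * (`|g v - g u| + `|h v - h u|)) ->
  abs_continuous a b f.
Proof.
move=> L0 acg ach dom e e0.
have e'0 : 0 < e / (2 * (L + 1)) by rewrite divr_gt0// mulr_gt0//; lra.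
have [d1 d10 H1] := acg _ e'0; have [d2 d20 H2] := ach _ e'0.
exists (Num.min d1 d2); first by rewrite lt_min d10.
move=> n u v uv tr; rewrite lt_min => /andP[/(H1 n u v uv tr) s1 /(H2 n u v uv tr) s2].
have : \sum_(i < n) `|f (v i) - f (u i)| <=
    L * (\sum_(i < n) `|g (v i) - g (u i)| + \sum_(i < n) `|h (v i) - h (u i)|).
  rewrite -big_split /= mulr_sumr; apply: ler_sum => i _.
  by have [/andP[? ?] ?] := uv i; apply: dom.
move/le_lt_trans; apply.
set A := \sum_(i < n) _ in s1 *; set B := \sum_(i < n) _ in s2 *.
apply: (@le_lt_trans _ _ ((L * (e / (2 * (L + 1)) * 2)))).
  by apply: ler_wpM2l => //; lra.
have -> : L * (e / (2 * (L + 1)) * 2) = e * (L / (L + 1)) by field; lra.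
by rewrite gtr_pMr// ltr_pdivrMr; lra.
Qed.

Lemma ac_unif a b f : abs_continuous a b f -> forall e : R, 0 < e ->
  exists2 d : R, 0 < d & forall u v, a <= u -> u <= v -> v <= b ->
    v - u < d -> `|f v - f u| < e.
Proof.
move=> acf e e0; have [d d0 H] := acf e e0; exists d => // u v au uv vb uvd.
have := H 1%N (fun=> u) (fun=> v).
rewrite !big_ord1; apply => //; first by rewrite au uv vb.
by apply/trivIsetP => i j _ _; rewrite !ord1 eqxx.
Qed.

Lemma ac_bounded a b f : a <= b -> abs_continuous a b f ->
  exists2 M : R, 0 <= M & forall x, a <= x <= b -> `|f x| <= M.
Proof.
move=> ab acf; have [d d0 H] := ac_unif acf ltr01.
suff [M HM] : exists M, forall x, a <= x <= b -> `|f x| <= M.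
  by exists M => //; apply: le_trans (normr_ge0 (f a)) (HM a _); rewrite lexx ab.
apply: (@cousin R a b (fun u v => exists M, forall x, u <= x <= v -> `|f x| <= M)) => //.
- move=> u v w _ _ _ _ [M HM] [N HN]; exists (Num.max M N) => x /andP[ux xw].
  rewrite le_max; have [xv|vx] := leP x v.
    by rewrite HM// ux.
  by rewrite HN ?orbT// xw (ltW vx).
- move=> x /andP[ax xb]; exists d => // u v au ux xv vb ru rv.
  exists (`|f x| + 1) => y /andP[uy yv].
  rewrite -lerBlDl; apply: le_trans (lerB_dist _ _) _.
  have [yx|xy] := leP y x.
    by rewrite distrC; apply/ltW/H => //; lra.
  by apply/ltW/H; lra.
Qed.

Lemma ac_lipschitz a b f (L : R) : 0 <= L ->
  (forall u v, a <= u -> u <= v -> v <= b -> `|f v - f u| <= L * (v - u)) ->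
  abs_continuous a b f.
Proof.
move=> L0 Hf e e0; exists (e / (L + 1)); first by rewrite divr_gt0//; lra.
move=> n u v uv _ s.
apply: (@le_lt_trans _ _ (L * \sum_(i < n) (v i - u i))).
  rewrite mulr_sumr; apply: ler_sum => i _.
  by have [/andP[? ?] ?] := uv i; apply: Hf.
apply: (@le_lt_trans _ _ (L * (e / (L + 1)))); first by apply: ler_wpM2l => //; exact: ltW.
have -> : L * (e / (L + 1)) = e * (L / (L + 1)) by field; lra.
by rewrite gtr_pMr// ltr_pdivrMr; lra.
Qed.

Lemma ac_cst a b (c : R) : abs_continuous a b (fun=> c).
Proof. by apply: (@ac_lipschitz _ _ _ 0) => // u v _ _ _; rewrite subrr normr0 mul0r. Qed.

(** A function is carried together with an almost everywhere derivative of it,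
    so that the rules of calculus below act on both at once. *)
Definition ac_deriv a b f g := abs_continuous a b f /\
  {ae mu, forall x, a < x < b -> is_derive x 1 f (g x)}.

Lemma ac_deriv_sub a b a' b' f g : a <= a' -> b' <= b -> ac_deriv a b f g ->
  ac_deriv a' b' f g.
Proof.
move=> aa' bb' [acf df]; split.
  move=> e e0; have [d d0 H] := acf e e0; exists d => // n u v uv; apply: H => i.
  have [/andP[? ?] ?] := uv i; split; last exact: le_trans bb'.
  by apply/andP; split => //; exact: le_trans aa' _.
apply: (aeS df) => x H /andP[? ?]; apply: H.
by rewrite (le_lt_trans aa') ?(lt_le_trans _ bb').
Qed.

Lemma ac_deriv_ext a b f f' g g' : ac_deriv a b f g -> f =1 f' ->
  {ae mu, forall x, a < x < b -> g x = g' x} -> ac_deriv a b f' g'.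
Proof.
move=> [acf df] /funext <- gg'; split => //.
by apply: (aeS2 df gg') => x H1 H2 ab; rewrite -H2//; exact: H1.
Qed.

Lemma ac_deriv_cst a b (c : R) : ac_deriv a b (fun=> c) (fun=> 0).
Proof. by split; [exact: ac_cst|apply: aeW => x _; exact: is_derive_cst]. Qed.

Lemma ac_deriv_add a b f f' g g' : ac_deriv a b f f' -> ac_deriv a b g g' ->
  ac_deriv a b (fun x => f x + g x) (fun x => f' x + g' x).
Proof.
move=> [acf df] [acg dg]; split.
  apply: (@ac_dominated a b _ f g 1) => // u v _ _ _; rewrite mul1r.
  by apply: le_trans (ler_normD _ _); rewrite le_eqVlt; apply/orP; left; apply/eqP;
    congr `|_|; ring.
by apply: (aeS2 df dg) => x H1 H2 ab; apply: is_deriveD; [exact: H1|exact: H2].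
Qed.

Lemma ac_deriv_opp a b f f' : ac_deriv a b f f' -> ac_deriv a b (fun x =>
  - f x) (fun x => - f' x).
Proof.
move=> [acf df]; split.
  apply: (@ac_dominated a b _ f f 1) => // u v _ _ _.
  by rewrite mul1r -opprD normrN lerDl.
by apply: (aeS df) => x H ab; apply: is_deriveN; exact: H.
Qed.

Lemma ac_deriv_mul a b f f' g g' : a <= b -> ac_deriv a b f f' -> ac_deriv a b g g' ->
  ac_deriv a b (fun x => f x * g x) (fun x => f x * g' x + f' x * g x).
Proof.
move=> ab [acf df] [acg dg]; split.
  have [M M0 HM] := ac_bounded ab acf; have [N N0 HN] := ac_bounded ab acg.
  apply: (@ac_dominated a b _ f g (M + N)) => //; first exact: addr_ge0.
  move=> u v au uv vb.
  have -> : f v * g v - f u * g u = (f v - f u) * g v + f u * (g v - g u) by ring.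
  apply: le_trans (ler_normD _ _) _; rewrite !normrM.
  have hg := HN v ltac:(lra); have hf := HM u ltac:(lra).
  have h1 := ler_wpM2l (normr_ge0 (f v - f u)) hg.
  have h2 := ler_wpM2r (normr_ge0 (g v - g u)) hf.
  have h3 := mulr_ge0 M0 (normr_ge0 (f v - f u)).
  have h4 := mulr_ge0 N0 (normr_ge0 (g v - g u)).
  lra.
apply: (aeS2 df dg) => x H1 H2 xab.
apply: is_derive_eq; first by apply: is_deriveM; [exact: H1|exact: H2].
by rewrite /GRing.scale /= (mulrC (f' x)).
Qed.

(** By the mean value theorem the function is Lipschitz. *)
Lemma ac_deriv_bounded_derive a b f f' (M : R) : 0 <= M ->
  {within `[a, b], continuous f} ->
  (forall x, a < x < b -> is_derive x 1 f (f' x) /\ `|f' x| <= M) ->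
  ac_deriv a b f f'.
Proof.
move=> M0 cf df; split; last by apply: aeW => x /df[].
apply: (@ac_lipschitz _ _ _ M) => // u v au uv vb.
have [<-|nuv] := eqVneq u v; first by rewrite !subrr normr0 mulr0.
have {}uv : u < v by rewrite lt_neqAle nuv uv.
have [||c cuv ->] := @MVT R f f' u v uv.
- by move=> x; rewrite in_itv /= => /andP[ux xv]; apply: (df x _).1; lra.
- apply: continuous_subspaceW cf => x /=; rewrite !in_itv /= => /andP[ux xv]; lra.
move: cuv; rewrite in_itv /= => /andP[uc cv].
rewrite normrM (gtr0_norm (x := v - u)) ?subr_gt0//.
by apply: ler_wpM2r; [lra|apply: (df c _).2; lra].
Qed.

Lemma derive_within (f f' : R -> R) (A : set R) :
  (forall x : R, is_derive x 1 f (f' x)) -> {within A, continuous f}.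
Proof.
move=> df; apply: continuous_subspaceT => x.
by apply/differentiable_continuous/derivable1_diffP; have [] := df x.
Qed.

Lemma ac_deriv_smooth a b f f' (M : R) : 0 <= M ->
  (forall x : R, is_derive x 1 f (f' x)) -> (forall x, a <= x <= b -> `|f' x| <= M) ->
  ac_deriv a b f f'.
Proof.
move=> M0 df bf; apply: (ac_deriv_bounded_derive M0); first exact: derive_within df.
by move=> x /andP[ax xb]; split => //; apply: bf; rewrite !ltW.
Qed.

Lemma ac_deriv_id a b : ac_deriv a b (fun x => x) (fun=> 1).
Proof. by apply: (@ac_deriv_smooth _ _ _ _ 1) => // x _; rewrite normr1. Qed.

(** The exponential is Lipschitz on the range of a bounded function. *)
Lemma ac_deriv_exp a b f f' : a <= b -> ac_deriv a b f f' ->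
  ac_deriv a b (fun x => expR (f x)) (fun x => f' x * expR (f x)).
Proof.
move=> ab [acf df]; split.
  have [M M0 HM] := ac_bounded ab acf.
  apply: (@ac_dominated a b _ f f (expR M)) => //.
  move=> u v au uv vb.
  have key x y : x <= y -> `|y| <= M -> `|expR y - expR x| <= expR M * (y - x).
    move=> xy yM; rewrite ger0_norm ?subr_ge0 ?ler_expR//.
    have -> : expR y - expR x = expR y * (1 - expR (x - y)).
      by rewrite mulrBr mulr1 -expRD (addrC y) subrK.
    have := expR_ge1Dx (x - y) => h.
    apply: ler_pM; rewrite ?expR_ge0 ?ler_expR ?subr_ge0 ?expR_le1; try lra.
    by apply: le_trans yM; exact: ler_norm.
  rewrite mulrDr; apply: ler_wpDr; first by rewrite mulr_ge0// expR_ge0.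
  have [fuv|fvu] := leP (f u) (f v).
    by rewrite (ger0_norm (x := f v - f u)) ?subr_ge0//; apply: key => //; apply: HM; lra.
  rewrite distrC (distrC (f v)) (ger0_norm (x := f u - f v)) ?subr_ge0 ?(ltW fvu)//.
  by apply: key; [exact: ltW|apply: HM; lra].
apply: (aeS df) => x H xab.
have {}H := is_derive1_comp (is_derive_expR (f x)) (H xab).
by rewrite mulrC; exact: H.
Qed.

Lemma ac_deriv_nonincreasing a b f g : a <= b -> ac_deriv a b f g ->
  {ae mu, forall x, a < x < b -> g x <= 0} -> f b <= f a.
Proof.
move=> ab [acf df] g0; apply: abs_continuous_nonincreasing ab acf _.
by apply: (aeS2 df g0) => x H1 H2 xab; exists (g x); [exact: H1|exact: H2].
Qed.

(** Absolute continuity of the integral, and Lebesgue's differentiation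
    theorem. *)
Lemma ac_deriv_primitive a b h : a <= b -> mu.-integrable `]a, b[ (EFin \o h) ->
  exists H, ac_deriv a b H h.
Proof.
move=> ab ih; pose k := h \_ `]a, b[.
have ik : mu.-integrable setT (EFin \o k).
  by rewrite /k -restrict_EFin; apply/integrable_restrict => //; rewrite setTI.
have ikA (A : set R) : measurable A -> mu.-integrable A (EFin \o k).
  by move=> mA; exact: (integrableS _ _ _ ik).
pose H x := (\int[mu]_(t in `]-oo, x]) k t).
exists H; split.
  move=> e e0; have [d [d0 Hd]] := integral_normr_continuous ik e0.
  exists d => // n u v uv tr s.
  pose D := \big[setU/set0]_(i <- index_enum 'I_n) `]u i, v i[%classic.
  have mD : measurable D by apply: bigsetU_measurable => i _; exact: measurable_itv.
  have mk : measurable_fun D (fun x => `|k x|).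
    apply: measurableT_comp => //.
    by apply/measurable_EFinP; have /integrableP[] := ikA D mD.
  have muD : (mu D < d%:E)%E.
    rewrite measure_bigsetU_ord//.
    rewrite (eq_bigr (fun i => (v i - u i)%:E)) ?sumEFin ?lte_fin// => i _.
    transitivity (mu `]u i, v i[%classic) => //; rewrite lebesgue_measure_itv /= lte_fin;
      case: ltP => [|h']; first by rewrite EFinB.
    have [/andP[_ h''] _] := uv i.
    by rewrite (_ : v i = u i) ?subrr //; apply/eqP; rewrite eq_le h' h''.
  have {}Hd := Hd D mD muD.
  apply: le_lt_trans Hd.
  have fin (A : set R) : measurable A ->
    (\int[mu]_(x in A) `|k x|%:E = (\int[mu]_(x in A) `|k x|)%:E)%E.
    move=> mA; rewrite /Rintegral fineK//; apply: integrable_fin_num => //.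
    by apply: (integrable_norm (ikA A mA)) || exact: integrable_abse (ikA A mA).
  rewrite -lee_fin -fin// integral_bigsetU_EFin//=; last 3 first.
  - exact: index_enum_uniq.
  - by apply: sub_trivIset tr.
  - exact/measurable_EFinP.
  rewrite -sumEFin; apply: lee_sum => i _.
  have [/andP[au uvi] vb] := uv i.
  rewrite fin // lee_fin /H.
  rewrite Rintegral_itvB ?bnd_simp//; last by apply: ikA.
  rewrite -(Rintegral_itv_bndo_bndc (r := v i)); last by apply: ikA.
  by apply: le_normr_Rintegral => //; apply: ikA.
have := @FTC1Ny R k (fun y => ikA _ (measurable_itv _)) (integrable_locally
  (measurable_itv _) ih).
move=> /aeS; apply => x [dH eH] xab; split; first exact: dH.
by rewrite -derive1E eH /k patchE mem_set.
Qed.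

End AC2.

(** * Gronwall's inequality *)

Section Gron.
Context {R : realType}.
Local Notation mu := (@lebesgue_measure R).

(** The function (X e^(- c (x - a)) + M) e^(- (k x - k a)) is nonincreasing. *)
Lemma gronwall_fwd a b (X X' k kp : R -> R) (c M : R) : a <= b ->
  ac_deriv a b X X' -> ac_deriv a b k kp ->
  {ae mu, forall x, a < x < b ->
     X' x <= c * X x + kp x * (X x + M * expR (c * (x - a)))} ->
  0 <= M -> X b <= (X a + M) * expR (c * (b - a)) * expR (k b - k a).
Proof.
move=> ab dX dk H M0.
have dE : ac_deriv a b (fun x => expR (- (c * (x - a)))) (fun x =>
  - c * expR (- (c * (x - a)))).
  apply: ac_deriv_ext; first apply: ac_deriv_exp => //.
  - apply: ac_deriv_opp; apply: ac_deriv_mul => //; first exact: (ac_deriv_cst a b c).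
    by apply: ac_deriv_add; [exact: ac_deriv_id|exact: (ac_deriv_cst a b (- a))].
  - by [].
  - by apply: aeW => x _ /=; ring.
have dK : ac_deriv a b (fun x => expR (- (k x - k a))) (fun x =>
  - kp x * expR (- (k x - k a))).
  apply: ac_deriv_ext; first apply: ac_deriv_exp => //.
  - by apply: ac_deriv_opp; apply: ac_deriv_add;
    [exact: dk|exact: (ac_deriv_cst a b (- k a))].
  - by [].
  - by apply: aeW => x _ /=; ring.
have dG := ac_deriv_mul ab (ac_deriv_add (ac_deriv_mul ab dX dE) (ac_deriv_cst a b M)) dK.
have := ac_deriv_nonincreasing ab dG _.
rewrite !subrr !mulr0 oppr0 expR0 !mulr1 => G.
have {G} : (X b * expR (- (c * (b - a))) + M) * expR (- (k b - k a)) <= X a + M.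
  apply: G; apply: (aeS H) => x Hx xab; have {}Hx := Hx xab.
  set e := expR (- (c * (x - a))); set e' := expR _.
  have e0 : 0 < e by exact: expR_gt0.
  have e'0 : 0 < e' by exact: expR_gt0.
  have ee : expR (c * (x - a)) * e = 1 by rewrite -expRD subrr expR0.
  have := ler_wpM2r (ltW e0) Hx.
  have -> : (c * X x + kp x * (X x + M * expR (c * (x - a)))) * e =
     c * X x * e + kp x * (X x * e + M * (expR (c * (x - a)) * e)) by ring.
  rewrite ee mulr1 => h.
  have -> : (X x * e + M) * (- kp x * e') + (X x * (- c * e) + X' x * e + 0) * e' =
    - (e' * (c * X x * e + kp x * (X x * e + M) - X' x * e)) by ring.
  by rewrite oppr_le0; apply: mulr_ge0; [exact: ltW|lra].
have e0 := expR_gt0 (c * (b - a)); have e'0 := expR_gt0 (k b - k a).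
move/(ler_wpM2r (ltW e0))/(ler_wpM2r (ltW e'0)).
rewrite !expRN => h; apply: le_trans h.
rewrite -[leRHS]mulrA [_ * expR (k b - k a)]mulrC.
have -> : (X b / expR (c * (b - a)) +
  M) / expR (k b - k a) * (expR (k b - k a) * expR (c * (b - a))) =
   X b + M * expR (c * (b - a)).
  by field; rewrite !gt_eqF.
by rewrite lerDl mulr_ge0// ltW.
Qed.

(** The mirror image: (X e^(- c (b - x)) + M) e^(- (k b - k x)) is
    nondecreasing. *)
Lemma gronwall_bwd a b (X X' k kp : R -> R) (c M : R) : a <= b ->
  ac_deriv a b X X' -> ac_deriv a b k kp ->
  {ae mu, forall x, a < x < b ->
     - X' x <= c * X x + kp x * (X x + M * expR (c * (b - x)))} ->
  0 <= M -> X a <= (X b + M) * expR (c * (b - a)) * expR (k b - k a).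
Proof.
move=> ab dX dk H M0.
have dE : ac_deriv a b (fun x => expR (- (c * (b - x)))) (fun x =>
  c * expR (- (c * (b - x)))).
  apply: ac_deriv_ext; first apply: ac_deriv_exp => //.
  - apply: ac_deriv_opp; apply: ac_deriv_mul => //; first exact: (ac_deriv_cst a b c).
    by apply: ac_deriv_add; [exact: (ac_deriv_cst a b b)|apply: ac_deriv_opp;
      exact: ac_deriv_id].
  - by [].
  - by apply: aeW => x _ /=; ring.
have dK : ac_deriv a b (fun x => expR (- (k b - k x))) (fun x =>
  kp x * expR (- (k b - k x))).
  apply: ac_deriv_ext; first apply: ac_deriv_exp => //.
  - by apply: ac_deriv_opp; apply: ac_deriv_add;
    [exact: (ac_deriv_cst a b (k b))|apply: ac_deriv_opp; exact: dk].
  - by [].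
  - by apply: aeW => x _ /=; ring.
have dG := ac_deriv_opp (ac_deriv_mul ab (ac_deriv_add (ac_deriv_mul ab dX dE)
  (ac_deriv_cst a b M)) dK).
have := ac_deriv_nonincreasing ab dG _.
rewrite !subrr !mulr0 oppr0 expR0 !mulr1 lerN2 => G.
have {G} : (X a * expR (- (c * (b - a))) + M) * expR (- (k b - k a)) <= X b + M.
  apply: G; apply: (aeS H) => x Hx xab; have {}Hx := Hx xab.
  set e := expR (- (c * (b - x))); set e' := expR _.
  have e0 : 0 < e by exact: expR_gt0.
  have e'0 : 0 < e' by exact: expR_gt0.
  have ee : expR (c * (b - x)) * e = 1 by rewrite -expRD subrr expR0.
  have := ler_wpM2r (ltW e0) Hx.
  have -> : (c * X x + kp x * (X x + M * expR (c * (b - x)))) * e =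
     c * X x * e + kp x * (X x * e + M * (expR (c * (b - x)) * e)) by ring.
  rewrite ee mulr1 => h.
  have -> : - ((X x * e + M) * (kp x * e') + (X x * (c * e) + X' x * e + 0) * e') =
    - (e' * (c * X x * e + kp x * (X x * e + M) - (- X' x * e))) by ring.
  by rewrite oppr_le0; apply: mulr_ge0; [exact: ltW|lra].
have e0 := expR_gt0 (c * (b - a)); have e'0 := expR_gt0 (k b - k a).
move/(ler_wpM2r (ltW e0))/(ler_wpM2r (ltW e'0)).
rewrite !expRN => h; apply: le_trans h.
rewrite -[leRHS]mulrA [_ * expR (k b - k a)]mulrC.
have -> : (X a / expR (c * (b - a)) +
  M) / expR (k b - k a) * (expR (k b - k a) * expR (c * (b - a))) =
   X a + M * expR (c * (b - a)).
  by field; rewrite !gt_eqF.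
by rewrite lerDl mulr_ge0// ltW.
Qed.

End Gron.

(** * Complex-valued absolutely continuous functions *)

Section CAD.
Context {R : realType}.
Local Notation mu := (@lebesgue_measure R).
Local Notation C := R[i].
Implicit Types f g : R -> C.

(** Squared moduli are polynomials in the real and imaginary parts, so that
    they can be differentiated, and compared by linear arithmetic. *)
Definition nsq (z : C) : R := complex.Re z ^+ 2 + complex.Im z ^+ 2.
Definition dot (z w : C) : R :=
  complex.Re z * complex.Re w + complex.Im z * complex.Im w.

Lemma cReD (z w : C) : complex.Re (z + w) = complex.Re z + complex.Re w.
Proof. by case: z; case: w. Qed.
Lemma cImD (z w : C) : complex.Im (z + w) = complex.Im z + complex.Im w.
Proof. by case: z; case: w. Qed.
Lemma cReN (z : C) : complex.Re (- z) = - complex.Re z.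
Proof. by case: z. Qed.
Lemma cImN (z : C) : complex.Im (- z) = - complex.Im z.
Proof. by case: z. Qed.
Lemma cReM (z w : C) : complex.Re (z * w) =
  complex.Re z * complex.Re w - complex.Im z * complex.Im w.
Proof. by case: z; case: w. Qed.
Lemma cImM (z w : C) : complex.Im (z * w) =
  complex.Re z * complex.Im w + complex.Im z * complex.Re w.
Proof. by case: z; case: w. Qed.
Definition ReImE := (cReD, cImD, cReN, cImN, cReM, cImM).

Lemma nsqM z w : nsq (z * w) = nsq z * nsq w.
Proof. rewrite /nsq !ReImE; ring. Qed.
Lemma nsqN z : nsq (- z) = nsq z.
Proof. rewrite /nsq !ReImE; ring. Qed.
Lemma nsqB z w : nsq (z - w) = nsq (w - z).
Proof. by rewrite -nsqN opprB. Qed.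
Lemma nsq_ge0 z : 0 <= nsq z.
Proof. by rewrite addr_ge0 ?sqr_ge0. Qed.
Lemma nsq0 : nsq 0 = 0.
Proof. by rewrite /nsq /= expr0n addr0. Qed.
Lemma nsq1 : nsq 1 = 1.
Proof. by rewrite /nsq /= expr0n addr0 expr1n. Qed.
Lemma nsq_eq0 z : (nsq z == 0) = (z == 0).
Proof. by rewrite /nsq paddr_eq0 ?sqr_ge0// !sqrf_eq0 eq_complex. Qed.
Lemma nsq_gt0 z : (0 < nsq z) = (z != 0).
Proof. by rewrite lt_def nsq_eq0 nsq_ge0 andbT. Qed.
Lemma nsqV z : nsq z^-1 = (nsq z)^-1.
Proof.
have [->|z0] := eqVneq z 0; first by rewrite invr0 nsq0 invr0.
apply: (mulfI (x := nsq z)); first by rewrite nsq_eq0.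
by rewrite -nsqM !divff ?nsq1 ?nsq_eq0.
Qed.

(** Plays the part of the triangle inequality for squared moduli. *)
Lemma nsqD_le z w : nsq (z + w) <= 2 * nsq z + 2 * nsq w.
Proof.
rewrite /nsq !ReImE.
have := sqr_ge0 (complex.Re z - complex.Re w).
have := sqr_ge0 (complex.Im z - complex.Im w); lra.
Qed.

Lemma nsqB_le z w : nsq (z - w) <= 2 * nsq z + 2 * nsq w.
Proof. by have := nsqD_le z (- w); rewrite nsqN. Qed.

Lemma normr_dot2 z w : 2 * `|dot z w| <= nsq z + nsq w.
Proof.
rewrite /dot /nsq.
have := sqr_ge0 (complex.Re z - complex.Re w);
  have := sqr_ge0 (complex.Im z - complex.Im w).
have := sqr_ge0 (complex.Re z + complex.Re w);
  have := sqr_ge0 (complex.Im z + complex.Im w).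
by case: ler0P; lra.
Qed.

(** The Cauchy-Schwarz inequality in the plane. *)
Lemma dot_sqr z w : dot z w ^+ 2 <= nsq z * nsq w.
Proof.
rewrite /dot /nsq.
have := sqr_ge0 (complex.Re z * complex.Im w - complex.Im z * complex.Re w); lra.
Qed.

Definition cac_deriv a b f g :=
  ac_deriv a b (fun x => complex.Re (f x)) (fun x => complex.Re (g x)) /\
  ac_deriv a b (fun x => complex.Im (f x)) (fun x => complex.Im (g x)).

Lemma cac_deriv_sub a b a' b' f g : a <= a' -> b' <= b -> cac_deriv a b f g ->
  cac_deriv a' b' f g.
Proof. by move=> aa bb [h1 h2]; split; apply: ac_deriv_sub aa bb _. Qed.

Lemma cac_deriv_ext a b f f' g g' : cac_deriv a b f g -> f =1 f' ->
  {ae mu, forall x, a < x < b -> g x = g' x} -> cac_deriv a b f' g'.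
Proof.
move=> [h1 h2] ff gg; split.
  by apply: ac_deriv_ext h1 _ _ => [x|]; [rewrite ff|apply: (aeS gg) => x H /H ->].
by apply: ac_deriv_ext h2 _ _ => [x|]; [rewrite ff|apply: (aeS gg) => x H /H ->].
Qed.

Lemma cac_deriv_cst a b (c : C) : cac_deriv a b (fun=> c) (fun=> 0).
Proof. by split; exact: ac_deriv_cst. Qed.

Lemma cac_deriv_add a b f f' g g' : cac_deriv a b f f' -> cac_deriv a b g g' ->
  cac_deriv a b (fun x => f x + g x) (fun x => f' x + g' x).
Proof.
move=> [h1 h2] [k1 k2]; split; (apply: ac_deriv_ext; [apply: ac_deriv_add|..]).
- exact: h1.
- exact: k1.
- by move=> x; rewrite cReD.
- by apply: aeW => x _; rewrite cReD.
- exact: h2.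
- exact: k2.
- by move=> x; rewrite cImD.
- by apply: aeW => x _; rewrite cImD.
Qed.

Lemma cac_deriv_mul a b f f' g g' : a <= b -> cac_deriv a b f f' -> cac_deriv a b g g' ->
  cac_deriv a b (fun x => f x * g x) (fun x => f x * g' x + f' x * g x).
Proof.
move=> ab [h1 h2] [k1 k2]; split.
  apply: ac_deriv_ext; first exact:
    (ac_deriv_add (ac_deriv_mul ab h1 k1) (ac_deriv_opp (ac_deriv_mul ab h2 k2))).
    by move=> x; rewrite cReM.
  by apply: aeW => x _ /=; rewrite !ReImE; ring.
apply: ac_deriv_ext; first exact:
  (ac_deriv_add (ac_deriv_mul ab h1 k2) (ac_deriv_mul ab h2 k1)).
  by move=> x; rewrite cImM.
by apply: aeW => x _ /=; rewrite !ReImE; ring.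
Qed.

Lemma cac_deriv_scale a b (c : C) f f' : a <= b -> cac_deriv a b f f' ->
  cac_deriv a b (fun x => c * f x) (fun x => c * f' x).
Proof.
move=> ab h; apply: cac_deriv_ext (cac_deriv_mul ab (cac_deriv_cst a b c) h) _ _ => //.
by apply: aeW => x _; rewrite mul0r addr0.
Qed.

Lemma cac_deriv_opp a b f f' : a <= b -> cac_deriv a b f f' ->
  cac_deriv a b (fun x => - f x) (fun x => - f' x).
Proof.
move=> ab h; apply: cac_deriv_ext (cac_deriv_scale (-1) ab h) _ _; first by move=> x;
  rewrite mulN1r.
by apply: aeW => x _; rewrite mulN1r.
Qed.

Lemma cac_deriv_subr a b f f' g g' : a <= b -> cac_deriv a b f f' -> cac_deriv a b g g' ->
  cac_deriv a b (fun x => f x - g x) (fun x => f' x - g' x).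
Proof. by move=> ab h1 h2; apply: cac_deriv_add h1 (cac_deriv_opp ab h2). Qed.

Lemma ac_deriv_nsq a b f f' : a <= b -> cac_deriv a b f f' ->
  ac_deriv a b (fun x => nsq (f x)) (fun x => 2 * dot (f x) (f' x)).
Proof.
move=> ab [h1 h2].
apply: ac_deriv_ext; first exact:
  (ac_deriv_add (ac_deriv_mul ab h1 h1) (ac_deriv_mul ab h2 h2)).
  by move=> x /=; rewrite /nsq !expr2.
by apply: aeW => x _ /=; rewrite /dot; ring.
Qed.

Lemma cac_deriv0_const a b f g : a <= b -> cac_deriv a b f g ->
  {ae mu, forall x, a < x < b -> g x = 0} -> f b = f a.
Proof.
move=> ab [h1 h2] g0.
have H (h k : R -> R) : ac_deriv a b h k -> {ae mu, forall x, a < x < b -> k x = 0} ->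
  h b = h a.
  move=> hk k0; apply/eqP; rewrite eq_le; apply/andP; split.
    by apply: (ac_deriv_nonincreasing ab hk); apply: (aeS k0) => x H /H ->.
  rewrite -lerN2; apply: (ac_deriv_nonincreasing ab (ac_deriv_opp hk)).
  by apply: (aeS k0) => x H /H ->; rewrite oppr0.
apply/eqP; rewrite eq_complex; apply/andP; split; apply/eqP.
  by apply: (H _ _ h1); apply: (aeS g0) => x H' /H' ->.
by apply: (H _ _ h2); apply: (aeS g0) => x H' /H' ->.
Qed.

End CAD.

(** * Energy estimates for the Sturm-Liouville equation *)

Section Sol.
Context {R : realType}.
Local Notation mu := (@lebesgue_measure R).
Local Notation C := R[i].
Implicit Types y q F : R -> C.

Lemma dotD (z w w' : C) : dot z (w + w') = dot z w + dot z w'.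
Proof. rewrite /dot !ReImE; ring. Qed.

Lemma dot_coef_le (z p w : C) : 2 * `|dot z (p * w)| <= (1 + nsq p) * (nsq z + nsq w).
Proof.
apply: le_trans (normr_dot2 _ _) _; rewrite nsqM.
have := mulr_ge0 (nsq_ge0 p) (nsq_ge0 z); have := nsq_ge0 w; lra.
Qed.

(** y'' = - l y + F with y1 = y'. The term q y of the Sturm-Liouville equation
    is kept in F, so that the same function solves several such equations: the
    spectral parameter can be shifted, and solutions for different potentials
    or parameters can be subtracted. *)
Definition forced_sol a b (l : C) F (y y1 : R -> C) :=
  cac_deriv a b y y1 /\ cac_deriv a b y1 (fun x => - l * y x + F x).

Definition energy (r : R) (y y1 : R -> C) (x : R) := nsq (y1 x) + r * nsq (y x).

Lemma forced_sol_sub a b a' b' l F y y1 : a <= a' -> b' <= b ->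
  forced_sol a b l F y y1 -> forced_sol a' b' l F y y1.
Proof. by move=> aa bb [h1 h2]; split; apply: cac_deriv_sub aa bb _. Qed.

Lemma forced_sol_ext a b l F F' y y1 : forced_sol a b l F y y1 ->
  {ae mu, forall x, a < x < b -> F x = F' x} -> forced_sol a b l F' y y1.
Proof.
move=> [h1 h2] FF; split => //; apply: cac_deriv_ext h2 _ _ => //.
by apply: (aeS FF) => x H /H ->.
Qed.

Lemma forced_sol_shift a b l m F y y1 : forced_sol a b l F y y1 ->
  forced_sol a b m (fun x => (m - l) * y x + F x) y y1.
Proof.
move=> [h1 h2]; split => //; apply: cac_deriv_ext h2 _ _ => //.
by apply: aeW => x _; ring.
Qed.

Lemma forced_sol_add a b l F F' y y1 z z1 : forced_sol a b l F y y1 ->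
  forced_sol a b l F' z z1 ->
  forced_sol a b l (fun x => F x + F' x) (fun x => y x + z x) (fun x => y1 x + z1 x).
Proof.
move=> [h1 h2] [k1 k2]; split; first exact: cac_deriv_add.
apply: cac_deriv_ext (cac_deriv_add h2 k2) _ _ => //.
by apply: aeW => x _; ring.
Qed.

Lemma forced_sol_scale a b l c F y y1 : a <= b -> forced_sol a b l F y y1 ->
  forced_sol a b l (fun x => c * F x) (fun x => c * y x) (fun x => c * y1 x).
Proof.
move=> ab [h1 h2]; split; first exact: cac_deriv_scale.
apply: cac_deriv_ext (cac_deriv_scale c ab h2) _ _ => //.
by apply: aeW => x _; ring.
Qed.

Lemma forced_sol_subr a b l F F' y y1 z z1 : a <= b -> forced_sol a b l F y y1 ->
  forced_sol a b l F' z z1 ->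
  forced_sol a b l (fun x => F x - F' x) (fun x => y x - z x) (fun x => y1 x - z1 x).
Proof.
move=> ab h /(forced_sol_scale (-1) ab) k; have [k1 k2] := forced_sol_add h k.
split.
  apply: cac_deriv_ext k1 _ _ => [x|]; first by rewrite mulN1r.
  by apply: aeW => x _; rewrite mulN1r.
apply: cac_deriv_ext k2 _ _ => [x|]; first by rewrite mulN1r.
by apply: aeW => x _; rewrite !mulN1r.
Qed.

(** The parameter rho^2 contributes to the derivative of the energy only
    through |rho|^2 - rho^2 = - 2 i rho Im rho, hence the exponential rate 2
    Im rho. *)
Lemma energy_derive a b (rho : C) F y y1 : a <= b -> 0 <= complex.Im rho ->
  forced_sol a b (rho ^+ 2) F y y1 ->
  exists2 X', ac_deriv a b (energy (nsq rho) y y1) X' &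
    forall x, `|X' x| <= 2 * complex.Im rho * energy (nsq rho) y y1 x
                         + 2 * `|dot (y1 x) (F x)|.
Proof.
move=> ab t0 [h1 h2].
exists (fun x => 2 * dot (y1 x) (- rho ^+ 2 * y x + F x) +
  nsq rho * (2 * dot (y x) (y1 x))).
  apply: ac_deriv_ext.
  - apply: (ac_deriv_add (ac_deriv_nsq ab h2)).
    exact: (ac_deriv_mul ab (ac_deriv_cst a b (nsq rho)) (ac_deriv_nsq ab h1)).
  - by [].
  - by apply: aeW => x _; rewrite mul0r addr0.
move=> x; set t := complex.Im rho in t0 *.
(* |rho|^2 - rho^2 = 2 t (t - i Re rho), where t = Im rho, and |t - i Re rho| =
   |rho|. *)
pose w : C := Complex t (- complex.Re rho) * y x.
have wE : nsq w = nsq rho * nsq (y x).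
  by rewrite nsqM; congr (_ * _); rewrite /nsq /= sqrrN addrC.
have -> : 2 * dot (y1 x) (- rho ^+ 2 * y x + F x) + nsq rho * (2 * dot (y x) (y1 x))
   = 4 * t * dot (y1 x) w + 2 * dot (y1 x) (F x).
  by rewrite dotD /w /dot /nsq /t !expr2 !ReImE /=; ring.
apply: le_trans (ler_normD _ _) _; apply: lerD; last by rewrite normrM gtr0_norm.
have := normr_dot2 (y1 x) w; rewrite wE /energy => h.
rewrite normrM ger0_norm; last by rewrite mulr_ge0.
have := ler_wpM2l t0 h; lra.
Qed.

Lemma energy_fwd a b (rho : C) F y y1 k kp (M : R) : a <= b -> 0 <= complex.Im rho ->
  forced_sol a b (rho ^+ 2) F y y1 -> ac_deriv a b k kp -> 0 <= M ->
  {ae mu, forall x, a < x < b -> 2 * `|dot (y1 x) (F x)| <=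
     kp x * (energy (nsq rho) y y1 x + M * expR (2 * complex.Im rho * (x - a)))} ->
  energy (nsq rho) y y1 b <=
    (energy (nsq rho) y y1 a + M) * expR (2 * complex.Im rho * (b - a)) * expR (k b - k a).
Proof.
move=> ab t0 hs dk M0 H; have [X' dX HX] := energy_derive ab t0 hs.
apply: (gronwall_fwd ab dX dk) => //.
apply: (aeS H) => x Hx /Hx {}Hx; apply: le_trans (ler_norm _) _.
by apply: le_trans (HX x) _; rewrite lerD2l.
Qed.

Lemma energy_bwd a b (rho : C) F y y1 k kp (M : R) : a <= b -> 0 <= complex.Im rho ->
  forced_sol a b (rho ^+ 2) F y y1 -> ac_deriv a b k kp -> 0 <= M ->
  {ae mu, forall x, a < x < b -> 2 * `|dot (y1 x) (F x)| <=
     kp x * (energy (nsq rho) y y1 x + M * expR (2 * complex.Im rho * (b - x)))} ->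
  energy (nsq rho) y y1 a <=
    (energy (nsq rho) y y1 b + M) * expR (2 * complex.Im rho * (b - a)) * expR (k b - k a).
Proof.
move=> ab t0 hs dk M0 H; have [X' dX HX] := energy_derive ab t0 hs.
apply: (gronwall_bwd ab dX dk) => //.
apply: (aeS H) => x Hx /Hx {}Hx; apply: le_trans (ler_norm _) _; rewrite normrN.
by apply: le_trans (HX x) _; rewrite lerD2l.
Qed.

(** A primitive of |q|^2 is all that the estimates need to know about q,
    because |q| <= 1 + |q|^2. *)
Definition sq_primitive T q (H : R -> R) := ac_deriv 0 T H (fun x => nsq (q x)).

Lemma sq_primitive_homo T q H u v : sq_primitive T q H -> 0 <= u -> u <= v -> v <= T ->
  H u <= H v.
Proof.
move=> hH u0 uv vT; rewrite -lerN2.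
apply: (ac_deriv_nonincreasing uv (ac_deriv_opp (ac_deriv_sub u0 vT hH))).
by apply: aeW => x _; rewrite oppr_le0 nsq_ge0.
Qed.

Definition param_const (T : R) H (B : R) := expR ((6 + 4 * B) * T + 2 * (H T - H 0)).

Lemma ac_deriv_affine a b (c : R) q H (e : R) : a <= b -> ac_deriv a b H (fun x =>
  nsq (q x)) ->
  ac_deriv a b (fun x => c * x + e * H x) (fun x => c + e * nsq (q x)).
Proof.
move=> ab h; apply: ac_deriv_ext.
- apply: ac_deriv_add; first exact:
  (ac_deriv_mul ab (ac_deriv_cst a b c) (ac_deriv_id a b)).
  exact: (ac_deriv_mul ab (ac_deriv_cst a b e) h).
- by [].
- by apply: aeW => x _; ring.
Qed.

(** The energy estimate for rho = 1, after the potential has absorbed 1 - l.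
    It holds from any initial point x0 to any point x. *)
Lemma param_bound T q H (l : C) (f y y1 : R -> C) (B M x0 x : R) :
  sq_primitive T q H -> forced_sol 0 T l (fun x => q x * y x + f x) y y1 ->
  nsq l <= B -> 0 <= M -> (forall x : R, 0 < x < T -> nsq (f x) <= M) ->
  0 <= x0 <= T -> 0 <= x <= T ->
  nsq (y1 x) + nsq (y x) <= (nsq (y1 x0) + nsq (y x0) + M) * param_const T H B.
Proof.
move=> hH hs lB M0 fM /andP[x00 x0T] /andP[x_0 xT].
(* The energy estimates are for a parameter of the form rho^2; here rho = 1 and
   Im rho = 0. *)
have {hs}hs := forced_sol_shift (1 ^+ 2) hs.
have B0 : 0 <= B := le_trans (nsq_ge0 _) lB.
pose k x := (6 + 4 * B) * x + 2 * H x.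
have bound (u v : R) : 0 <= u -> v <= T -> {ae mu, forall x, u < x < v ->
    forall e, 1 <= e ->
    2 * `|dot (y1 x) ((1 ^+ 2 - l) * y x + (q x * y x + f x))| <=
     (6 + 4 * B + 2 * nsq (q x)) * (energy (nsq 1) y y1 x + M * e)}.
  move=> u0 vT; apply: aeW => z /andP[uz zv] e e1.
  have := fM z; rewrite (le_lt_trans u0 uz) (lt_le_trans zv vT) => /(_ isT) fz.
  rewrite addrA -mulrDl dotD.
  have h1 := dot_coef_le (y1 z) (1 ^+ 2 - l + q z) (y z).
  have h2 := normr_dot2 (y1 z) (f z).
  have h3 := ler_normD (dot (y1 z) ((1 ^+ 2 - l + q z) * y z)) (dot (y1 z) (f z)).
  have h4 := nsqD_le (1 ^+ 2 - l) (q z); have h5 := nsqB_le (1 ^+ 2) l.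
  rewrite /energy nsq1 mul1r; rewrite expr1n nsq1 in h1 h3 h4 h5 *.
  set Y := nsq (y z) in h1 *; set Y1 := nsq (y1 z) in h1 h2 *.
  have Y0 : 0 <= Y by exact: nsq_ge0. have Y10 : 0 <= Y1 by exact: nsq_ge0.
  set p := nsq (1 - l + q z) in h1 h4; set Q := nsq (q z) in h4 *.
  have Q0 : 0 <= Q by exact: nsq_ge0.
  have h6 : (1 + p) * (Y1 + Y) <= (5 + 4 * B + 2 * Q) * (Y1 + Y).
    by apply: ler_wpM2r; lra.
  have h7 : 0 <= (5 + 4 * B + 2 * Q) * (M * e).
    by rewrite mulr_ge0//; [lra|rewrite mulr_ge0//; lra].
  have h8 : M <= M * e by rewrite ler_peMr.
  lra.
have dk (u v : R) : 0 <= u -> u <= v -> v <= T -> ac_deriv u v k (fun x =>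
  6 + 4 * B + 2 * nsq (q x)).
  by move=> u0 uv vT; apply: ac_deriv_affine => //; exact: ac_deriv_sub hH.
have kmono (u v : R) : 0 <= u -> u <= v -> v <= T -> expR (k v - k u) <= param_const T H B.
  move=> u0 uv vT; rewrite ler_expR /k.
  have := sq_primitive_homo hH (lexx 0) u0 (le_trans uv vT).
  have := sq_primitive_homo hH (le_trans u0 uv) vT (lexx T).
  have : (6 + 4 * B) * (v - u) <= (6 + 4 * B) * T by apply: ler_wpM2l; lra.
  lra.
have e1 (s : R) : (1 : R) <= expR (2 * complex.Im (1 :
  C) * s) by rewrite /= mulr0 mul0r expR0.
have pos : 0 <= nsq (y1 x0) + nsq (y x0) + M by apply: addr_ge0 => //; apply: addr_ge0;
  exact: nsq_ge0.
have [xx|xx] := leP x0 x.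
  have hs' := forced_sol_sub x00 xT hs.
  have := @energy_fwd x0 x (1 : C) _ _ _ _ _ M xx (lexx 0) hs' (dk _ _ x00 xx xT) M0 _.
  rewrite /energy nsq1 /= !mulr0 !mul0r !expR0 !mulr1 !mul1r => h.
  apply: le_trans (h _) _; last by apply: ler_wpM2l => //; exact: kmono.
  apply: (aeS (bound _ _ x00 xT)) => z Hz /Hz; move=> /(_ _ (e1 (z - x0))).
  by rewrite /energy nsq1 /= !mulr0 !mul0r !expR0 !mulr1 !mul1r.
have {}xx := ltW xx; have hs' := forced_sol_sub x_0 x0T hs.
have := @energy_bwd x x0 (1 : C) _ _ _ _ _ M xx (lexx 0) hs' (dk _ _ x_0 xx x0T) M0 _.
rewrite /energy nsq1 /= !mulr0 !mul0r !expR0 !mulr1 !mul1r => h.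
apply: le_trans (h _) _; last by apply: ler_wpM2l => //; exact: kmono.
apply: (aeS (bound _ _ x_0 x0T)) => z Hz /Hz; move=> /(_ _ (e1 (x0 - z))).
by rewrite /energy nsq1 /= !mulr0 !mul0r !expR0 !mulr1 !mul1r.
Qed.

Definition growth_const (T : R) (H : R -> R) := expR (T + (H T - H 0)).

Lemma growth_const_ge T q H u v : sq_primitive T q H -> 0 <= u -> u <= v -> v <= T ->
  expR ((v + H v) - (u + H u)) <= growth_const T H.
Proof.
move=> hH u0 uv vT; rewrite ler_expR.
have := sq_primitive_homo hH (lexx 0) u0 (le_trans uv vT).
have := sq_primitive_homo hH (le_trans u0 uv) vT (lexx T); lra.
Qed.

Lemma ac_deriv_id_add a b q H : a <= b -> ac_deriv a b H (fun x => nsq (q x)) ->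
  ac_deriv a b (fun x => x + H x) (fun x => 1 + nsq (q x)).
Proof. by move=> ab h; apply: ac_deriv_add; [exact: ac_deriv_id|]. Qed.

Lemma dot_coef_energy (rho p z w : C) : 1 <= nsq rho ->
  2 * `|dot z (p * w)| <= (1 + nsq p) * (nsq z + nsq rho * nsq w).
Proof.
move=> r1; apply: le_trans (dot_coef_le _ _ _) _; apply: ler_wpM2l.
  by rewrite addr_ge0 ?nsq_ge0.
by rewrite lerD2l ler_peMl ?nsq_ge0.
Qed.

(** For |rho| >= 1 the integral of the potential enters the bound only through
    a constant, and the exponential rate is exactly that of the free equation. *)
Lemma energy_growth_fwd T q H (rho : C) y y1 x :
  sq_primitive T q H -> forced_sol 0 T (rho ^+ 2) (fun x => q x * y x) y y1 ->
  0 <= complex.Im rho -> 1 <= nsq rho -> 0 <= x <= T ->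
  energy (nsq rho) y y1 x <=
    energy (nsq rho) y y1 0 * growth_const T H * expR (2 * complex.Im rho * x).
Proof.
move=> hH hs t0 r1 /andP[x0 xT].
have := energy_fwd x0 t0 (forced_sol_sub (lexx 0) xT hs) (ac_deriv_id_add x0
  (ac_deriv_sub (lexx 0) xT hH)) (lexx 0) _.
rewrite !addr0 subr0 => h; apply: le_trans (h _) _.
  apply: aeW => z _; rewrite mul0r addr0; exact: dot_coef_energy.
rewrite mulrAC; apply: ler_wpM2r; first exact: expR_ge0.
apply: ler_wpM2l; first by rewrite addr_ge0// ?mulr_ge0 ?nsq_ge0.
by have := growth_const_ge hH (lexx 0) x0 xT; rewrite add0r.
Qed.

Lemma energy_growth_bwd T q H (rho : C) y y1 x :
  sq_primitive T q H -> forced_sol 0 T (rho ^+ 2) (fun x => q x * y x) y y1 ->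
  0 <= complex.Im rho -> 1 <= nsq rho -> 0 <= x <= T ->
  energy (nsq rho) y y1 x <=
    energy (nsq rho) y y1 T * growth_const T H * expR (2 * complex.Im rho * (T - x)).
Proof.
move=> hH hs t0 r1 /andP[x0 xT].
have := energy_bwd xT t0 (forced_sol_sub x0 (lexx T) hs) (ac_deriv_id_add xT
  (ac_deriv_sub x0 (lexx T) hH)) (lexx 0) _.
rewrite !addr0 => h; apply: le_trans (h _) _.
  apply: aeW => z _; rewrite mul0r addr0; exact: dot_coef_energy.
rewrite mulrAC; apply: ler_wpM2r; first exact: expR_ge0.
apply: ler_wpM2l; first by rewrite addr_ge0// ?mulr_ge0 ?nsq_ge0.
exact: growth_const_ge hH x0 xT (lexx T).
Qed.

(** The difference of two solutions with the same data (0, 1) at 0 solves the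
    free equation with forcing term q y - q' z, which is smaller than the
    derivatives of y and z by a factor |rho|; so the difference is of one
    order less. *)
Lemma solution_diff_bound T q q' H H' (rho : C) y y1 z z1 x :
  sq_primitive T q H -> sq_primitive T q' H' ->
  forced_sol 0 T (rho ^+ 2) (fun x => q x * y x) y y1 ->
  forced_sol 0 T (rho ^+ 2) (fun x => q' x * z x) z z1 ->
  y 0 = 0 -> y1 0 = 1 -> z 0 = 0 -> z1 0 = 1 ->
  0 <= complex.Im rho -> 1 <= nsq rho -> 0 <= x <= T ->
  nsq (y1 x - z1 x) + nsq rho * nsq (y x - z x) <=
    (growth_const T H + growth_const T H') * growth_const T H * growth_const T H' / nsq
      rho * expR (2 * complex.Im rho * x).
Proof.
move=> hH hH' hy hz y0 y10 z0 z10 t0 r1 /andP[x0 xT].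
have T0 := le_trans x0 xT.
have r0 : 0 < nsq rho by lra.
have K0 : 0 < growth_const T H by exact: expR_gt0.
have K'0 : 0 < growth_const T H' by exact: expR_gt0.
have ds := forced_sol_sub (lexx 0) xT (forced_sol_subr T0 hy hz).
pose M := (growth_const T H + growth_const T H') / nsq rho.
have M0 : 0 <= M by apply: divr_ge0; lra.
have dk : ac_deriv 0 x (fun x => (x + H x) + (x + H' x)) (fun x =>
  (1 + nsq (q x)) + (1 + nsq (q' x))).
  by apply: ac_deriv_add; apply: ac_deriv_id_add => //; apply: ac_deriv_sub (lexx 0) xT _.
have := energy_fwd x0 t0 ds dk M0 _.
rewrite /energy y0 y10 z0 z10 !subrr nsq0 mulr0 addr0 add0r subr0 => h.
apply: le_trans (h _) _; last first.
  rewrite mulrAC; apply: ler_wpM2r; first exact: expR_ge0.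
  have -> : (growth_const T H + growth_const T H') * growth_const T H * growth_const T H'
    / nsq rho = M * (growth_const T H * growth_const T H').
    by rewrite /M; field; rewrite gt_eqF.
  apply: ler_wpM2l => //.
  have -> : x + H x + (x + H' x) - (0 + H 0 + (0 + H' 0)) =
    ((x + H x) - (0 + H 0)) + ((x + H' x) - (0 + H' 0)) by ring.
  rewrite expRD; apply: ler_pM; rewrite ?expR_ge0//.
    exact: (growth_const_ge hH (lexx 0) x0 xT).
  exact: (growth_const_ge hH' (lexx 0) x0 xT).
apply: aeW => u /andP[u0 ux]; rewrite subr0.
set E := expR _.
have uT : 0 <= u <= T by rewrite (ltW u0) (le_trans (ltW ux) xT).
have E0 : 0 < E by exact: expR_gt0.
have by_ : nsq (y u) <= M * E.
  have := energy_growth_fwd hH hy t0 r1 uT.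
  rewrite /energy y0 y10 nsq0 nsq1 mulr0 addr0 mul1r -/E => h1.
  rewrite /M -(ler_pM2l r0).
  have -> : nsq rho * ((growth_const T H + growth_const T H') / nsq rho * E) =
    (growth_const T H + growth_const T H') * E.
    by field; rewrite gt_eqF.
  have := nsq_ge0 (y1 u); have := mulr_gt0 K'0 E0; lra.
have bz_ : nsq (z u) <= M * E.
  have := energy_growth_fwd hH' hz t0 r1 uT.
  rewrite /energy z0 z10 nsq0 nsq1 mulr0 addr0 mul1r -/E => h1.
  rewrite /M -(ler_pM2l r0).
  have -> : nsq rho * ((growth_const T H + growth_const T H') / nsq rho * E) =
    (growth_const T H + growth_const T H') * E.
    by field; rewrite gt_eqF.
  have := nsq_ge0 (z1 u); have := mulr_gt0 K0 E0; lra.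
have h1 := dot_coef_le (y1 u - z1 u) (q u) (y u).
have h2 := dot_coef_le (y1 u - z1 u) (- q' u) (z u).
rewrite nsqN in h2.
have -> : q u * y u - q' u * z u = q u * y u + - q' u * z u by rewrite mulNr.
rewrite dotD.
have h3 := ler_normD (dot (y1 u - z1 u) (q u * y u)) (dot (y1 u - z1 u) (- q' u * z u)).
have h4 : 0 <= nsq rho * nsq (y u - z u) by rewrite mulr_ge0 ?nsq_ge0.
have h5 : (1 + nsq (q u)) * (nsq (y1 u - z1 u) + nsq (y u)) <=
   (1 + nsq (q u)) * (nsq (y1 u - z1 u) + nsq rho * nsq (y u - z u) + M * E).
  by apply: ler_wpM2l; [rewrite addr_ge0 ?nsq_ge0|lra].
have h6 : (1 + nsq (q' u)) * (nsq (y1 u - z1 u) + nsq (z u)) <=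
   (1 + nsq (q' u)) * (nsq (y1 u - z1 u) + nsq rho * nsq (y u - z u) + M * E).
  by apply: ler_wpM2l; [rewrite addr_ge0 ?nsq_ge0|lra].
lra.
Qed.

End Sol.

(** * Functions with zero derivative off a countable set *)

Section Countable.
Context {R : realType}.

(** Cousin's lemma once more. At a point s_m no derivative is available; the
    oscillation of f near it is paid for by the weight w_N, which increases by
    at least 2^-m on every nondegenerate interval that contains s_m, even as
    an endpoint. *)
Lemma const_off_countable (f : R -> R) (s : nat -> R) (a b : R) : a <= b ->
  (forall x : R, a <= x <= b -> forall e : R, 0 < e -> exists2 d : R, 0 < d &
     forall y : R, a <= y <= b -> `|y - x| < d -> `|f y - f x| <= e) ->
  (forall x : R, a <= x <= b -> (forall n, x != s n) ->
     forall e : R, 0 < e -> exists2 d : R, 0 < d &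
     forall y : R, a <= y <= b -> `|y - x| < d -> `|f y - f x| <= e * `|y - x|) ->
  f b = f a.
Proof.
move=> ab cf df.
(* Both comparisons are needed: the strict one jumps when s_n is the left
   endpoint of an interval, the other one when it is the right endpoint. *)
pose w N (x : R) : R := \sum_(n < N) 2^-1 ^+ n * ((s n < x)%R%:R + (s n <= x)%R%:R).
have term0 n (u v : R) : u <= v ->
  0 <= 2^-1 ^+ n * ((s n < v)%R%:R + (s n <= v)%R%:R) - 2^-1 ^+ n * ((s n < u)%R%:R +
    (s n <= u)%R%:R) :> R.
  move=> uv; rewrite -mulrBr; apply: mulr_ge0; first by rewrite exprn_ge0// invr_ge0.
  by case: (ltgtP (s n) u) => h; case: (ltgtP (s n) v) => k /=; lra.
have wmono N (u v : R) : u <= v -> 0 <= w N v - w N u.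
  by move=> uv; rewrite -sumrB; apply: sumr_ge0 => n _; exact: term0.
have wjump N m (u v : R) : (m < N)%N -> u < v -> u <= s m <= v ->
  2^-1 ^+ m <= w N v - w N u.
  move=> mN uv /andP[us sv]; rewrite -sumrB (bigD1 (Ordinal mN)) //=.
  apply: ler_wpDr; first by apply: sumr_ge0 => n _; exact: (term0 _ _ _ (ltW uv)).
  rewrite -mulrBr ler_peMr ?exprn_ge0 ?invr_ge0//.
  rewrite sv (ltNge (s m) u) us /= add0r.
  have [su|su] := leP (s m) u; last by case: (s m < v) => /=; lra.
  by rewrite (le_lt_trans su uv) /=; lra.
have wbound N : w N b - w N a <= 4.
  have h : forall N, \sum_(n < N) 2^-1 ^+ n = 2 - 2 * 2^-1 ^+ N :> R.
    elim=> [|n IH]; first by rewrite big_ord0 expr0; lra.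
    by rewrite big_ord_recr /= IH exprS; lra.
  rewrite -sumrB; apply: (@le_trans _ _ (\sum_(n < N) 2^-1 ^+ n * 2)).
    apply: ler_sum => n _; rewrite -mulrBr ler_wpM2l ?exprn_ge0 ?invr_ge0//.
    by case: (s n < b); case: (s n <= b); case: (s n < a); case: (s n <= a) => /=; lra.
  rewrite -mulr_suml h; have : 0 <= (2^-1 : R) ^+ N by rewrite exprn_ge0// invr_ge0.
  lra.
suff H (e : R) : 0 < e -> `|f b - f a| <= e * (b - a) + e * 4.
  apply/eqP; rewrite -subr_eq0 -normr_le0; apply/ler_addgt0Pr => e e0; rewrite add0r.
  have p : 0 < b - a + 4 by lra.
  have := H (e / (b - a + 4)) (divr_gt0 e0 p).
  have -> : e / (b - a + 4) * (b - a) + e / (b - a + 4) * 4 = e by field; lra.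
  by [].
move=> e0.
have [N0 HN] : exists N0, forall N, (N0 <= N)%N ->
  `|f b - f a| <= e * (b - a) + e * (w N b - w N a).
  apply: (@cousin R a b (fun u v => exists N0, forall N, (N0 <= N)%N ->
     `|f v - f u| <= e * (v - u) + e * (w N v - w N u))) => //.
  - move=> u v t _ uv vt _ [N1 H1] [N2 H2]; exists (maxn N1 N2) => N.
    rewrite geq_max => /andP[/H1 h1 /H2 h2].
    have -> : f t - f u = (f t - f v) + (f v - f u) by ring.
    apply: le_trans (ler_normD _ _) _; lra.
  - move=> x xab; have [[m xm]|nx] := pselect (exists m, x = s m).
    + have e'0 : 0 < e * 2^-1 ^+ m / 2.
        by rewrite divr_gt0// mulr_gt0// exprn_gt0// invr_gt0.
      have [d d0 Hd] := cf x xab _ e'0.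
      exists d => // u v au ux xv vb ru rv; exists m.+1 => N mN.
      have uv := le_trans ux xv.
      have [->|nuv] := eqVneq u v; first by rewrite !subrr normr0 !mulr0 addr0.
      have {nuv} uv' : u < v by rewrite lt_neqAle nuv uv.
      have hj := wjump N m u v mN uv'; rewrite -xm ux xv in hj.
      have {}hj := ler_wpM2l (ltW e0) (hj isT).
      have hu : `|f u - f x| <= e * 2^-1 ^+ m / 2 by apply: Hd; [lra|rewrite ltr_distlC;
        lra].
      have hv : `|f v - f x| <= e * 2^-1 ^+ m / 2 by apply: Hd; [lra|rewrite ltr_distlC;
        lra].
      have -> : f v - f u = (f v - f x) - (f u - f x) by ring.
      apply: le_trans (ler_normB _ _) _.
      have : 0 <= e * (v - u) by rewrite mulr_ge0//; lra.
      lra.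
    + have nx' n : x != s n by apply/eqP => xs; apply: nx; exists n.
      have [d d0 Hd] := df x xab nx' _ e0.
      exists d => // u v au ux xv vb ru rv; exists 0%N => N _.
      have hu : `|f u - f x| <= e * `|u - x| by apply: Hd; [lra|rewrite ltr_distlC; lra].
      have hv : `|f v - f x| <= e * `|v - x| by apply: Hd; [lra|rewrite ltr_distlC; lra].
      rewrite (ler0_norm (x := u - x)) in hu; last lra.
      rewrite (ger0_norm (x := v - x)) in hv; last lra.
      have hw := mulr_ge0 (ltW e0) (wmono N _ _ (le_trans ux xv)).
      have -> : f v - f u = (f v - f x) - (f u - f x) by ring.
      apply: le_trans (ler_normB _ _) _; lra.
apply: le_trans (HN N0 (leqnn _)) _; rewrite lerD2l ler_wpM2l//; exact: ltW.
Qed.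

End Countable.

(** * Holomorphic functions *)

Section Nrm.
Context {R : realType}.
Local Notation C := R[i].
Implicit Types (z w : C) (f g : C -> C).

(** The modulus as a real number; the norm of R[i] takes its values in R[i]. *)
Definition nrm z : R := Num.sqrt (nsq z).

Lemma nrm_ge0 z : 0 <= nrm z. Proof. exact: sqrtr_ge0. Qed.
Lemma nrm_sqr z : nrm z ^+ 2 = nsq z. Proof. by rewrite sqr_sqrtr// nsq_ge0. Qed.
Lemma nrmM z w : nrm (z * w) = nrm z * nrm w.
Proof. by rewrite /nrm nsqM sqrtrM// nsq_ge0. Qed.
Lemma nrmN z : nrm (- z) = nrm z. Proof. by rewrite /nrm nsqN. Qed.
Lemma nrmV z : nrm z^-1 = (nrm z)^-1.
Proof. by rewrite /nrm nsqV sqrtrV// nsq_ge0. Qed.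
Lemma nrm0 : nrm 0 = 0. Proof. by rewrite /nrm nsq0 sqrtr0. Qed.
Lemma nrm_eq0 z : (nrm z == 0) = (z == 0).
Proof. by rewrite sqrtr_eq0 -nsq_eq0 eq_le nsq_ge0 andbT. Qed.
Lemma nrm_gt0 z : (0 < nrm z) = (z != 0).
Proof. by rewrite lt_def nrm_eq0 nrm_ge0 andbT. Qed.
Lemma nrmD z w : nrm (z + w) <= nrm z + nrm w.
Proof.
have h : dot z w <= nrm z * nrm w.
  apply: le_trans (ler_norm _) _.
  by rewrite -sqrtr_sqr /nrm -sqrtrM ?nsq_ge0// ler_wsqrtr// dot_sqr.
rewrite -(@ler_pXn2r _ 2)// ?nnegrE ?nrm_ge0 ?addr_ge0 ?nrm_ge0//.
rewrite sqrrD !nrm_sqr.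
have -> : nsq (z + w) = nsq z + 2 * dot z w + nsq w by rewrite /nsq /dot !ReImE; ring.
lra.
Qed.
Lemma nrmB z w : nrm (z - w) <= nrm z + nrm w.
Proof. by apply: le_trans (nrmD _ _) _; rewrite nrmN. Qed.
Lemma nrm_dist z w : nrm (z - w) = nrm (w - z).
Proof. by rewrite -nrmN opprB. Qed.
Lemma nrm_tri u z w : nrm (z - w) <= nrm (z - u) + nrm (u - w).
Proof. by rewrite -[X in nrm X](subrKA u); exact: nrmD. Qed.
Lemma Re_le_nrm z : `|complex.Re z| <= nrm z.
Proof. by rewrite -sqrtr_sqr ler_wsqrtr// lerDl sqr_ge0. Qed.
Lemma Im_le_nrm z : `|complex.Im z| <= nrm z.
Proof. by rewrite -sqrtr_sqr ler_wsqrtr// lerDr sqr_ge0. Qed.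
Lemma Re_dist z w : `|complex.Re z - complex.Re w| <= nrm (z - w).
Proof. by rewrite -cReN -cReD; exact: Re_le_nrm. Qed.
Lemma Im_dist z w : `|complex.Im z - complex.Im w| <= nrm (z - w).
Proof. by rewrite -cImN -cImD; exact: Im_le_nrm. Qed.
Lemma nrm_le_ReIm z : nrm z <= `|complex.Re z| + `|complex.Im z|.
Proof.
rewrite -(@ler_pXn2r _ 2)// ?nnegrE ?nrm_ge0 ?addr_ge0//.
rewrite nrm_sqr /nsq -(real_normK (num_real (complex.Re z))) -(real_normK (num_real
  (complex.Im z))).
rewrite sqrrD; have := mulr_ge0 (normr_ge0 (complex.Re z)) (normr_ge0 (complex.Im z)); lra.
Qed.
Lemma norm_nrm z : `|z| = (nrm z)%:C%C. Proof. exact: normc_def. Qed.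

(** Holomorphy in a strong form: the first-order expansion holds uniformly
    around z, with a quadratic error. It implies that f' is Lipschitz around
    z, and it is stable under algebraic operations by elementary estimates. *)
Definition holo_at f f' (z : C) := exists2 d : R, 0 < d & exists K : R,
  forall w w', nrm (w - z) < d -> nrm (w' - z) < d ->
    [/\ nrm (f w) <= K, nrm (f' w) <= K &
        nrm (f w' - f w - f' w * (w' - w)) <= K * nrm (w' - w) ^+ 2].

Lemma holo_atP f f' z : holo_at f f' z ->
  exists2 d : R, 0 < d <= 1/2 & exists2 K : R, 1 <= K &
  forall w w', nrm (w - z) < d -> nrm (w' - z) < d ->
    [/\ nrm (f w) <= K, nrm (f' w) <= K,
        nrm (f w' - f w - f' w * (w' - w)) <= K * nrm (w' - w) ^+ 2 &
        nrm (f w' - f w) <= 2 * K * nrm (w' - w)].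
Proof.
move=> [d d0 [K HK]]; exists (Num.min d (1/2)).
  by rewrite lt_min d0 ge_min lexx orbT andbT /=; lra.
exists (Num.max K 1); first by rewrite le_max lexx orbT.
move=> w w'; rewrite !lt_min => /andP[wd w1] /andP[wd' w1'].
have [h1 h2 h3] := HK w w' wd wd'.
have KM : K <= Num.max K 1 by rewrite le_max lexx.
have h2' := le_trans h2 KM.
have h3' : nrm (f w' - f w - f' w * (w' - w)) <= Num.max K 1 * nrm (w' - w) ^+ 2.
  by apply: le_trans h3 _; rewrite ler_wpM2r ?sqr_ge0.
split => //; first exact: le_trans h1 KM.
set M := Num.max K 1 in h2' h3' *.
have M0 : 0 <= M by apply: le_trans (nrm_ge0 _) h2'.
have hh : nrm (w' - w) <= 1 by have := nrm_tri z w' w; rewrite (nrm_dist z w); lra.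
have -> : f w' - f w = (f w' - f w - f' w * (w' - w)) + f' w * (w' - w) by ring.
apply: le_trans (nrmD _ _) _; rewrite nrmM.
have n0 := nrm_ge0 (w' - w).
have := ler_wpM2r n0 h2'.
have : M * nrm (w' - w) ^+ 2 <= M * nrm (w' - w).
  by rewrite ler_wpM2l// expr2 ler_piMl.
lra.
Qed.

Lemma holo_at_cst c z : holo_at (fun=> c) (fun=> 0) z.
Proof.
exists 1 => //; exists (nrm c) => w w' _ _; rewrite nrm0 mul0r !subrr nrm0.
by rewrite nrm_ge0 mulr_ge0 ?nrm_ge0 ?sqr_ge0; split.
Qed.

Lemma holo_at_ext f f' g g' z : holo_at f f' z ->
  (exists2 d : R, 0 < d & forall w, nrm (w - z) < d -> f w = g w /\ f' w = g' w) ->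
  holo_at g g' z.
Proof.
move=> [d d0 [K HK]] [e e0 He]; exists (Num.min d e); first by rewrite lt_min d0.
exists K => w w'; rewrite !lt_min => /andP[wd we] /andP[wd' we'].
by have [<- <-] := He _ we; have [<- _] := He _ we'; exact: HK.
Qed.

Lemma holo_at_add f f' g g' z : holo_at f f' z -> holo_at g g' z ->
  holo_at (fun w => f w + g w) (fun w => f' w + g' w) z.
Proof.
move=> [d d0 [K HK]] [e e0 [L HL]]; exists (Num.min d e); first by rewrite lt_min d0.
exists (K + L) => w w'; rewrite !lt_min => /andP[wd we] /andP[wd' we'].
have [h1 h2 h3] := HK _ _ wd wd'; have [k1 k2 k3] := HL _ _ we we'.
split; [exact: le_trans (nrmD _ _) (lerD h1 k1)|exact: le_trans (nrmD _ _) (lerD h2 k2)|].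
have -> : f w' + g w' - (f w + g w) - (f' w + g' w) * (w' - w) =
  (f w' - f w - f' w * (w' - w)) + (g w' - g w - g' w * (w' - w)) by ring.
by apply: le_trans (nrmD _ _) _; rewrite mulrDl lerD.
Qed.

Lemma holo_at_mul f f' g g' z : holo_at f f' z -> holo_at g g' z ->
  holo_at (fun w => f w * g w) (fun w => f' w * g w + f w * g' w) z.
Proof.
move=> /holo_atP[d /andP[d0 _] [K K1 HK]] /holo_atP[e /andP[e0 _] [L L1 HL]].
exists (Num.min d e); first by rewrite lt_min d0.
exists (4 * (K * L)) => w w'; rewrite !lt_min => /andP[wd we] /andP[wd' we'].
have [h1 h2 h3 h4] := HK _ _ wd wd'; have [k1 k2 k3 k4] := HL _ _ we we'.
have [k1' _ _ _] := HL _ _ we' we.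
have KL : 0 <= K * L by rewrite mulr_ge0//; lra.
have pm (x y a b : R) : 0 <= x -> 0 <= y -> x <= a -> y <= b -> x * y <= a * b.
  by move=> *; exact: ler_pM.
split.
- by rewrite nrmM; have := pm _ _ _ _ (nrm_ge0 _) (nrm_ge0 _) h1 k1; lra.
- apply: le_trans (nrmD _ _) _; rewrite !nrmM.
  have := pm _ _ _ _ (nrm_ge0 _) (nrm_ge0 _) h2 k1.
  have := pm _ _ _ _ (nrm_ge0 _) (nrm_ge0 _) h1 k2; lra.
set h := w' - w in h3 h4 k3 k4 *.
have -> : f w' * g w' - f w * g w - (f' w * g w + f w * g' w) * h =
  (f w' - f w - f' w * h) * g w' + f' w * h * (g w' - g w) + f w * (g w' - g w - g' w * h).
  ring.
have n0 := nrm_ge0 h; have n2 := sqr_ge0 (nrm h).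
apply: le_trans (nrmD _ _) _; apply: le_trans (lerD (nrmD _ _) (lexx _)) _.
rewrite !nrmM.
have q1 := pm _ _ _ _ (nrm_ge0 _) (nrm_ge0 _) h3 k1'.
have q2 := pm _ _ _ _ (mulr_ge0 (nrm_ge0 _) n0) (nrm_ge0 _) (ler_wpM2r n0 h2) k4.
have q3 := pm _ _ _ _ (nrm_ge0 _) (nrm_ge0 _) h1 k3.
rewrite expr2 in q1 q3 *; lra.
Qed.

Lemma holo_at_opp f f' z : holo_at f f' z -> holo_at (fun w => - f w) (fun w => - f' w) z.
Proof.
move=> h; apply: holo_at_ext (holo_at_mul (holo_at_cst (-1) z) h) _.
by exists 1 => // w _; rewrite mul0r add0r !mulN1r.
Qed.

Lemma holo_at_sub f f' g g' z : holo_at f f' z -> holo_at g g' z ->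
  holo_at (fun w => f w - g w) (fun w => f' w - g' w) z.
Proof. by move=> h k; apply: holo_at_add h (holo_at_opp k). Qed.

Lemma holo_at_cont f f' z : holo_at f f' z -> forall e : R, 0 < e ->
  exists2 d : R, 0 < d & forall w, nrm (w - z) < d -> nrm (f w - f z) < e.
Proof.
move=> /holo_atP[d /andP[d0 _] [K K1 HK]] e e0.
have p : 0 < 2 * K by lra.
exists (Num.min d (e / (2 * K))); first by rewrite lt_min d0 divr_gt0.
move=> w; rewrite lt_min => /andP[wd we].
have [_ _ _ h] := HK z w ltac:(by rewrite subrr nrm0) wd.
apply: le_lt_trans h _; rewrite mulrC -ltr_pdivlMr//.
Qed.

Lemma holo_at_neq0 f f' z : holo_at f f' z -> f z != 0 ->
  exists2 d : R, 0 < d & forall w, nrm (w - z) < d -> nrm (f z) / 2 <= nrm (f w).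
Proof.
move=> hf fz; have p : 0 < nrm (f z) / 2 by rewrite divr_gt0// nrm_gt0.
have [d d0 H] := holo_at_cont hf p; exists d => // w /H h.
have := nrmD (f w) (f z - f w); rewrite (addrC (f w)) subrK (nrm_dist (f z)); lra.
Qed.

Lemma holo_at_inv f f' z : holo_at f f' z -> f z != 0 ->
  holo_at (fun w => (f w)^-1) (fun w => - f' w / f w ^+ 2) z.
Proof.
move=> hf fz; have [e e0 He] := holo_at_neq0 hf fz.
have /holo_atP[d /andP[d0 _] [K K1 HK]] := hf.
set c := nrm (f z) / 2 in He.
have c0 : 0 < c by rewrite divr_gt0// nrm_gt0.
exists (Num.min d e); first by rewrite lt_min d0.
exists (c^-1 + K / c ^+ 2 + 3 * K ^+ 2 / c ^+ 3) => w w'.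
rewrite !lt_min => /andP[wd /He cw] /andP[wd' /He cw'].
have [h1 h2 h3 h4] := HK _ _ wd wd'.
have t1 : 0 <= c^-1 by rewrite invr_ge0 ltW.
have t2 : 0 <= K / c ^+ 2 by apply: divr_ge0; [lra|exact/exprn_ge0/ltW].
have t3 : 0 <= 3 * K ^+ 2 / c ^+ 3 by apply: divr_ge0; [apply: mulr_ge0 => //;
  exact: sqr_ge0|exact/exprn_ge0/ltW].
have a0 : 0 < nrm (f w) by exact: lt_le_trans cw.
have a'0 : 0 < nrm (f w') by exact: lt_le_trans cw'.
have fw0 : f w != 0 by rewrite -nrm_gt0.
have fw'0 : f w' != 0 by rewrite -nrm_gt0.
have i1 : (nrm (f w))^-1 <= c^-1 by rewrite lef_pV2.
have i1' : (nrm (f w'))^-1 <= c^-1 by rewrite lef_pV2.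
have j0 : 0 <= (nrm (f w))^-1 by rewrite invr_ge0 ltW.
have j0' : 0 <= (nrm (f w'))^-1 by rewrite invr_ge0 ltW.
have i2 : (nrm (f w))^-1 ^+ 2 <= c^-1 ^+ 2 by rewrite ler_pXn2r.
split.
- rewrite nrmV; lra.
- rewrite expr2 invfM mulNr nrmN !nrmM !nrmV -expr2.
  suff : nrm (f' w) * (nrm (f w))^-1 ^+ 2 <= K / c ^+ 2 by lra.
  by rewrite -exprVn; apply: ler_pM => //; [exact: nrm_ge0|exact: sqr_ge0].
set h := w' - w in h3 h4 *.
have -> : (f w')^-1 - (f w)^-1 - - f' w / f w ^+ 2 * h =
  (f' w * h * (f w' - f w) - f w * (f w' - f w - f' w * h)) * (f w)^-1 ^+ 2 * (f w')^-1.
  by field; rewrite fw0 fw'0.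
rewrite (nrmM _ (f w')^-1) nrmM.
have -> : nrm ((f w)^-1 ^+ 2) = (nrm (f w))^-1 ^+ 2 by rewrite !expr2 nrmM nrmV.
rewrite nrmV.
have n0 := nrm_ge0 h; have n2 := sqr_ge0 (nrm h).
have q : nrm (f' w * h * (f w' - f w) - f w * (f w' - f w - f' w * h)) <=
  3 * K ^+ 2 * nrm h ^+ 2.
  apply: le_trans (nrmB _ _) _; rewrite !nrmM.
  have q2 := ler_pM (mulr_ge0 (nrm_ge0 _) n0) (nrm_ge0 _) (ler_wpM2r n0 h2) h4.
  have q3 := ler_pM (nrm_ge0 _) (nrm_ge0 _) h1 h3.
  rewrite !expr2 in q3 *; lra.
have q' := ler_pM (mulr_ge0 (nrm_ge0 _) (sqr_ge0 _)) j0' (ler_pM (nrm_ge0 _) (sqr_ge0 _)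
  q i2) i1'.
apply: le_trans q' _.
have -> : 3 * K ^+ 2 * nrm h ^+ 2 * c^-1 ^+ 2 / c = 3 * K ^+ 2 / c ^+ 3 * nrm h ^+ 2.
  by field; rewrite gt_eqF.
rewrite ler_wpM2r//; lra.
Qed.

(** Add the expansions at w and at w', with the roles exchanged: the values of
    f cancel. *)
Lemma holo_at_deriv_lip f f' z : holo_at f f' z ->
  exists2 d : R, 0 < d & exists2 K : R, 0 <= K &
  forall w w', nrm (w - z) < d -> nrm (w' - z) < d ->
    nrm (f' w' - f' w) <= K * nrm (w' - w).
Proof.
move=> /holo_atP[d /andP[d0 _] [K K1 HK]]; exists d => //; exists (2 * K); first by lra.
move=> w w' wd wd'; have [->|nw] := eqVneq w' w; first by rewrite !subrr nrm0 mulr0.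
have [_ _ h1 _] := HK _ _ wd wd'; have [_ _ h2 _] := HK _ _ wd' wd.
have p : 0 < nrm (w' - w) by rewrite nrm_gt0 subr_eq0.
rewrite -(ler_pM2r p) -nrmM.
have -> : (f' w' - f' w) * (w' - w) =
  (f w' - f w - f' w * (w' - w)) + (f w - f w' - f' w' * (w - w')) by ring.
apply: le_trans (nrmD _ _) _.
rewrite (nrm_dist w w') in h2; rewrite expr2 in h1 h2; lra.
Qed.

End Nrm.

(** * Means over circles and Liouville's theorem *)

Section CircleIntegral.
Context {R : realType}.
Local Notation mu := (@lebesgue_measure R).
Implicit Types f g : R -> R.

Lemma eps_continuous f :
  (forall x e : R, 0 < e -> exists2 d : R, 0 < d &
     forall y, `|y - x| < d -> `|f y - f x| <= e) -> continuous f.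
Proof.
move=> H x; apply/cvgrPdist_le => e e0; have [d d0 Hd] := H x e e0.
apply/nbhs_ballP; exists d => //= y; rewrite /ball /= => yd.
by rewrite distrC; apply: Hd; rewrite distrC.
Qed.

Let tp : R := 2 * pi.
Let tp0 : 0 < tp. Proof. by rewrite mulr_gt0 ?pi_gt0. Qed.

Definition int2pi f := (\int[mu]_(x in `[0, 2 * pi]) f x).

Lemma int2pi_integrable f : continuous f -> mu.-integrable `[0, tp] (EFin \o f).
Proof.
move=> cf; apply: continuous_compact_integrable; first exact: segment_compact.
exact: continuous_subspaceT.
Qed.

Lemma int2pi_sub f g : continuous f -> continuous g ->
  int2pi (fun x => f x - g x) = int2pi f - int2pi g.
Proof. by move=> cf cg; rewrite /int2pi RintegralB//; exact: int2pi_integrable. Qed.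

Lemma int2pi_scale (c : R) f : continuous f -> int2pi (fun x => c * f x) = c * int2pi f.
Proof. by move=> cf; rewrite /int2pi RintegralZl//; exact: int2pi_integrable. Qed.

Lemma int2pi_cst (c : R) : int2pi (fun=> c) = c * tp.
Proof.
have E : mu `[0, tp]%classic = tp%:E.
  by rewrite lebesgue_measure_itv /= lte_fin tp0 sube0.
by rewrite /int2pi Rintegral_cst//; congr (_ * _); rewrite -[RHS]/(fine tp%:E) -E.
Qed.

Lemma int2pi_le f g : continuous f -> continuous g ->
  (forall x, 0 <= x <= tp -> f x <= g x) -> int2pi f <= int2pi g.
Proof.
move=> cf cg fg; by apply: le_Rintegral => //; exact: int2pi_integrable.
Qed.

Lemma int2pi_bound f (M : R) : continuous f ->
  (forall x, 0 <= x <= tp -> `|f x| <= M) -> `|int2pi f| <= M * tp.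
Proof.
move=> cf fM; rewrite -int2pi_cst; have cM : continuous ((fun=> M) : R -> R) by move=> x;
  exact: cvg_cst.
have cM' : continuous ((fun=> - M) : R -> R) by move=> x; exact: cvg_cst.
rewrite ler_norml; apply/andP; split; last first.
  by apply: int2pi_le => // x /fM; apply: le_trans; exact: ler_norm.
rewrite int2pi_cst -mulNr -int2pi_cst; apply: int2pi_le => // x /fM.
by rewrite ler_norml => /andP[].
Qed.

Lemma int2pi_derive (G g : R -> R) : continuous g ->
  (forall x : R, is_derive x 1 G (g x)) ->
  int2pi g = G tp - G 0.
Proof.
move=> cg dG.
have cG : continuous G.
  by move=> x; apply/differentiable_continuous/derivable1_diffP; have [] := dG x.
rewrite /int2pi /Rintegral (@continuous_FTC2 R g G 0 tp)//.
- exact: continuous_subspaceT.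
- split.
  + by move=> x _; have [] := dG x.
  + by apply: cvg_at_right_filter; exact: cG.
  + by apply: cvg_at_left_filter; exact: cG.
- by move=> x _; rewrite derive1E; have [_ ->] := dG x.
Qed.

End CircleIntegral.

Section Circle.
Context {R : realType}.
Local Notation C := R[i].
Implicit Types (z w : C).

Definition cis (t : R) : C := Complex (cos t) (sin t).
Definition circ z0 (r t : R) : C := z0 + Complex r 0 * cis t.

Lemma nrm_real (r : R) : nrm (Complex r 0) = `|r|.
Proof. by rewrite /nrm /nsq /= expr0n addr0 sqrtr_sqr. Qed.

Lemma nrm_cis t : nrm (cis t) = 1.
Proof. by rewrite /nrm /nsq /= cos2Dsin2 sqrtr1. Qed.

Lemma circ_nrm z0 r t : nrm (circ z0 r t - z0) = `|r|.
Proof. by rewrite /circ addrC addKr nrmM nrm_cis mulr1 nrm_real. Qed.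

Lemma lipschitz1 (f f' : R -> R) : (forall x : R, is_derive x 1 f (f' x)) ->
  (forall x, `|f' x| <= 1) -> forall x y, `|f y - f x| <= `|y - x|.
Proof.
move=> df b x y; wlog xy : x y / x <= y.
  by move=> W; have [|/ltW] := leP x y; [exact: W|rewrite distrC (distrC y); exact: W].
have [c _ ->] := @MVT_segment R f f' x y xy (fun x _ => df x) (derive_within df).
by rewrite normrM ler_piMl.
Qed.

(** The mean value theorem for the sine and the cosine. *)
Lemma cis_lip s t : nrm (cis t - cis s) <= 2 * `|t - s|.
Proof.
apply: le_trans (nrm_le_ReIm _) _; rewrite !ReImE /=.
have h1 := @lipschitz1 cos (fun x => - sin x) (fun x => is_derive_cos x) _ s t.
have h2 := @lipschitz1 sin cos (fun x => is_derive_sin x) _ s t.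
have -> : 2 * `|t - s| = `|t - s| + `|t - s| by ring.
apply: lerD; [apply: h1|apply: h2] => x; rewrite ?normrN.
  by rewrite ler_norml sin_geN1 sin_le1.
by rewrite ler_norml cos_geN1 cos_le1.
Qed.

Lemma circ_dist z0 r s t u : nrm (circ z0 s u - circ z0 r t) <= `|s - r| +
  2 * `|r| * `|u - t|.
Proof.
have -> : circ z0 s u - circ z0 r t =
  Complex (s - r) 0 * cis u + Complex r 0 * (cis u - cis t).
  rewrite /circ; apply/eqP; rewrite eq_complex !ReImE /=; apply/andP; split; apply/eqP;
    ring.
apply: le_trans (nrmD _ _) _; rewrite !nrmM !nrm_real nrm_cis mulr1 lerD2l.
by have := ler_wpM2l (normr_ge0 r) (cis_lip t u); lra.
Qed.

Lemma cis_derive t (e : R) : 0 < e -> exists2 d : R, 0 < d &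
  forall u, `|u - t| < d -> nrm (cis u - cis t - Complex 0 1 * cis t * Complex (u - t) 0)
    <= e * `|u - t|.
Proof.
move=> e0; have e20 : 0 < e / 2 by lra.
have [d1 d10 H1] := is_derive_eps (is_derive_cos t) e20.
have [d2 d20 H2] := is_derive_eps (is_derive_sin t) e20.
exists (Num.min d1 d2); first by rewrite lt_min d10.
move=> u; rewrite lt_min => /andP[/H1 h1 /H2 h2].
apply: le_trans (nrm_le_ReIm _) _; rewrite !ReImE /=.
have -> : cos u - cos t - (((0 * cos t - 1 * sin t) * (u - t)) - (0 * sin t +
  1 * cos t) * 0)
   = cos u - cos t - - sin t * (u - t) by ring.
have -> : sin u - sin t - ((0 * cos t - 1 * sin t) * 0 + (0 * sin t + 1 * cos t) * (u - t))
   = sin u - sin t - cos t * (u - t) by ring.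
lra.
Qed.

End Circle.

Section Liouville.
Context {R : realType}.
Local Notation C := R[i].
Variables (Phi Phi' : C -> C) (ex : nat -> C) (z0 : C).
Hypothesis contPhi : forall z (e : R), 0 < e -> exists2 d : R, 0 < d &
  forall w, nrm (w - z) < d -> nrm (Phi w - Phi z) < e.
Hypothesis holoPhi : forall z, (forall n, z != ex n) -> holo_at Phi Phi' z.
Let tp : R := 2 * pi.
Let tp0 : 0 < tp. Proof. by rewrite mulr_gt0 ?pi_gt0. Qed.

(** Uniformity in the angle by Cousin's lemma. *)
Lemma circ_unif r0 (e : R) : 0 < e -> exists2 d : R, 0 < d &
  forall r t, 0 <= t <= tp -> `|r - r0| < d ->
    nrm (Phi (circ z0 r t) - Phi (circ z0 r0 t)) <= e.
Proof.
move=> e0.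
apply: (@cousin R 0 tp (fun u v =>
  exists2 d : R, 0 < d & forall r t, u <= t <= v -> `|r - r0| < d ->
    nrm (Phi (circ z0 r t) - Phi (circ z0 r0 t)) <= e)); first exact: ltW.
  move=> u v w _ _ _ _ [d1 d10 H1] [d2 d20 H2]; exists (Num.min d1 d2);
    first by rewrite lt_min d10.
  move=> r t /andP[ut tw]; rewrite lt_min => /andP[r1 r2].
  by have [tv|/ltW vt] := leP t v; [apply: H1|apply: H2] => //; apply/andP.
move=> t0 _; have e20 : 0 < e / 2 by lra.
have [d d0 Hd] := contPhi (circ z0 r0 t0) e20.
have p : 0 < 2 * (2 * `|r0| + 1) by have := normr_ge0 r0; lra.
(* Half of d is for the change of radius, half for the change of angle. *)
pose d' := d / (2 * (2 * `|r0| + 1)).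
have d'0 : 0 < d' by rewrite divr_gt0.
have d'd : 2 * `|r0| * d' < d / 2.
  have -> : d / 2 = d' * (2 * `|r0| + 1) by rewrite /d'; field; have := normr_ge0 r0; lra.
  lra.
exists d' => // u v _ ut tv _ ud vd; exists (d / 2); first lra.
move=> r t /andP[ut' tv'] rd.
have td : `|t - t0| < d' by rewrite ltr_distlC; lra.
have close s : `|s - r0| < d / 2 -> nrm (Phi (circ z0 s t) - Phi (circ z0 r0 t0)) < e / 2.
  move=> sd; apply: Hd; apply: le_lt_trans (circ_dist _ _ _ _ _) _.
  have := ler_wpM2l (mulr_ge0 (ler0n R 2) (normr_ge0 r0)) (ltW td); lra.
have h1 := close _ rd.
have h2 := close r0 ltac:(by rewrite subrr normr0; lra).
apply: le_trans (nrm_tri (Phi (circ z0 r0 t0)) _ _) _.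
by rewrite (nrm_dist (Phi (circ z0 r0 t0)) (Phi (circ z0 r0 t))); lra.
Qed.

Lemma circ_cont r : continuous (fun t => complex.Re (Phi (circ z0 r t))).
Proof.
apply: eps_continuous => t e e0; have [d d0 Hd] := contPhi (circ z0 r t) e0.
have p : 0 < 2 * `|r| + 1 by have := normr_ge0 r; lra.
exists (d / (2 * `|r| + 1)); first by rewrite divr_gt0.
move=> u ud; apply: le_trans (Re_dist _ _) _; apply/ltW/Hd.
apply: le_lt_trans (circ_dist _ _ _ _ _) _; rewrite subrr normr0 add0r.
rewrite ltr_pdivlMr// in ud; have := normr_ge0 (u - t); lra.
Qed.

Variable r0 : R.
Hypothesis r00 : 0 < r0.
Hypothesis offex : forall n, r0 != nrm (ex n - z0).

Let holoc t : holo_at Phi Phi' (circ z0 r0 t).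
Proof.
apply: holoPhi => n; apply/eqP => E; have := offex n.
by rewrite -E circ_nrm gtr0_norm// eqxx.
Qed.

Let g t := complex.Re (Phi' (circ z0 r0 t) * cis t).

Let circ_close (d : R) t : 0 < d -> exists2 d' : R, 0 < d' &
  forall u, `|u - t| < d' -> nrm (circ z0 r0 u - circ z0 r0 t) < d.
Proof.
move=> d0; have p : 0 < 2 * `|r0| + 1 by have := normr_ge0 r0; lra.
exists (d / (2 * `|r0| + 1)); first by rewrite divr_gt0.
move=> u ud; apply: le_lt_trans (circ_dist _ _ _ _ _) _; rewrite subrr normr0 add0r.
rewrite ltr_pdivlMr// in ud; have := normr_ge0 (u - t); lra.
Qed.

Let g_cont : continuous g.
Proof.
apply: eps_continuous => t e e0.
have [d d0 [K K0 HK]] := holo_at_deriv_lip (holoc t).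
have /holo_atP[d1 /andP[d10 _] [L L1 HL]] := holoc t.
have hr : 0 <= `|r0| by exact: normr_ge0.
have p : 0 < 2 * K * `|r0| + 2 * L + 1.
  by have := mulr_ge0 K0 hr; lra.
have [d2 d20 H2] := circ_close t d0.
have self d' : 0 < d' -> nrm (circ z0 r0 t - circ z0 r0 t) < d' by rewrite subrr nrm0.
exists (Num.min d2 (e / (2 * K * `|r0| + 2 * L + 1))); first by rewrite lt_min d20 divr_gt0.
move=> u; rewrite lt_min => /andP[/H2 ud]; rewrite ltr_pdivlMr// => ue.
rewrite /g; apply: le_trans (Re_dist _ _) _.
have -> : Phi' (circ z0 r0 u) * cis u - Phi' (circ z0 r0 t) * cis t =
  (Phi' (circ z0 r0 u) - Phi' (circ z0 r0 t)) * cis u +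
    Phi' (circ z0 r0 t) * (cis u - cis t) by ring.
apply: le_trans (nrmD _ _) _; rewrite !nrmM nrm_cis mulr1.
have [_ k1 _ _] := HL _ _ (self _ d10) (self _ d10).
have k2 := HK _ _ (self _ d0) ud.
have k3 := circ_dist z0 r0 r0 t u; rewrite subrr normr0 add0r in k3.
have k4 := ler_wpM2l K0 k3.
have k5 := ler_pM (nrm_ge0 _) (nrm_ge0 _) k1 (cis_lip t u).
have := normr_ge0 (u - t); lra.
Qed.

(** The Cauchy-Riemann equations in polar coordinates: the radial derivative g
    of Re Phi is, up to the factor r0, the angular derivative of Im Phi. *)
Let g_derive (t : R) : is_derive t 1 (fun u =>
  r0^-1 * complex.Im (Phi (circ z0 r0 u))) (g t).
Proof.
apply: eps_is_derive => e e0.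
have /holo_atP[d /andP[d0 _] [K K1 HK]] := holoc t.
have [d1 d10 H1] := circ_close t d0.
have p : 0 < e / (2 * K) by rewrite divr_gt0//; lra.
have [d2 d20 H2] := cis_derive t p.
have q0 : 0 < 8 * K * r0 by rewrite !mulr_gt0//; lra.
exists (Num.min d1 (Num.min d2 (e / (8 * K * r0)))).
  by rewrite !lt_min d10 d20 divr_gt0.
move=> u; rewrite !lt_min => /and3P[/H1 u1 /H2 u2]; rewrite ltr_pdivlMr// => u3.
have self : nrm (circ z0 r0 t - circ z0 r0 t) < d by rewrite subrr nrm0.
have [_ k1 k2 _] := HK _ _ self u1.
set P' := Phi' _ in k1 k2 *.
pose X := Phi (circ z0 r0 u) - Phi (circ z0 r0 t) - P' * (Complex r0 0 * (Complex 0 1 *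
  cis t * Complex (u - t) 0)).
have -> : r0^-1 * complex.Im (Phi (circ z0 r0 u)) - r0^-1 * complex.Im (Phi (circ z0 r0
  t)) - g t * (u - t)
  = r0^-1 * complex.Im X.
  by rewrite /g /X -/P' !ReImE /=; field; rewrite gt_eqF.
have XE : X = (Phi (circ z0 r0 u) - Phi (circ z0 r0 t) - P' * (circ z0 r0 u - circ z0 r0 t))
   + P' * (Complex r0 0 * (cis u - cis t - Complex 0 1 * cis t * Complex (u - t) 0)).
  by rewrite /X /circ; ring.
have k3 := circ_dist z0 r0 r0 t u; rewrite subrr normr0 add0r (gtr0_norm r00) in k3.
have n0 := normr_ge0 (u - t).
have k4 : nrm (circ z0 r0 u - circ z0 r0 t) ^+ 2 <= (2 * r0 * `|u - t|) ^+ 2.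
  by rewrite ler_pXn2r// nnegrE ?nrm_ge0// !mulr_ge0// ltW.
have k5 := ler_pM (nrm_ge0 P') (nrm_ge0 (Complex r0 0 * (cis u - cis t - Complex 0 1 *
  cis t * Complex (u - t) 0))) k1 (lexx _).
have hX : nrm X <= r0 * (e * `|u - t|).
  rewrite XE; apply: le_trans (nrmD _ _) _; rewrite [X in _ + X <= _]nrmM.
  rewrite nrmM nrm_real (gtr0_norm r00) in k5 *.
  have k6 : K * (r0 * nrm (cis u - cis t - Complex 0 1 * cis t * Complex (u - t) 0)) <=
    r0 * (e * `|u - t|) / 2.
    have -> : r0 * (e * `|u - t|) / 2 = K * (r0 * (e / (2 * K) * `|u - t|)) by field; lra.
    by apply: ler_wpM2l; [lra|apply: ler_wpM2l => //; exact: ltW].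
  have k7 : K * nrm (circ z0 r0 u - circ z0 r0 t) ^+ 2 <= r0 * (e * `|u - t|) / 2.
    apply: le_trans (ler_wpM2l _ k4) _; first lra.
    have := ler_wpM2r (mulr_ge0 (ltW r00) n0) (ltW u3).
    rewrite expr2; lra.
  lra.
suff : `|r0^-1 * complex.Im X| <= e * `|u - t| by [].
rewrite normrM normfV (gtr0_norm r00) ler_pdivrMl//.
exact: le_trans (Im_le_nrm _) hX.
Qed.

(** Hence the mean of the radial derivative over the circle is 0. *)
Let g_mean0 : int2pi g = 0.
Proof.
by rewrite (int2pi_derive g_cont g_derive) mulr_natl /circ /cis cos2pi sin2pi cos0 sin0
  subrr.
Qed.

Lemma circ_quad : exists2 d : R, 0 < d & exists K : R,
  forall h t, 0 <= t <= tp -> `|h| < d ->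
    `|complex.Re (Phi (circ z0 (r0 +
      h) t)) - complex.Re (Phi (circ z0 r0 t)) - h * g t| <= K * `|h| ^+ 2.
Proof.
apply: (@cousin R 0 tp (fun u v =>
  exists2 d : R, 0 < d & exists K : R, forall h t, u <= t <= v -> `|h| < d ->
    `|complex.Re (Phi (circ z0 (r0 +
      h) t)) - complex.Re (Phi (circ z0 r0 t)) - h * g t| <= K * `|h| ^+ 2));
      first exact: ltW.
  move=> u v w _ _ _ _ [d1 d10 [K1 H1]] [d2 d20 [K2 H2]]; exists (Num.min d1 d2);
    first by rewrite lt_min d10.
  exists (Num.max K1 K2) => h t /andP[ut tw]; rewrite lt_min => /andP[r1 r2].
  have hh := sqr_ge0 `|h|.
  have [tv|/ltW vt] := leP t v.
    by apply: le_trans (H1 h t _ r1) _; [apply/andP|rewrite ler_wpM2r// le_max lexx].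
  by apply: le_trans (H2 h t _ r2) _; [apply/andP|rewrite ler_wpM2r// le_max lexx orbT].
move=> t0 _; have [d d0 [K HK]] := holoc t0.
have d20 : 0 < d / 2 by lra.
have [d1 d10 H1] := circ_close t0 d20.
exists d1 => // u v _ ut tv _ ud vd; exists (d / 2) => //; exists K.
move=> h t /andP[ut' tv'] hd.
have td : nrm (circ z0 r0 t - circ z0 r0 t0) < d / 2 by apply: H1; rewrite ltr_distlC; lra.
have td' : nrm (circ z0 (r0 + h) t - circ z0 r0 t0) < d.
  apply: le_lt_trans (nrm_tri (circ z0 r0 t) _ _) _.
  have := circ_dist z0 r0 (r0 + h) t t;
    rewrite subrr normr0 mulr0 addr0 (addrC r0) addrK; lra.
have td2 : nrm (circ z0 r0 t - circ z0 r0 t0) < d by lra.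
have [_ _ ] := HK _ _ td2 td'.
have E : circ z0 (r0 + h) t - circ z0 r0 t = Complex h 0 * cis t.
  rewrite /circ; apply/eqP; rewrite eq_complex !ReImE /=; apply/andP; split; apply/eqP;
    ring.
rewrite E nrmM nrm_real nrm_cis mulr1; apply: le_trans.
apply: le_trans (Re_le_nrm _); rewrite !ReImE /g !ReImE /=.
by rewrite le_eqVlt; apply/orP; left; apply/eqP; congr `|_|; ring.
Qed.

(** The increment of the mean is h times the mean of g, which is 0, up to a
    quadratic error. *)
Lemma mean_derive0 (e : R) : 0 < e -> exists2 d : R, 0 < d & forall r, `|r - r0| < d ->
  `|int2pi (fun t => complex.Re (Phi (circ z0 r t))) - int2pi (fun t =>
    complex.Re (Phi (circ z0 r0 t)))| <= e * `|r - r0|.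
Proof.
move=> e0; have [d d0 [K HK]] := circ_quad.
have p : 0 < (`|K| + 1) * tp by rewrite mulr_gt0//; have := normr_ge0 K; lra.
exists (Num.min d (e / ((`|K| + 1) * tp))); first by rewrite lt_min d0 divr_gt0.
move=> r; rewrite lt_min => /andP[rd]; rewrite ltr_pdivlMr// => re.
set h := r - r0 in rd re *.
have cc := circ_cont.
have chg : continuous (fun t => h * g t) by move=> t; apply: cvgM;
  [exact: cvg_cst|exact: g_cont].
have <- : int2pi (fun t => complex.Re (Phi (circ z0 r t)) - complex.Re (Phi (circ z0 r0
  t)) - h * g t) =
   int2pi (fun t => complex.Re (Phi (circ z0 r t))) - int2pi (fun t =>
     complex.Re (Phi (circ z0 r0 t))).
  rewrite (@int2pi_sub R (fun t => complex.Re (Phi (circ z0 r t)) - complex.Re (Phi (circ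
    z0 r0 t)))) //; last first.
    by move=> t; apply: cvgB; exact: cc.
  by rewrite int2pi_scale// g_mean0 mulr0 subr0 int2pi_sub.
apply: le_trans (int2pi_bound (M := K * `|h| ^+ 2) _ _) _.
- by move=> t; apply: cvgB; [apply: cvgB; exact: cc|exact: chg].
- by move=> t tt; have := HK h t tt rd; rewrite (_ : r0 + h = r) // /h; ring.
have n0 := normr_ge0 h.
have : K * `|h| ^+ 2 <= (`|K| + 1) * `|h| ^+ 2.
  by rewrite ler_wpM2r ?sqr_ge0//; have := ler_norm K; lra.
move/(ler_wpM2r (ltW tp0)) => k; apply: le_trans k _.
have := ler_wpM2r n0 (ltW re); rewrite expr2 -/tp; lra.
Qed.

End Liouville.

Section Liouville2.
Context {R : realType}.
Local Notation C := R[i].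
Let tp : R := 2 * pi.
Let tp0 : 0 < tp. Proof. by rewrite mulr_gt0 ?pi_gt0. Qed.

(** The mean of Re Phi over the circle of radius r does not depend on r: it is
    continuous in r, and its derivative is 0 except for the countably many
    radii of circles that meet the exceptional points. *)
Lemma Re_mean (Phi Phi' : C -> C) (ex : nat -> C) (z0 : C) (r e : R) :
  (forall z (e : R), 0 < e -> exists2 d : R, 0 < d &
     forall w, nrm (w - z) < d -> nrm (Phi w - Phi z) < e) ->
  (forall z, (forall n, z != ex n) -> holo_at Phi Phi' z) ->
  0 < r -> (forall w, nrm (w - z0) = r -> nrm (Phi w) <= e) ->
  `|complex.Re (Phi z0)| <= e.
Proof.
move=> cP hP r0 bP.
pose I r := int2pi (fun t => complex.Re (Phi (circ z0 r t))).
have Irr : I r = I 0.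
  apply: (@const_off_countable R I (fun n =>
    if n is m.+1 then nrm (ex m - z0) else 0)) => //; first exact: ltW.
  - move=> x _ d d0; have [|d1 d10 H1] := @circ_unif R Phi z0 cP x (d / tp);
    first by rewrite divr_gt0.
    exists d1 => // y _ yd; rewrite /I -int2pi_sub; try exact: circ_cont.
    have -> : d = d / tp * tp by field; rewrite gt_eqF.
    apply: int2pi_bound.
      by move=> t; apply: cvgB; exact: circ_cont.
    move=> t tt; apply: le_trans (Re_dist _ _) _; exact: H1.
  - move=> x /andP[x0 _] nx d d0.
    have x00 : 0 < x by rewrite lt_def x0 (nx 0%N).
    have [d1 d10 H1] := @mean_derive0 R Phi Phi' ex z0 cP hP x x00 (fun n => nx n.+1) d d0.
    by exists d1 => // y _; exact: H1.
have I0 : I 0 = complex.Re (Phi z0) * tp.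
  rewrite /I -int2pi_cst; congr int2pi; apply/funext => t; congr (complex.Re (Phi _)).
  by rewrite /circ; apply/eqP; rewrite eq_complex !ReImE /=; apply/andP; split;
    apply/eqP; ring.
have : `|I r| <= e * tp.
  apply: int2pi_bound; first exact: circ_cont.
  by move=> t _; apply: le_trans (Re_le_nrm _) _; apply: bP; rewrite circ_nrm gtr0_norm.
by rewrite Irr I0 normrM (gtr0_norm tp0) ler_pM2r.
Qed.

(** Re_mean gives the real part; the imaginary part is the real part of - i
    Phi. *)
Lemma liouville (Phi Phi' : C -> C) (ex : nat -> C) (z0 : C) :
  (forall z (e : R), 0 < e -> exists2 d : R, 0 < d &
     forall w, nrm (w - z) < d -> nrm (Phi w - Phi z) < e) ->
  (forall z, (forall n, z != ex n) -> holo_at Phi Phi' z) ->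
  (forall e : R, 0 < e -> exists2 r, 0 < r & forall w, nrm (w - z0) = r ->
    nrm (Phi w) <= e) ->
  Phi z0 = 0.
Proof.
move=> cP hP bP.
have small (x : R) : (forall e, 0 < e -> `|x| <= e) -> x = 0.
  by move=> H; apply/eqP; rewrite -normr_le0; apply/ler_addgt0Pr => e /H; rewrite add0r.
apply/eqP; rewrite eq_complex; apply/andP; split; apply/eqP.
  by apply: small => e /bP[r r0 H]; apply: Re_mean cP hP r0 H.
apply: small => e /bP[r r0 H].
pose j : C := Complex 0 (-1).
have nj : nrm j = 1 by rewrite /nrm /nsq /= expr0n sqrrN expr1n add0r sqrtr1.
have -> : complex.Im (Phi z0) = complex.Re (j * Phi z0) by rewrite !ReImE /=; ring.
apply: (@Re_mean (fun w => j * Phi w) (fun w => 0 * Phi w + j * Phi' w) ex z0 r e) => //.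
- move=> z d /(cP z)[d1 d10 H1]; exists d1 => // w /H1.
  by rewrite -mulrBr nrmM nj mul1r.
- by move=> z /hP; apply: holo_at_mul; exact: holo_at_cst.
- by move=> w /H; rewrite nrmM nj mul1r.
Qed.

End Liouville2.

(** * Dependence on the spectral parameter *)

Section LipLimit.
Context {R : realType}.
Local Notation C := R[i].

(** The supremum of v l - K |l - m| is the limit of v at m: no sequence is
    needed. *)
Lemma lip_limit_real (v : C -> R) (m : C) (A : C -> Prop) (K : R) : 0 <= K ->
  (exists l, A l) ->
  (forall l l', A l -> A l' -> `|v l - v l'| <= K * (nrm (l - m) + nrm (l' - m))) ->
  exists L, forall l, A l -> `|v l - L| <= K * nrm (l - m).
Proof.
move=> K0 [l0 Al0] H.
pose E := [set x | exists2 l, A l & x = v l - K * nrm (l - m)].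
have ub l : A l -> ubound E (v l + K * nrm (l - m)).
  move=> Al x [l' Al' ->]; have := H _ _ Al' Al; rewrite ler_norml => /andP[_]; lra.
have supE : has_sup E.
  by split; [exists (v l0 - K * nrm (l0 - m));
    exists l0|exists (v l0 + K * nrm (l0 - m)); exact: ub].
exists (sup E) => l Al.
have h1 : v l - K * nrm (l - m) <= sup E by apply: ub_le_sup; [exact: supE.2|exists l].
have h2 : sup E <= v l + K * nrm (l - m) by apply: ge_sup; [exact: supE.1|exact: ub].
by rewrite ler_norml; apply/andP; split; lra.
Qed.

(** A Lipschitz function on a punctured neighbourhood of m has a limit at m.
    The estimate for the limit is then valid with any other Lipschitz
    constant, on any larger set A; this makes the limit independent of the
    neighbourhood. *)
Lemma lip_limit (V : C -> C) (m : C) (d K : R) : 0 < d ->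
  (forall l l', l != m -> l' != m -> nrm (l - m) < d -> nrm (l' - m) < d ->
     nrm (V l - V l') <= K * nrm (l - l')) ->
  exists L, forall (A : C -> Prop) (K' : R) (d' : R), 0 <= K' -> 0 < d' ->
     (forall l, l != m -> nrm (l - m) < d' -> A l) ->
     (forall l l', l != m -> l' != m -> A l -> A l' ->
       nrm (V l - V l') <= K' * nrm (l - l')) ->
     forall l, l != m -> A l -> nrm (V l - L) <= K' * nrm (l - m).
Proof.
move=> d0 HV.
have pt (e : R) : 0 < e -> exists l, l != m /\ nrm (l - m) < e.
  move=> e0; exists (m + Complex (e / 2) 0); rewrite addrC addrK.
  rewrite /nrm /nsq /= expr0n addr0 sqrtr_sqr ger0_norm; last lra.
  split; last lra.
  rewrite -subr_eq0 addrK eq_complex /= eqxx andbT; lra.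
pose A l := l != m /\ nrm (l - m) < d.
have HA l l' : A l -> A l' -> nrm (V l - V l') <= `|K| * (nrm (l - m) + nrm (l' - m)).
  move=> [l0 l1] [l0' l1']; apply: le_trans (HV _ _ l0 l0' l1 l1') _.
  apply: le_trans (ler_wpM2r (nrm_ge0 _) (ler_norm K)) _; apply: ler_wpM2l => //.
  by rewrite (nrm_dist l' m); exact: nrm_tri.
have exA : exists l, A l by exact: pt.
have [a Ha] := @lip_limit_real (fun l => complex.Re (V l)) m A `|K| (normr_ge0 _) exA
  (fun l l' Al Al' => le_trans (Re_dist _ _) (HA l l' Al Al')).
have [b Hb] := @lip_limit_real (fun l => complex.Im (V l)) m A `|K| (normr_ge0 _) exA
  (fun l l' Al Al' => le_trans (Im_dist _ _) (HA l l' Al Al')).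
exists (Complex a b) => A' K' d' K'0 d'0 nA' HK' l lm Al.
apply/ler_addgt0Pr => e e0.
have k0 := normr_ge0 K.
have p : 0 < 2 * `|K| + K' + 1 by lra.
have q : 0 < Num.min (Num.min d d') (e / (2 * `|K| + K' +
  1)) by rewrite !lt_min d0 d'0 divr_gt0.
have [l' [l'm]] := pt _ q; rewrite !lt_min => /andP[/andP[l1 l2]];
  rewrite ltr_pdivlMr// => l3.
have h1 := HK' l l' lm l'm Al (nA' _ l'm l2).
have h2 : nrm (V l' - Complex a b) <= 2 * `|K| * nrm (l' - m).
  apply: le_trans (nrm_le_ReIm _) _; rewrite !ReImE /=.
  have := Ha l' (conj l'm l1); have := Hb l' (conj l'm l1); lra.
apply: le_trans (nrm_tri (V l') _ _) _.
have h3 : nrm (l - l') <= nrm (l - m) + nrm (l' - m) by rewrite (nrm_dist l' m);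
  exact: nrm_tri.
have := ler_wpM2l K'0 h3; have := nrm_ge0 (l' - m); lra.
Qed.

(** The derivative is the limit of the divided differences, and the rate of
    their convergence is the quadratic error of the expansion. *)
Lemma holo_of_divided_differences (G : C -> C) :
  (forall B : R, exists K : R, forall m l l', nrm m <= B -> nrm l <= B -> nrm l' <= B ->
     [/\ nrm (G l) <= K, nrm (G l - G m) <= K * nrm (l - m) &
         l != m -> l' != m ->
         nrm ((G l - G m) / (l - m) - (G l' - G m) / (l' - m)) <= K * nrm (l - l')]) ->
  exists G', forall z, holo_at G G' z.
Proof.
move=> H.
pose V m l := (G l - G m) / (l - m).
have : forall m, exists L, forall (A : C -> Prop) (K' : R) (d' : R), 0 <= K' -> 0 < d' ->
     (forall l, l != m -> nrm (l - m) < d' -> A l) ->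
     (forall l l', l != m -> l' != m -> A l -> A l' ->
       nrm (V m l - V m l') <= K' * nrm (l - l')) ->
     forall l, l != m -> A l -> nrm (V m l - L) <= K' * nrm (l - m).
  move=> m; have [K HK] := H (nrm m + 1).
  apply: (@lip_limit (V m) m 1 K) => // l l' lm l'm l1 l1'.
  have b w : nrm (w - m) < 1 -> nrm w <= nrm m + 1.
    by move=> wm; have := nrmD (w - m) m; rewrite subrK; lra.
  by have [|_ _] := HK m l l' _ (b _ l1) (b _ l1'); [lra|apply].
move=> /choice[G' HG'].
exists G' => z; exists 1 => //; have [K HK] := H (nrm z + 1).
have b w : nrm (w - z) < 1 -> nrm w < nrm z + 1.
  by move=> wz; have := nrmD (w - z) z; rewrite subrK; lra.
have bz : nrm z <= nrm z + 1 by lra.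
have K0 : 0 <= K by have [/(le_trans (nrm_ge0 _))] := HK z z z bz bz bz.
have key w l : nrm (w - z) < 1 -> l != w -> nrm l <= nrm z + 1 ->
    nrm (V w l - G' w) <= K * nrm (l - w).
  move=> wz lw lz; have wB := b _ wz.
  apply: (HG' w (fun l => nrm l <= nrm z + 1) K (nrm z + 1 - nrm w)) => //; first lra.
    by move=> l1 _ l1w; have := nrmD (l1 - w) w; rewrite subrK; lra.
  move=> l1 l2 n1 n2 b1 b2; have [_ _] := HK w l1 l2 (ltW wB) b1 b2; exact.
have Vb w l : nrm (w - z) < 1 -> l != w -> nrm l <= nrm z + 1 -> nrm (V w l) <= K.
  move=> wz lw lz; rewrite nrmM nrmV ler_pdivrMr ?nrm_gt0 ?subr_eq0//.
  by have [_ ? _] := HK w l l (ltW (b _ wz)) lz lz.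
exists (3 * K) => w w' wz w'z.
have [g1 _ _] := HK w w w (ltW (b _ wz)) (ltW (b _ wz)) (ltW (b _ wz)).
split.
- lra.
- have [l [lw lz lw1]] : exists l, [/\ l != w, nrm l <= nrm z + 1 & nrm (l - w) <= 1].
    have [->|nwz] := eqVneq w z; last first.
      by exists z; rewrite eq_sym nwz nrm_dist (ltW wz).
    have h : nrm (Complex (1/2) 0 : C) = 1/2.
      by rewrite /nrm /nsq /= expr0n addr0 sqrtr_sqr ger0_norm; lra.
    exists (z + Complex (1/2) 0); split.
    + by rewrite -subr_eq0 (addrC z) addrK eq_complex /= eqxx andbT; lra.
    + by apply: le_trans (nrmD _ _) _; rewrite h; lra.
    + by rewrite (addrC z) addrK h; lra.
  have h1 := key w l wz lw lz; have h2 := Vb w l wz lw lz.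
  have := nrmB (V w l) (V w l - G' w); rewrite opprB addrCA subrr addr0.
  have := ler_wpM2l K0 lw1; lra.
- have [->|ww'] := eqVneq w' w; first by rewrite !subrr mulr0 subrr nrm0 expr0n mulr0.
  have h := key w w' wz ww' (ltW (b _ w'z)).
  have d0 : w' - w != 0 by rewrite subr_eq0.
  have -> : G w' - G w - G' w * (w' - w) = (V w w' - G' w) * (w' - w).
    by rewrite /V mulrBl divfK.
  rewrite nrmM expr2.
  have := ler_wpM2r (nrm_ge0 (w' - w)) h.
  have := mulr_ge0 K0 (mulr_ge0 (nrm_ge0 (w' - w)) (nrm_ge0 (w' - w))); lra.
Qed.

End LipLimit.

Section Families.
Context {R : realType}.
Local Notation mu := (@lebesgue_measure R).
Local Notation C := R[i].
Variables (T : R) (q : R -> C) (H : R -> R).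
Hypothesis hH : sq_primitive T q H.
Hypothesis T0 : 0 <= T.

(** The difference of the two solutions is forced by (m - l) z and has zero
    data at x0. *)
Lemma lip_pair l m (y y1 z z1 : R -> C) (B x0 x : R) :
  forced_sol 0 T l (fun x => q x * y x) y y1 -> forced_sol 0 T m (fun x =>
    q x * z x) z z1 ->
  nsq l <= B -> nsq m <= B -> 0 <= x0 <= T -> 0 <= x <= T ->
  y x0 = z x0 -> y1 x0 = z1 x0 ->
  nsq (y1 x - z1 x) + nsq (y x - z x) <=
    nsq (l - m) * ((nsq (z1 x0) + nsq (z x0)) * param_const T H B ^+ 2).
Proof.
move=> hy hz lB mB x0T xT e0 e1.
have hd := forced_sol_subr T0 hy (forced_sol_shift l hz).
have hd' : forced_sol 0 T l (fun x => q x * (y x - z x) + (m - l) * z x) (fun x =>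
  y x - z x) (fun x => y1 x - z1 x).
  by apply: forced_sol_ext hd _; apply: aeW => u _; ring.
have hz0 : forced_sol 0 T m (fun x => q x * z x + 0) z z1.
  by apply: forced_sol_ext hz _; apply: aeW => u _; rewrite addr0.
have b0 u : 0 <= u <= T -> nsq (z1 u) + nsq (z u) <= (nsq (z1 x0) +
  nsq (z x0)) * param_const T H B.
  move=> uT; have := param_bound hH hz0 mB (lexx 0) _ x0T uT.
  by rewrite addr0; apply => v _; rewrite nsq0.
have Kp : 0 <= param_const T H B by exact: expR_ge0.
have N0 : 0 <= nsq (z1 x0) + nsq (z x0) by apply: addr_ge0; exact: nsq_ge0.
have := param_bound hH hd' lB (M :=
  nsq (l - m) * ((nsq (z1 x0) + nsq (z x0)) * param_const T H B)) _ _ x0T xT.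
rewrite e0 e1 !subrr nsq0 !add0r expr2 !mulrA => h; apply: h.
  by apply: mulr_ge0 => //; rewrite -?mulrA; apply: mulr_ge0 => //; exact: nsq_ge0.
move=> u /andP[u0 uT]; rewrite nsqM nsqB -mulrA; apply: ler_wpM2l; first exact: nsq_ge0.
by have := b0 u ltac:(by rewrite !ltW); have := nsq_ge0 (z1 u); lra.
Qed.

Lemma solution_unique l (y y1 z z1 : R -> C) (x0 x : R) :
  forced_sol 0 T l (fun x => q x * y x) y y1 -> forced_sol 0 T l (fun x =>
    q x * z x) z z1 ->
  0 <= x0 <= T -> 0 <= x <= T -> y x0 = z x0 -> y1 x0 = z1 x0 ->
  y x = z x /\ y1 x = z1 x.
Proof.
move=> hy hz x0T xT e0 e1.
have := lip_pair hy hz (lexx _) (lexx _) x0T xT e0 e1.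
rewrite subrr nsq0 mul0r => h.
have h1 := nsq_ge0 (y1 x - z1 x); have h2 := nsq_ge0 (y x - z x).
split; apply/eqP; rewrite -subr_eq0 -nsq_eq0 eq_le ?h1 ?h2 andbT; lra.
Qed.

Variables (Y Y1 : R -> C -> C) (x0 : R) (d0 d1 : C).
Hypothesis hY : forall l, forced_sol 0 T l (fun x => q x * Y x l) (Y ^~ l) (Y1 ^~ l).
Hypothesis x0T : 0 <= x0 <= T.
Hypothesis Yx0 : forall l, Y x0 l = d0.
Hypothesis Y1x0 : forall l, Y1 x0 l = d1.

Let N := nsq d1 + nsq d0.
Let N0 : 0 <= N. Proof. by apply: addr_ge0; exact: nsq_ge0. Qed.

Lemma fam_bound l (B x : R) : nsq l <= B -> 0 <= x <= T ->
  nsq (Y1 x l) + nsq (Y x l) <= N * param_const T H B.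
Proof.
move=> lB xT.
have h0 : forced_sol 0 T l (fun x => q x * Y x l + 0) (Y ^~ l) (Y1 ^~ l).
  by apply: forced_sol_ext (hY l) _; apply: aeW => u _; rewrite addr0.
have := param_bound hH h0 lB (lexx 0) _ x0T xT; rewrite addr0 Yx0 Y1x0.
by apply => v _; rewrite nsq0.
Qed.

Lemma fam_lip l m (B x : R) : nsq l <= B -> nsq m <= B -> 0 <= x <= T ->
  nsq (Y1 x l - Y1 x m) + nsq (Y x l - Y x m) <= nsq (l - m) * (N * param_const T H B ^+ 2).
Proof.
move=> lB mB xT; have := lip_pair (hY l) (hY m) lB mB x0T xT; rewrite !Yx0 !Y1x0.
exact.
Qed.

(** The divided difference (Y_l - Y_m) / (l - m) solves the equation for m
    with forcing term - Y_l, so it depends on l as Y_l does, in a Lipschitz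
    way. *)
Lemma fam_divided m l l' (B x : R) : nsq m <= B -> nsq l <= B -> nsq l' <= B ->
  l != m -> l' != m -> 0 <= x <= T ->
  nsq ((Y1 x l - Y1 x m) / (l - m) - (Y1 x l' - Y1 x m) / (l' - m)) +
  nsq ((Y x l - Y x m) / (l - m) - (Y x l' - Y x m) / (l' - m)) <=
    nsq (l - l') * (N * param_const T H B ^+ 3).
Proof.
move=> mB lB lB' lm lm' xT.
have hV k : k != m -> forced_sol 0 T m (fun x => q x * ((Y x k - Y x m) / (k - m)) - Y x k)
    (fun x => (Y x k - Y x m) / (k - m)) (fun x => (Y1 x k - Y1 x m) / (k - m)).
  move=> km; have k0 : k - m != 0 by rewrite subr_eq0.
  have [h1 h2] := forced_sol_scale (k - m)^-1 T0 (forced_sol_subr T0 (forced_sol_shift m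
    (hY k)) (hY m)).
  split.
    by apply: cac_deriv_ext h1 _ _ => [u|]; [rewrite mulrC|apply: aeW => u _;
      rewrite mulrC].
  apply: cac_deriv_ext h2 _ _ => [u|]; first by rewrite mulrC.
  by apply: aeW => u _; field.
have hZ := forced_sol_subr T0 (hV _ lm) (hV _ lm').
have {}hZ : forced_sol 0 T m (fun x =>
  q x * ((Y x l - Y x m) / (l - m) - (Y x l' - Y x m) / (l' - m)) + (Y x l' - Y x l))
    (fun x => (Y x l - Y x m) / (l - m) - (Y x l' - Y x m) / (l' - m))
    (fun x => (Y1 x l - Y1 x m) / (l - m) - (Y1 x l' - Y1 x m) / (l' - m)).
  by apply: forced_sol_ext hZ _; apply: aeW => u _; ring.
have Kp : 0 <= param_const T H B by exact: expR_ge0.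
have := param_bound hH hZ mB (M := nsq (l - l') * (N * param_const T H B ^+ 2)) _ _ x0T xT.
rewrite !Yx0 !Y1x0 !subrr !mul0r !subrr nsq0 !add0r => h.
have -> : nsq (l - l') * (N * param_const T H B ^+ 3) =
  nsq (l - l') * (N * param_const T H B ^+ 2) * param_const T H B.
  by ring.
apply: h.
  by apply: mulr_ge0; [exact: nsq_ge0|apply: mulr_ge0 => //; exact: sqr_ge0].
move=> u /andP[u0 uT]; rewrite nsqB.
by have := @fam_lip l l' B u lB lB' ltac:(by rewrite !ltW);
  have := nsq_ge0 (Y1 u l - Y1 u l'); lra.
Qed.

Lemma nsq_le_nrm (z : C) (B : R) : nsq z <= B -> nrm z <= Num.sqrt B.
Proof. exact: ler_wsqrtr. Qed.

Lemma fam_holo x : 0 <= x <= T ->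
  (exists G', forall z, holo_at (Y x) G' z) /\ (exists G', forall z, holo_at (Y1 x) G' z).
Proof.
move=> xT.
have gen (G : C -> C) :
   (forall B l, nsq l <= B -> nsq (G l) <= N * param_const T H B) ->
   (forall B l m, nsq l <= B -> nsq m <= B ->
     nsq (G l - G m) <= nsq (l - m) * (N * param_const T H B ^+ 2)) ->
   (forall B m l l', nsq m <= B -> nsq l <= B -> nsq l' <= B -> l != m -> l' != m ->
     nsq ((G l - G m) / (l - m) - (G l' - G m) / (l' - m)) <=
       nsq (l - l') * (N * param_const T H B ^+ 3)) ->
   exists G', forall z, holo_at G G' z.
  move=> h1 h2 h3; apply: holo_of_divided_differences => B.
  set K := param_const T H (B ^+ 2).
  exists (Num.sqrt (N * K) + Num.sqrt (N * K ^+ 2) + Num.sqrt (N * K ^+ 3)) =>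
    m l l' mB lB lB'.
  have sq (z : C) : nrm z <= B -> nsq z <= B ^+ 2.
    by move=> zB; rewrite -nrm_sqr ler_pXn2r// nnegrE ?nrm_ge0// (le_trans (nrm_ge0 z) zB).
  have p1 := sqrtr_ge0 (N * K); have p2 := sqrtr_ge0 (N * K ^+ 2);
    have p3 := sqrtr_ge0 (N * K ^+ 3).
  have fin (w z : C) (A : R) : nsq w <= nsq z * A -> nrm w <= Num.sqrt A * nrm z.
    by move=> /nsq_le_nrm; rewrite sqrtrM ?nsq_ge0// mulrC.
  split.
  - have := nsq_le_nrm (h1 _ _ (sq _ lB)); rewrite -/K; lra.
  - have := fin _ _ _ (h2 _ _ _ (sq _ lB) (sq _ mB)); rewrite -/K.
    have := nrm_ge0 (l - m) => n0; have := mulr_ge0 p1 n0; have := mulr_ge0 p3 n0; lra.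
  - move=> lm lm'; have := fin _ _ _ (h3 _ _ _ _ (sq _ mB) (sq _ lB) (sq _ lB') lm lm');
    rewrite -/K.
    have := nrm_ge0 (l - l') => n0; have := mulr_ge0 p1 n0; have := mulr_ge0 p2 n0; lra.
split; apply: gen => B.
- by move=> l lB; have := fam_bound lB xT; have := nsq_ge0 (Y1 x l); lra.
- by move=> l m lB mB; have := fam_lip lB mB xT; have := nsq_ge0 (Y1 x l - Y1 x m); lra.
- move=> m l l' mB lB lB' lm lm'; have := fam_divided mB lB lB' lm lm' xT.
  by have := nsq_ge0 ((Y1 x l - Y1 x m) / (l - m) - (Y1 x l' - Y1 x m) / (l' - m)); lra.
- by move=> l lB; have := fam_bound lB xT; have := nsq_ge0 (Y x l); lra.
- by move=> l m lB mB; have := fam_lip lB mB xT; have := nsq_ge0 (Y x l - Y x m); lra.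
- move=> m l l' mB lB lB' lm lm'; have := fam_divided mB lB lB' lm lm' xT.
  by have := nsq_ge0 ((Y x l - Y x m) / (l - m) - (Y x l' - Y x m) / (l' - m)); lra.
Qed.

End Families.

(** * Quotients of entire functions *)

Section Ratio.
Context {R : realType}.
Local Notation C := R[i].

(** For these rho the modulus of sin (2 pi rho) is comparable to e^(2 pi Im
    rho). *)
Definition off_sine (rho : C) : Prop :=
  1 <= 2 * pi * complex.Im rho \/ 1/4 <= sin (2 * pi * complex.Re rho) ^+ 2.

Lemma sin_sqr_shift N (x : R) : sin (x + N%:R * pi) ^+ 2 = sin x ^+ 2.
Proof.
elim: N => [|N IH]; first by rewrite mul0r addr0.
by rewrite -natr1 mulrDl mul1r addrA sinDpi sqrrN.
Qed.

Lemma cos_ge_half (h : R) : `|h| <= 1/2 -> 1/2 <= cos h.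
Proof.
move=> hh; have := @lipschitz1 R cos (fun x => - sin x) (fun x => is_derive_cos x) _ 0 h.
rewrite cos0 subr0 => H.
have {}H : `|cos h - 1| <= `|h|.
  by apply: H => x; rewrite normrN ler_norml sin_geN1 sin_le1.
by move: H; rewrite ler_norml => /andP[]; lra.
Qed.

Lemma nrm_sqr_nsq (z : C) : nrm (z ^+ 2) = nsq z.
Proof. by rewrite expr2 nrmM -expr2 nrm_sqr. Qed.

(** The circles |rho^2 - z0| = ((N + 1/2) / 2)^2 stay away from the points
    rho^2 = (n / 2)^2 where sin (2 pi rho) = 0, because |2 pi rho| is close to
    pi (N + 1/2) on them. *)
Lemma good_circle (z0 : C) (r1 : R) : exists r : R, [/\ 0 < r, r1 <= r &
  forall rho : C, 0 <= complex.Im rho -> nrm (rho ^+ 2 - z0) = r -> off_sine rho].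
Proof.
have pi1 : (1 : R) <= pi by have := @pi_ge2 R; lra.
pose Kz := 4 * pi ^+ 2 * nrm z0 + 1.
have Kz1 : 1 <= Kz by rewrite lerDr; apply: mulr_ge0; [apply: mulr_ge0 => //;
  exact: sqr_ge0|exact: nrm_ge0].
pose X := 2 * Kz + 4 * `|r1|.
have r10 := normr_ge0 r1; have r11 := ler_norm r1.
have X0 : 0 <= X by rewrite /X; lra.
have XN := archi_boundP X0; set N := Num.bound X in XN.
have N0 : 1 <= N%:R :> R by rewrite /X in XN; lra.
exists ((N%:R + 1/2) ^+ 2 / 4).
have NN : N%:R <= N%:R ^+ 2 :> R by rewrite expr2 ler_peMr//; lra.
split; [by rewrite divr_gt0// exprn_gt0//; lra|by rewrite sqrrD /X in XN *; lra|].
move=> rho t0 nr; rewrite /off_sine.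
have [t1|t1] := leP 1 (2 * pi * complex.Im rho); [by left|right].
have [a aE] : exists a : R, a = 2 * pi * complex.Re rho by eexists.
have [t tE] : exists t : R, t = 2 * pi * complex.Im rho by eexists.
rewrite -aE; rewrite -tE in t1.
have t00 : 0 <= t by rewrite tE mulr_ge0// mulr_ge0// pi_ge0.
have [A AE] : exists A : R, A = pi * (N%:R + 1/2) by eexists.
have at2 : a ^+ 2 + t ^+ 2 = 4 * pi ^+ 2 * nsq rho by rewrite aE tE /nsq; ring.
have A2 : A ^+ 2 = 4 * pi ^+ 2 * ((N%:R + 1/2) ^+ 2 / 4) by rewrite AE; field.
have d1 : nsq rho <= (N%:R + 1/2) ^+ 2 / 4 + nrm z0.
  by rewrite -nr -nrm_sqr_nsq; have := nrmD (rho ^+ 2 - z0) z0; rewrite subrK.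
have d2 : (N%:R + 1/2) ^+ 2 / 4 - nrm z0 <= nsq rho.
  by rewrite -nr -nrm_sqr_nsq; have := nrmB (rho ^+ 2) z0; lra.
have pp : 0 <= 4 * pi ^+ 2 :> R by rewrite mulr_ge0// sqr_ge0.
have e1 := ler_wpM2l pp d1; have e2 := ler_wpM2l pp d2.
(* From here on t < 1, so that the square of a is close to that of A. *)
have t2 : t ^+ 2 <= 1 by rewrite expr2 mulr_ile1//; lra.
have t20 := sqr_ge0 t.
have A0 : 2 * Kz <= A.
  have h : N%:R <= A by rewrite AE -[leLHS]mul1r; apply: ler_pM; lra.
  by rewrite /X in XN; lra.
pose h := `|a| - A.
have hA : `|h| * A <= Kz.
  have -> : `|h| * A = `|h * A| by rewrite normrM (ger0_norm (x := A))//; lra.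
  have : `|h * (`|a| + A)| <= Kz.
    have -> : h * (`|a| + A) = a ^+ 2 - A ^+ 2 by rewrite /h -(real_normK (num_real a));
      ring.
    by rewrite ler_norml /Kz; lra.
  have a0 := normr_ge0 a.
  apply: le_trans; rewrite !normrM; apply: ler_wpM2l => //.
  have A1 : 0 <= A by lra.
  by rewrite (ger0_norm A1) (ger0_norm (addr_ge0 a0 A1)); lra.
have h12 : `|h| <= 1/2.
  rewrite -(@ler_pM2r _ A); last lra.
  lra.
have -> : sin a ^+ 2 = cos h ^+ 2.
  have -> : sin a ^+ 2 = sin `|a| ^+ 2 by case: (ler0P a) => // _; rewrite sinN sqrrN.
  have -> : `|a| = (h + pi / 2) + N%:R * pi by rewrite /h AE; field.
  by rewrite sin_sqr_shift sinDpihalf.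
have := cos_ge_half h12 => c.
have -> : 1/4 = (1/2) ^+ 2 :> R by field.
by rewrite ler_pXn2r// nnegrE; lra.
Qed.

Lemma exists_sqrt (w : C) : exists rho : C, rho ^+ 2 = w /\ 0 <= complex.Im rho.
Proof.
have h := sqr_sqrtc w; have [t|t] := leP 0 (complex.Im (sqrtc w)).
  by exists (sqrtc w).
by exists (- sqrtc w); rewrite sqrrN cImN; split => //; lra.
Qed.

(** N / D extends to a function that is continuous everywhere, holomorphic off
    the zeros of D, and O(1 / |rho|) on large circles; so it is 0. *)
Lemma ratio_vanish (D D' N N' : C -> C) (ex : nat -> C) (c K R0 : R) :
  (forall z, holo_at D D' z) -> (forall z, holo_at N N' z) ->
  (forall z, D z = 0 -> exists n, z = ex n) ->
  (forall z, D z = 0 -> exists L, forall e : R, 0 < e -> exists2 d : R, 0 < d &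
     forall w, w != z -> nrm (w - z) < d -> D w != 0 /\ nrm (N w / D w - L) < e) ->
  0 < c -> 0 <= K ->
  (forall rho : C, 0 <= complex.Im rho -> R0 <= nsq rho -> off_sine rho ->
     c * expR (4 * pi * complex.Im rho) / nsq rho <= nsq (D (rho ^+ 2))) ->
  (forall rho : C, 0 <= complex.Im rho -> R0 <= nsq rho ->
     nsq (N (rho ^+ 2)) <= K * expR (4 * pi * complex.Im rho) / nsq rho ^+ 2) ->
  forall z, N z = 0.
Proof.
move=> hD hN Dex Dlim c0 K0 gD gN.
have : forall z, exists L, D z = 0 -> forall e : R, 0 < e -> exists2 d : R, 0 < d &
     forall w, w != z -> nrm (w - z) < d -> D w != 0 /\ nrm (N w / D w - L) < e.
  move=> z; have [/Dlim[L HL]|nz] := pselect (D z = 0); first by exists L.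
  by exists 0.
move=> /choice[L HL].
pose Phi w := if D w == 0 then L w else N w / D w.
pose Phi' w := N' w / D w + N w * (- D' w / D w ^+ 2).
have hPhi z : D z != 0 -> holo_at Phi Phi' z.
  move=> Dz; apply: (holo_at_ext (holo_at_mul (hN z) (holo_at_inv (hD z) Dz))).
  have [d d0 Hd] := holo_at_neq0 (hD z) Dz; exists d => // w /Hd h.
  have Dw : D w != 0.
    by rewrite -nrm_gt0; apply: lt_le_trans h; rewrite divr_gt0// nrm_gt0.
  by rewrite /Phi (negbTE Dw).
have cPhi z (e : R) : 0 < e -> exists2 d : R, 0 < d &
    forall w, nrm (w - z) < d -> nrm (Phi w - Phi z) < e.
  move=> e0; have [Dz|Dz] := eqVneq (D z) 0; last exact: holo_at_cont (hPhi z Dz) e e0.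
  have [d d0 Hd] := HL z Dz e e0; exists d => // w wd.
  have [->|wz] := eqVneq w z; first by rewrite subrr nrm0.
  by have [Dw] := Hd w wz wd; rewrite /Phi Dz eqxx (negbTE Dw).
have Phi0 z : Phi z = 0.
  apply: (@liouville R Phi Phi' ex z cPhi) => [y ny|e e0].
    by apply: hPhi; apply/eqP => /Dex[n yn]; have := ny n; rewrite yn eqxx.
  (* Beyond M the quotient of the two growth bounds is below e^2. *)
  pose M := Num.max (Num.max R0 1) (K / (c * e ^+ 2)).
  have [r [r0 rM Hr]] := good_circle z (M + nrm z).
  exists r => // w wr; have [rho [rw t0]] := exists_sqrt w.
  have rhoM : M <= nsq rho.
    by rewrite -nrm_sqr_nsq rw; have := nrmB w z; lra.
  have := rhoM; rewrite !ge_max => /andP[/andP[h1 h2] h3].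
  have g1 := gD rho t0 h1 (Hr rho t0 ltac:(by rewrite rw)).
  have g2 := gN rho t0 h1.
  rewrite rw in g1 g2.
  set E := expR _ in g1 g2; have E0 : 0 < E by exact: expR_gt0.
  have n0 : 0 < nsq rho by lra.
  have D0 : 0 < nsq (D w) by apply: lt_le_trans g1; rewrite divr_gt0// mulr_gt0.
  have Dw : D w != 0 by rewrite -nsq_gt0.
  rewrite /Phi (negbTE Dw) -(@ler_pXn2r _ 2)// ?nnegrE ?nrm_ge0 ?(ltW e0)//.
  rewrite nrm_sqr nsqM nsqV ler_pdivrMr//.
  apply: le_trans g2 _.
  apply: (@le_trans _ _ (e ^+ 2 * (c * E / nsq rho))); last first.
    by rewrite ler_wpM2l// sqr_ge0.
  have ce : 0 < c * e ^+ 2 by rewrite mulr_gt0// exprn_gt0.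
  rewrite ler_pdivrMr// in h3.
  have -> : K * E / nsq rho ^+ 2 = K * (E / nsq rho ^+ 2) by ring.
  have -> : e ^+ 2 * (c * E / nsq rho) = nsq rho * (c * e ^+ 2) * (E / nsq rho ^+ 2).
    by field; rewrite gt_eqF.
  by rewrite ler_wpM2r// divr_ge0// ?ltW// exprn_gt0.
have N0 w : D w != 0 -> N w = 0.
  move=> Dw; have := Phi0 w; rewrite /Phi (negbTE Dw) => /eqP.
  by rewrite mulf_eq0 invr_eq0 (negbTE Dw) orbF => /eqP.
move=> z; have [Dz|] := eqVneq (D z) 0; last exact: N0.
apply/eqP; rewrite -nrm_eq0 eq_le nrm_ge0 andbT; apply/ler_addgt0Pr => e e0; rewrite add0r.
have [d d0 Hd] := holo_at_cont (hN z) e0.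
have [d' d'0 Hd'] := HL z Dz 1 ltr01.
pose m := Num.min d d' / 2.
have m0 : 0 < m by rewrite divr_gt0// lt_min d0.
have md : m < d /\ m < d'.
  have := lexx (Num.min d d'); rewrite {2}/Num.min /m; case: ltP => h; rewrite ?lt_min;
    split; lra.
pose w := z + Complex m 0.
have nw : nrm (w - z) = m by rewrite /w (addrC z) addrK nrm_real gtr0_norm.
have wz : w != z by rewrite -subr_eq0 -nrm_gt0 nw.
have [Dw _] := Hd' w wz ltac:(by rewrite nw; exact: md.2).
have := Hd w ltac:(by rewrite nw; exact: md.1).
by rewrite N0// sub0r nrmN => /ltW.
Qed.

End Ratio.

(** * Comparison with the free equation *)

Section Free.
Context {R : realType}.
Local Notation mu := (@lebesgue_measure R).
Local Notation C := R[i].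

Definition cexp (u v x : R) : C :=
  Complex (expR (u * x) * cos (v * x)) (expR (u * x) * sin (v * x)).

Lemma ac_deriv_scaled_id a b (c : R) : a <= b -> ac_deriv a b (fun x => c * x) (fun=> c).
Proof.
move=> ab; apply: ac_deriv_ext (ac_deriv_mul ab (ac_deriv_cst a b c) (ac_deriv_id a b)) _
  _ => //.
by apply: aeW => x _; ring.
Qed.

Lemma is_derive_scaled (f f' : R -> R) (c x : R) : (forall x : R, is_derive x 1 f (f' x)) ->
  is_derive x 1 (fun x => f (c * x)) (c * f' (c * x)).
Proof.
move=> df; have h : is_derive x 1 (fun x : R => c * x) c.
  have := is_deriveM (is_derive_cst c x 1) (is_derive_id x (1 : R)).
  by move=> /is_derive_eq; apply; rewrite /GRing.scale /= mulr1 mulr0 addr0.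
by have := is_derive1_comp (df (c * x)) h; rewrite mulrC.
Qed.

Lemma cac_deriv_cexp a b u v : a <= b ->
  cac_deriv a b (cexp u v) (fun x => Complex u v * cexp u v x).
Proof.
move=> ab; have he := ac_deriv_exp ab (ac_deriv_scaled_id u ab).
have hc : ac_deriv a b (fun x => cos (v * x)) (fun x => v * - sin (v * x)).
  apply: (@ac_deriv_smooth R a b _ _ `|v|) => // x;
    first exact: (is_derive_scaled _ _ (fun x => is_derive_cos x)).
  by move=> _; rewrite normrM ler_piMr// normrN ler_norml sin_geN1 sin_le1.
have hs : ac_deriv a b (fun x => sin (v * x)) (fun x => v * cos (v * x)).
  apply: (@ac_deriv_smooth R a b _ _ `|v|) => // x;
    first exact: (is_derive_scaled _ _ (fun x => is_derive_sin x)).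
  by move=> _; rewrite normrM ler_piMr// ler_norml cos_geN1 cos_le1.
split.
  by apply: ac_deriv_ext (ac_deriv_mul ab he hc) _ _ => //; apply: aeW => x _;
    rewrite /=; ring.
by apply: ac_deriv_ext (ac_deriv_mul ab he hs) _ _ => //; apply: aeW => x _; rewrite /=;
  ring.
Qed.

(** i rho *)
Definition imul (rho : C) : C := Complex (- complex.Im rho) (complex.Re rho).

Lemma imul_sqr rho : imul rho ^+ 2 = - rho ^+ 2.
Proof.
by apply/eqP; rewrite eq_complex !expr2 !ReImE /=; apply/andP; split; apply/eqP; ring.
Qed.

Lemma nsq_imul rho : nsq (imul rho) = nsq rho.
Proof. by rewrite /nsq /= sqrrN addrC. Qed.

(** exp (i rho x) *)
Definition exp_plus (rho : C) := cexp (- complex.Im rho) (complex.Re rho).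
(** exp (- i rho x) *)
Definition exp_minus (rho : C) := cexp (complex.Im rho) (- complex.Re rho).

(** sin (rho x) / rho *)
Definition sfree (rho : C) x := (2 * imul rho)^-1 * (exp_plus rho x - exp_minus rho x).
(** cos (rho x) *)
Definition sfree1 (rho : C) x := 2^-1 * (exp_plus rho x + exp_minus rho x).

Lemma sfree_forced_sol a b rho : a <= b -> rho != 0 ->
  forced_sol a b (rho ^+ 2) (fun x => (fun=> 0) x * sfree rho x) (sfree rho) (sfree1 rho).
Proof.
move=> ab rho0; have w0 : imul rho != 0 by rewrite -nsq_eq0 nsq_imul nsq_eq0.
have hp : cac_deriv a b (exp_plus rho) (fun x => imul rho * exp_plus rho x).
  exact: (cac_deriv_cexp (- complex.Im rho) (complex.Re rho) ab).
have hm : cac_deriv a b (exp_minus rho) (fun x => - imul rho * exp_minus rho x).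
  apply: cac_deriv_ext (cac_deriv_cexp (complex.Im rho) (- complex.Re rho) ab) _ _ => //.
  apply: aeW => x _; congr (_ * _); rewrite /imul; apply/eqP.
  by rewrite eq_complex /= opprK !eqxx.
split.
  apply: cac_deriv_ext (cac_deriv_scale (2 * imul rho)^-1 ab (cac_deriv_subr ab hp hm)) _
    _ => //.
  by apply: aeW => x _; rewrite /sfree1; field.
apply: cac_deriv_ext (cac_deriv_scale 2^-1 ab (cac_deriv_add hp hm)) _ _ => //.
apply: aeW => x _; rewrite mul0r addr0 -imul_sqr /sfree.
by field.
Qed.

Lemma sfree0 rho : sfree rho 0 = 0.
Proof. by rewrite /sfree /exp_plus /exp_minus /cexp !mulr0 expR0 cos0 sin0 !mulr0 mulr1
  subrr mulr0. Qed.

Lemma sfree10 rho : sfree1 rho 0 = 1.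
Proof.
rewrite /sfree1 /exp_plus /exp_minus /cexp !mulr0 expR0 cos0 sin0 !mulr0 mulr1.
have -> : Complex 1 0 = 1 :> C by [].
by field.
Qed.

Definition free_const : R := (4 * expR 2)^-1.

Lemma free_const_gt0 : 0 < free_const.
Proof. by rewrite invr_gt0 mulr_gt0// expR_gt0. Qed.

(** |2 sin (v + i u)|^2 = (e^u - e^(- u))^2 + 4 sin^2 v; the first term is
    enough when u >= 1, the second one when u < 1. *)
Lemma sfree_lower rho (x : R) : rho != 0 -> 0 <= complex.Im rho -> 0 <= x ->
  1 <= x * complex.Im rho \/ 1/4 <= sin (x * complex.Re rho) ^+ 2 ->
  free_const * expR (2 * complex.Im rho * x) <= 4 * nsq rho * nsq (sfree rho x).
Proof.
move=> rho0 t0 x0 H.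
have n0 : nsq rho != 0 by rewrite nsq_eq0.
have -> : 4 * nsq rho * nsq (sfree rho x) = nsq (exp_plus rho x - exp_minus rho x).
  rewrite /sfree nsqM nsqV nsqM nsq_imul.
  have -> : nsq (2 : C) = 4 by rewrite /nsq /=; ring.
  by field.
set u := x * complex.Im rho in H; set v := x * complex.Re rho in H.
have u0 : 0 <= u by exact: mulr_ge0.
have -> : nsq (exp_plus rho x - exp_minus rho x) =
  (expR u - expR (- u)) ^+ 2 + 4 * sin v ^+ 2.
  rewrite /nsq /exp_plus /exp_minus /cexp !ReImE /=.
  have -> : - complex.Im rho * x = - u by rewrite /u; ring.
  have -> : complex.Im rho * x = u by rewrite /u; ring.
  have -> : - complex.Re rho * x = - v by rewrite /v; ring.
  have -> : complex.Re rho * x = v by rewrite /v; ring.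
  rewrite cosN sinN.
  have e1 : expR u * expR (- u) = 1 by rewrite -expRD subrr expR0.
  have c2 : cos v ^+ 2 = 1 - sin v ^+ 2 by rewrite -(cos2Dsin2 v); ring.
  transitivity ((expR u - expR (- u)) ^+ 2 * cos v ^+ 2 +
    ((expR u - expR (- u)) ^+ 2 + 4 * (expR u * expR (- u))) * sin v ^+ 2); first by ring.
  by rewrite e1 c2; ring.
have -> : expR (2 * complex.Im rho * x) = expR u ^+ 2.
  by rewrite expr2 -expRD; congr expR; rewrite /u; ring.
have E2 : 1 <= expR 2 :> R by rewrite -expR0 ler_expR.
have s0 := sqr_ge0 (sin v); have e0 := sqr_ge0 (expR u - expR (- u)).
have eu := expR_gt0 u.
case: H => [u1|sv].
  have h : expR (- u) <= expR u / 2.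
    rewrite expRN -[leLHS]mul1r ler_pdivrMr//.
    have := expR_ge1Dx (u + u); rewrite expRD; lra.
  have h2 : (expR u / 2) ^+ 2 <= (expR u - expR (- u)) ^+ 2.
    by rewrite ler_pXn2r ?nnegrE//; lra.
  have h3 : free_const <= 1/4.
    by rewrite /free_const invfM mul1r ler_piMr// invf_le1//; lra.
  have := ler_wpM2r (sqr_ge0 (expR u)) h3; rewrite expr2 in h2; rewrite expr2 in h2 *.
  by rewrite expr2; lra.
have [u1|u1] := leP 1 u.
  have h : expR (- u) <= expR u / 2.
    rewrite expRN -[leLHS]mul1r ler_pdivrMr//.
    have := expR_ge1Dx (u + u); rewrite expRD; lra.
  have h2 : (expR u / 2) ^+ 2 <= (expR u - expR (- u)) ^+ 2.
    by rewrite ler_pXn2r ?nnegrE//; lra.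
  have h3 : free_const <= 1/4.
    by rewrite /free_const invfM mul1r ler_piMr// invf_le1//; lra.
  have := ler_wpM2r (sqr_ge0 (expR u)) h3; lra.
have h : expR u ^+ 2 <= expR 2 by rewrite expr2 -expRD ler_expR; lra.
have : free_const * expR u ^+ 2 <= 1/4.
  rewrite /free_const mulrC ler_pdivrMr ?mulr_gt0 ?expR_gt0//; lra.
lra.
Qed.

Lemma sq_primitive0 (T : R) : sq_primitive T (fun=> 0 : C) (fun=> 0).
Proof. by have := @ac_deriv_cst R 0 T 0; rewrite /sq_primitive nsq0. Qed.

Variables (T : R) (q : R -> C) (H : R -> R).
Hypothesis hH : sq_primitive T q H.

Definition diff_const (H H' : R ->
  R) := (growth_const T H + growth_const T H') * growth_const T H * growth_const T H'.

(** The solution differs from sin (rho x) / rho by O(e^(x Im rho) / |rho|^2). *)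
Lemma solution_lower_bound (rho : C) (y y1 : R -> C) (x : R) :
  forced_sol 0 T (rho ^+ 2) (fun x => q x * y x) y y1 -> y 0 = 0 -> y1 0 = 1 ->
  0 <= complex.Im rho -> 1 + 16 * diff_const H (fun=> 0) / free_const <= nsq rho ->
    0 <= x <= T ->
  1 <= x * complex.Im rho \/ 1/4 <= sin (x * complex.Re rho) ^+ 2 ->
  free_const / 16 * expR (2 * complex.Im rho * x) / nsq rho <= nsq (y x).
Proof.
move=> hy y0 y10 t0 big xT off; have T0 : 0 <= T by case/andP: xT => [? ?]; lra.
have c0 := free_const_gt0.
have K0 : 0 < growth_const T H by exact: expR_gt0.
have K1 : 0 < growth_const T (fun=> 0) by exact: expR_gt0.
have C0 : 0 <= diff_const H (fun=> 0).
  by rewrite /diff_const; apply: mulr_ge0; [apply: mulr_ge0|]; lra.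
have d0 : 0 <= 16 * diff_const H (fun=> 0) / free_const by apply: divr_ge0; lra.
have r1 : 1 <= nsq rho by lra.
have n0 : 0 < nsq rho by lra.
have rho0 : rho != 0 by rewrite -nsq_gt0.
have := solution_diff_bound hH (sq_primitive0 T) hy (sfree_forced_sol T0 rho0) y0 y10
  (sfree0 _) (sfree10 _) t0 r1 xT.
rewrite -/(diff_const H (fun=> 0)).
have := sfree_lower rho0 t0 _ off; case/andP: xT => x0 xT => /(_ x0).
set E := expR _; have E0 : 0 < E by exact: expR_gt0.
set r := nsq rho in r1 n0 big *; set K := diff_const _ _ in C0 big d0 *.
move=> h1 h2.
have h3 := nsq_ge0 (y1 x - sfree1 rho x).
have h4 : nsq (sfree rho x) <= 2 * nsq (y x) + 2 * nsq (y x - sfree rho x).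
  have := nsqB_le (y x) (y x - sfree rho x).
  by rewrite opprB addrCA subrr addr0.
have h5 : K <= free_const / 16 * r.
  have h : 16 * K / free_const <= r by lra.
  by rewrite ler_pdivrMr// in h; lra.
have h6 : K / r * E <= free_const / 16 * E.
  by rewrite ler_wpM2r ?(ltW E0)// ler_pdivrMr.
rewrite ler_pdivrMr//.
have := ler_wpM2l (ltW n0) h4; lra.
Qed.

End Free.

(** * Solutions in the sense of the definitions *)

Section FromDefs.
Context {R : realType}.
Local Notation mu := (@lebesgue_measure R).
Local Notation C := R[i].

Lemma sq_primitive_exists (T : R) (q : R -> C) : 0 <= T -> square_integrable 0 T q ->
  exists H, sq_primitive T q H.
Proof. by move=> T0 [_ _ h]; exact: ac_deriv_primitive T0 h. Qed.

Lemma is_solution_forced_sol (q : R -> C) l y y1 : is_solution q l y y1 ->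
  forced_sol 0 (2 * pi) l (fun x => q x * y x) y y1.
Proof.
move=> [[cr ci] dy [acr aci] dy1].
have T0 : 0 <= 2 * pi :> R by rewrite mulr_ge0// pi_ge0.
split.
  have [Mr Mr0 HMr] := ac_bounded T0 acr; have [Mi Mi0 HMi] := ac_bounded T0 aci.
  split.
    apply: (ac_deriv_bounded_derive Mr0 cr) => x xT; split; first by have [] := dy x xT.
    by apply: HMr; case/andP: xT => ? ?; rewrite !ltW.
  apply: (ac_deriv_bounded_derive Mi0 ci) => x xT; split; first by have [] := dy x xT.
  by apply: HMi; case/andP: xT => ? ?; rewrite !ltW.
have e (x : R) y2 : - y2 + q x * y x = l * y x -> y2 = - l * y x + q x * y x.
  by move=> h; rewrite mulNr -h; ring.
split; split => //.
  by apply: (aeS dy1) => x Hx /Hx[y2 [h _] /e <-].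
by apply: (aeS dy1) => x Hx /Hx[y2 [_ h] /e <-].
Qed.

End FromDefs.

(** * Wronskians, local identities and punctured limits *)

Section Pieces.
Context {R : realType}.
Local Notation mu := (@lebesgue_measure R).
Local Notation C := R[i].

Lemma wronskian a b l (q y y1 z z1 : R -> C) : a <= b ->
  forced_sol a b l (fun x => q x * y x) y y1 -> forced_sol a b l (fun x =>
    q x * z x) z z1 ->
  y b * z1 b - y1 b * z b = y a * z1 a - y1 a * z a.
Proof.
move=> ab [hy hy1] [hz hz1].
apply: (cac_deriv0_const ab (cac_deriv_subr ab (cac_deriv_mul ab hy hz1) (cac_deriv_mul
  ab hy1 hz))).
by apply: aeW => x _; ring.
Qed.

(** For comparison with a solution that has zero data at a point. *)
Lemma zero_forced_sol a b l (q : R -> C) : forced_sol a b l (fun x =>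
  q x * (fun=> 0) x) (fun=> 0) (fun=> 0).
Proof.
split; first exact: cac_deriv_cst.
by apply: cac_deriv_ext (cac_deriv_cst a b 0) _ _ => //; apply: aeW => x _;
  rewrite !mulr0 addr0.
Qed.

(** Stated for a given derivative, so that identities between solutions can be
    differentiated. *)
Lemma is_derive_locally0 (f : R -> R) (a b x l : R) : a < x < b ->
  (forall y, a < y < b -> f y = 0) -> is_derive x 1 f l -> l = 0.
Proof.
move=> /andP[ax xb] f0 df; apply/eqP; rewrite -normr_le0; apply/ler_addgt0Pr => e e0.
have [d d0 Hd] := is_derive_eps df e0.
pose h := Num.min d (b - x) / 2.
have h0 : 0 < h by rewrite divr_gt0// lt_min d0 subr_gt0.
have [hd hb] : h < d /\ h < b - x.
  by rewrite /h; case: (leP d (b - x)) => ?; split; lra.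
have := Hd (x + h); rewrite (addrC x) addrK (gtr0_norm h0) => /(_ hd).
rewrite f0 ?f0; try lra.
by rewrite subrr sub0r normrN normrM (gtr0_norm h0) ler_pM2r// add0r.
Qed.

Lemma is_cderive_locally0 (f : R -> C) (a b x : R) (l : C) : a < x < b ->
  (forall y, a < y < b -> f y = 0) -> is_cderive f x l -> l = 0.
Proof.
move=> axb f0 [h1 h2]; apply/eqP; rewrite eq_complex; apply/andP; split; apply/eqP.
  by apply: is_derive_locally0 axb _ h1 => y /f0 ->.
by apply: is_derive_locally0 axb _ h2 => y /f0 ->.
Qed.

Lemma is_cderive_mul (f g : R -> C) x a b : is_cderive f x a -> is_cderive g x b ->
  is_cderive (fun t => f t * g t) x (f x * b + a * g x).
Proof.
move=> [f1 f2] [g1 g2]; split.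
  have -> : (fun t => complex.Re (f t * g t)) =
      (fun t => complex.Re (f t)) * (fun t => complex.Re (g t)) -
      (fun t => complex.Im (f t)) * (fun t => complex.Im (g t)).
    by apply/funext => t; exact: cReM.
  have := is_deriveB (is_deriveM f1 g1) (is_deriveM f2 g2).
  by move=> /is_derive_eq; apply; rewrite cReD !cReM /GRing.scale /=; lra.
have -> : (fun t => complex.Im (f t * g t)) =
    (fun t => complex.Re (f t)) * (fun t => complex.Im (g t)) +
    (fun t => complex.Im (f t)) * (fun t => complex.Re (g t)).
  by apply/funext => t; exact: cImM.
have := is_deriveD (is_deriveM f1 g2) (is_deriveM f2 g1).
by move=> /is_derive_eq; apply; rewrite cImD !cImM /GRing.scale /=; lra.
Qed.

Lemma is_cderive_sub (f g : R -> C) x a b : is_cderive f x a -> is_cderive g x b ->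
  is_cderive (fun t => f t - g t) x (a - b).
Proof.
move=> [f1 f2] [g1 g2]; split.
  have -> : (fun t => complex.Re (f t - g t)) = (fun t => complex.Re (f t)) - (fun t =>
    complex.Re (g t)).
    by apply/funext => t /=; rewrite !ReImE.
  by apply: is_derive_eq; rewrite !ReImE.
have -> : (fun t => complex.Im (f t - g t)) = (fun t => complex.Im (f t)) - (fun t =>
  complex.Im (g t)).
  by apply/funext => t /=; rewrite !ReImE.
by apply: is_derive_eq; rewrite !ReImE.
Qed.

(** From the topology of R[i] to real moduli. *)
Lemma entire_cont (g : C -> C) z : entire g -> forall e : R, 0 < e -> exists2 d : R, 0 < d &
  forall w, nrm (w - z) < d -> nrm (g w - g z) < e.
Proof.
move=> hg e e0.
have cg : {for z, continuous (g : C^o -> C^o)}.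
  by apply/differentiable_continuous/derivable1_diffP; exact: hg.
have ec0 : 0 < e%:C%C by rewrite ltcR.
have /cvgrPdist_lt/(_ _ ec0) := cg.
move=> /nbhs_ballP[d /= d0 Hd].
have [d' dE] : exists d' : R, d = d'%:C%C.
  move: d0; case: d {Hd} => a b; rewrite ltcE /= => /andP[/eqP -> _]; by exists a.
rewrite dE ltcR in d0; exists d' => // w wd.
have := Hd w; rewrite /ball /= dE norm_nrm ltcR (nrm_dist z) => /(_ wd) /=.
by rewrite norm_nrm ltcR nrm_dist.
Qed.

Definition plim (V : C -> C) (z L : C) := forall e : R, 0 < e -> exists2 d : R, 0 < d &
  forall w, w != z -> nrm (w - z) < d -> nrm (V w - L) < e.

Lemma plim_sub V W z L M : plim V z L -> plim W z M -> plim (fun w => V w - W w) z (L - M).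
Proof.
move=> hV hW e e0; have e2 : 0 < e / 2 by lra.
have [d d0 Hd] := hV _ e2; have [d' d'0 Hd'] := hW _ e2.
exists (Num.min d d'); first by rewrite lt_min d0.
move=> w wz; rewrite lt_min => /andP[/(Hd _ wz) h /(Hd' _ wz) h'].
have -> : V w - W w - (L - M) = (V w - L) - (W w - M) by ring.
by apply: le_lt_trans (nrmB _ _) _; lra.
Qed.

Lemma plim_mul V W z L M : plim V z L -> plim W z M -> plim (fun w => V w * W w) z (L * M).
Proof.
move=> hV hW e e0; have L0 := nrm_ge0 L; have M0 := nrm_ge0 M.
have p : 0 < nrm L + nrm M + 1 by lra.
have e2 : 0 < Num.min 1 (e / (nrm L + nrm M + 1)) by rewrite lt_min ltr01 divr_gt0.
have [d d0 Hd] := hV _ e2; have [d' d'0 Hd'] := hW _ e2.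
exists (Num.min d d'); first by rewrite lt_min d0.
move=> w wz; rewrite lt_min => /andP[/(Hd _ wz)].
rewrite lt_min ltr_pdivlMr// => /andP[h1 h2] /(Hd' _ wz); rewrite lt_min => /andP[k1 k2].
have k3 := nrm_ge0 (W w - M).
have k4 : nrm (V w - L) * nrm (W w - M) <= nrm (V w - L) by rewrite ler_piMr ?nrm_ge0// ltW.
have -> : V w * W w - L * M = (V w - L) * (W w - M) + (V w - L) * M + L * (W w - M) by ring.
apply: le_lt_trans (nrmD _ _) _; apply: le_lt_trans (lerD (nrmD _ _) (lexx _)) _.
rewrite !nrmM; rewrite ltr_pdivlMr// in k2.
case: (leP (nrm (V w - L)) (nrm (W w - M))) => c.
  have := ler_wpM2r M0 c; lra.
have := ler_wpM2l L0 (ltW c); lra.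
Qed.

Lemma holo_plim f f' z : holo_at f f' z -> plim f z (f z).
Proof. by move=> h e /(holo_at_cont h)[d d0 Hd]; exists d => // w _; exact: Hd. Qed.

Lemma entire_plim g z : entire g -> plim g z (g z).
Proof. by move=> h e /(entire_cont z h)[d d0 Hd]; exists d => // w _; exact: Hd. Qed.

Lemma plim_inv V z L : L != 0 -> plim V z L -> plim (fun w => (V w)^-1) z L^-1.
Proof.
move=> L0 hV e e0; have n0 : 0 < nrm L by rewrite nrm_gt0.
have p : 0 < Num.min (nrm L / 2) (e * (nrm L ^+ 2 / 2)).
  by rewrite lt_min divr_gt0// mulr_gt0// divr_gt0// exprn_gt0.
have [d d0 Hd] := hV _ p; exists d => // w wz wd.
have := Hd w wz wd; rewrite lt_min => /andP[h1 h2].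
have h3 : nrm L / 2 < nrm (V w).
  by have := nrmB (V w) (V w - L); rewrite opprB addrCA subrr addr0; lra.
have v0 : V w != 0 by rewrite -nrm_gt0; lra.
have -> : (V w)^-1 - L^-1 = (L - V w) * ((V w)^-1 * L^-1) by field; rewrite v0 L0.
rewrite nrmM nrm_dist nrmM !nrmV.
have k : (nrm (V w))^-1 * (nrm L)^-1 <= (nrm L ^+ 2 / 2)^-1.
  have h4 := ler_wpM2r (ltW n0) (ltW h3).
  have p1 : 0 < nrm (V w) * nrm L by rewrite mulr_gt0// nrm_gt0.
  have p2 : 0 < nrm L ^+ 2 / 2 by rewrite divr_gt0// exprn_gt0.
  by rewrite -invfM lef_pV2 ?posrE// expr2; lra.
apply: le_lt_trans (ler_wpM2l (nrm_ge0 _) k) _.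
by rewrite ltr_pdivrMr// divr_gt0// exprn_gt0.
Qed.

End Pieces.

(** * Equality of the characteristic functions and its consequences *)

Section System.
Context {R : realType}.
Local Notation mu := (@lebesgue_measure R).
Local Notation C := R[i].
Local Notation T := (2 * pi : R).

Definition sol_system (q : R -> C) (S S1 psi psi1 : R -> C -> C) := forall l,
  [/\ forced_sol 0 T l (fun x => q x * S x l) (S ^~ l) (S1 ^~ l), S 0 l = 0, S1 0 l = 1 &
  [/\ forced_sol 0 T l (fun x => q x * psi x l) (psi ^~ l) (psi1 ^~ l),
      psi T l = 0 & psi1 T l = -1]].

Lemma twopi_ge0 : 0 <= T.
Proof. by rewrite mulr_ge0// pi_ge0. Qed.

Lemma zero_in : 0 <= (0 : R) <= T. Proof. by rewrite lexx twopi_ge0. Qed.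
Lemma twopi_in : 0 <= T <= T. Proof. by rewrite lexx twopi_ge0. Qed.

Section One.
Variables (q : R -> C) (H : R -> R) (S S1 psi psi1 : R -> C -> C).
Hypothesis hH : sq_primitive T q H.
Hypothesis sys : sol_system q S S1 psi psi1.

(** The Wronskian is constant and is S (2 pi) at 2 pi: for x = pi this says
    that the characteristic function is S (2 pi). *)
Lemma sys_wronskian x l : 0 <= x <= T -> psi x l * S1 x l - psi1 x l * S x l = S T l.
Proof.
move=> /andP[x0 xT]; have [hS _ _ [hp p0 p1]] := sys l.
have := wronskian xT (forced_sol_sub x0 (lexx _) hp) (forced_sol_sub x0 (lexx _) hS).
by rewrite p0 p1 => <-; ring.
Qed.

Lemma sys_holo_S x : 0 <= x <= T ->
  (exists G', forall z, holo_at (S x) G' z) /\ (exists G', forall z, holo_at (S1 x) G' z).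
Proof.
apply: (@fam_holo R T q H hH twopi_ge0 S S1 0 0 1) => [l||l|l]; last 2 first.
- by have [] := sys l.
- by have [] := sys l.
- by have [] := sys l.
- exact: zero_in.
Qed.

Lemma sys_holo_psi x : 0 <= x <= T ->
  (exists G', forall z, holo_at (psi x) G' z) /\ (exists G', forall z,
    holo_at (psi1 x) G' z).
Proof.
apply: (@fam_holo R T q H hH twopi_ge0 psi psi1 T 0 (-1)) => [l||l|l]; last 2 first.
- by have [_ _ _ []] := sys l.
- by have [_ _ _ []] := sys l.
- by have [_ _ _ []] := sys l.
- exact: twopi_in.
Qed.

Lemma solution_growth_left (rho : C) x : 0 <= complex.Im rho -> 1 <= nsq rho ->
  0 <= x <= T ->
  nsq (S1 x (rho ^+ 2)) + nsq rho * nsq (S x (rho ^+ 2)) <=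
    growth_const T H * expR (2 * complex.Im rho * x).
Proof.
move=> t0 r1 xT; have [hS s0 s1 _] := sys (rho ^+ 2).
have := energy_growth_fwd hH hS t0 r1 xT; rewrite /energy s0 s1 nsq0 nsq1 mulr0 addr0 mul1r.
exact.
Qed.

Lemma solution_growth_right (rho : C) x : 0 <= complex.Im rho -> 1 <= nsq rho ->
  0 <= x <= T ->
  nsq (psi1 x (rho ^+ 2)) + nsq rho * nsq (psi x (rho ^+ 2)) <=
    growth_const T H * expR (2 * complex.Im rho * (T - x)).
Proof.
move=> t0 r1 xT; have [_ _ _ [hS s0 s1]] := sys (rho ^+ 2).
have := energy_growth_bwd hH hS t0 r1 xT.
rewrite /energy s0 s1 nsq0 nsqN nsq1 mulr0 addr0 mul1r; exact.
Qed.

Definition lower_radius := 1 + 16 * diff_const T H (fun=> 0) / free_const.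

Lemma lower_radius_ge1 : 1 <= lower_radius.
Proof.
have c0 := @free_const_gt0 R.
rewrite lerDl; apply: divr_ge0; last exact: ltW.
have K0 : 0 < growth_const T H by exact: expR_gt0.
have K1 : 0 < growth_const T (fun=> 0) by exact: expR_gt0.
by apply: mulr_ge0 => //; apply: mulr_ge0; [apply: mulr_ge0|]; lra.
Qed.

(** The common form of the three growth arguments: an entire function that is
    smaller than the characteristic function by a factor |rho|, and divisible
    by it, is 0. *)
Lemma char_vanish (N N' : C -> C) (ex : nat -> C) (K : R) :
  (forall z, holo_at N N' z) ->
  (forall z, S T z = 0 -> exists n, z = ex n) ->
  (forall z, S T z = 0 -> exists2 d : R, 0 < d & forall w, w != z -> nrm (w - z) < d ->
    S T w != 0) ->
  (forall z, S T z = 0 -> exists L, forall e : R, 0 < e -> exists2 d : R, 0 < d &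
     forall w, w != z -> nrm (w - z) < d -> S T w != 0 -> nrm (N w / S T w - L) < e) ->
  0 <= K ->
  (forall rho : C, 0 <= complex.Im rho -> 1 <= nsq rho ->
     nsq (N (rho ^+ 2)) <= K * expR (4 * pi * complex.Im rho) / nsq rho ^+ 2) ->
  forall z, N z = 0.
Proof.
move=> hN Dex iso lim K0 gN.
have [[D' hD] _] := sys_holo_S twopi_in.
apply: (@ratio_vanish R (S T) D' N N' ex (free_const / 16) K lower_radius) => //.
- move=> z Dz; have [d d0 Hd] := iso z Dz; have [L HL] := lim z Dz.
  exists L => e e0; have [d' d'0 Hd'] := HL e e0.
  exists (Num.min d d'); first by rewrite lt_min d0.
  move=> w wz; rewrite lt_min => /andP[/(Hd _ wz) h1 h2]; split => //; exact: Hd'.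
- by rewrite divr_gt0// free_const_gt0.
- move=> rho t0 r0 off; have [hS s0 s1 _] := sys (rho ^+ 2).
  have := solution_lower_bound hH hS s0 s1 t0 r0 twopi_in off.
  by rewrite (_ : 2 * complex.Im rho * T = 4 * pi * complex.Im rho) //; ring.
- by move=> rho t0 r0; apply: gN => //; exact: le_trans lower_radius_ge1 r0.
Qed.

End One.

Section Two.
Variables (q qt : R -> C) (H Ht : R -> R) (S S1 psi psi1 St S1t psit psi1t : R -> C -> C).
Hypothesis hH : sq_primitive T q H.
Hypothesis hHt : sq_primitive T qt Ht.
Hypothesis sys : sol_system q S S1 psi psi1.
Hypothesis syst : sol_system qt St S1t psit psi1t.
Variable ex : nat -> C.
Hypothesis Dex : forall z, S T z = 0 -> exists n, z = ex n.
Hypothesis Dmult : forall z, S T z = 0 -> exists m (g gt : C -> C),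
  [/\ entire g, entire gt, g z != 0, forall w, S T w = (w - z) ^+ m * g w &
      forall w, St T w = (w - z) ^+ m * gt w].
Hypothesis q_right : {ae mu, forall x, pi < x < T -> q x = qt x}.

(** The cofactor g does not vanish near z. *)
Lemma zeros_isolated z : S T z = 0 -> exists2 d : R, 0 < d &
  forall w, w != z -> nrm (w - z) < d -> S T w != 0.
Proof.
move=> /Dmult[m [g [gt [eg _ gz Dg _]]]].
have p : 0 < nrm (g z) by rewrite nrm_gt0.
have [d d0 Hd] := entire_cont z eg p.
exists d => // w wz /Hd h; rewrite Dg mulf_neq0//.
  by rewrite expf_neq0// subr_eq0.
by apply/eqP => gw; move: h; rewrite gw sub0r nrmN ltxx.
Qed.

Lemma diff_growth (rho : C) x : 0 <= complex.Im rho -> 1 <= nsq rho -> 0 <= x <= T ->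
  nsq (S1 x (rho ^+ 2) - S1t x (rho ^+ 2)) +
    nsq rho * nsq (S x (rho ^+ 2) - St x (rho ^+ 2)) <=
    diff_const T H Ht / nsq rho * expR (2 * complex.Im rho * x).
Proof.
move=> t0 r1 xT; have [hS s0 s1 _] := sys (rho ^+ 2);
  have [hSt st0 st1 _] := syst (rho ^+ 2).
exact: solution_diff_bound hH hHt hS hSt s0 s1 st0 st1 t0 r1 xT.
Qed.

Lemma diff_const_ge0 : 0 <= diff_const T H Ht.
Proof.
have K0 : 0 < growth_const T H by exact: expR_gt0.
have K1 : 0 < growth_const T Ht by exact: expR_gt0.
by apply: mulr_ge0; [apply: mulr_ge0|]; lra.
Qed.

(** Equal zeros with equal multiplicities make (St - S) / S at 2 pi regular,
    and the difference of the potentials contributes one order less. *)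
Lemma char_eq l : St T l = S T l.
Proof.
have [[G hG] _] := sys_holo_S hH sys twopi_in;
  have [[Gt hGt] _] := sys_holo_S hHt syst twopi_in.
apply/eqP; rewrite -subr_eq0; apply/eqP; move: l.
apply: (char_vanish hH sys (N := fun l => St T l - S T l) (N' := fun l =>
  Gt l - G l) (K := diff_const T H Ht)) Dex zeros_isolated _ _ _.
- by move=> z; apply: holo_at_sub.
- move=> z /Dmult[m [g [gt [eg egt gz Dg Dgt]]]]; exists (gt z / g z - 1).
  have h := plim_sub (plim_mul (entire_plim z egt) (plim_inv gz (entire_plim z eg)))
     (holo_plim (holo_at_cst 1 z)).
  move=> e e0; have [d d0 Hd] := h e e0; exists d => // w wz wd Dw.
  have := Hd w wz wd; congr (nrm (_ - _) < _).
  have w0 : (w - z) ^+ m != 0 by rewrite expf_neq0// subr_eq0.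
  have gw : g w != 0 by apply: contraNneq Dw => gw; rewrite Dg gw mulr0.
  by rewrite Dg Dgt; field; rewrite w0 gw.
- exact: diff_const_ge0.
move=> rho t0 r1; have h := diff_growth t0 r1 twopi_in.
have n0 : 0 < nsq rho by lra.
rewrite (_ : 4 * pi * complex.Im rho = 2 * complex.Im rho * T); last by ring.
set E := expR _ in h *.
rewrite ler_pdivlMr ?exprn_gt0//.
have h' : nsq rho * nsq (St T (rho ^+ 2) - S T (rho ^+ 2)) <=
  diff_const T H Ht / nsq rho * E.
  by have := nsq_ge0 (S1 T (rho ^+ 2) - S1t T (rho ^+ 2));
    rewrite (nsqB (St T (rho ^+ 2))); lra.
have := ler_wpM2r (ltW n0) h'.
have -> : diff_const T H Ht / nsq rho * E * nsq rho = diff_const T H Ht * E by field;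
  rewrite gt_eqF.
by rewrite expr2; lra.
Qed.

Lemma pi_in : 0 <= (pi : R) <= T.
Proof. by have := @pi_ge0 R; lra. Qed.

(** On (pi, 2 pi) both functions solve the same equation, so their Wronskian
    is the same at pi and at 2 pi. *)
Lemma mixed_wronskian l :
  S pi l * S1t pi l - S1 pi l * St pi l = S T l * (S1t T l - S1 T l).
Proof.
have [hS _ _ _] := sys l; have [hSt _ _ _] := syst l.
have /andP[p0 pT] := pi_in.
have hSt' : forced_sol pi T l (fun x => q x * St x l) (St ^~ l) (S1t ^~ l).
  apply: forced_sol_ext (forced_sol_sub p0 (lexx _) hSt) _.
  by apply: (aeS q_right) => x Hx /Hx ->.
have := wronskian pT (forced_sol_sub p0 (lexx _) hS) hSt'.
by rewrite char_eq => <-; ring.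
Qed.

(** At 2 pi this Wronskian is visibly divisible by the characteristic
    function; at pi it involves both solutions on (0, pi) only, and is
    therefore small. *)
Lemma mixed_wronskian0 l : S pi l * S1t pi l - S1 pi l * St pi l = 0.
Proof.
have [[a ha] [a1 ha1]] := sys_holo_S hH sys pi_in;
  have [[b hb] [b1 hb1]] := sys_holo_S hHt syst pi_in.
have [_ [c hc]] := sys_holo_S hH sys twopi_in;
  have [_ [c1 hc1]] := sys_holo_S hHt syst twopi_in.
move: l; apply: (char_vanish hH sys (N := fun l => S pi l * S1t pi l - S1 pi l * St pi l)
  (fun z => holo_at_sub (holo_at_mul (ha z) (hb1 z)) (holo_at_mul (ha1 z) (hb z)))
  (K := 2 * (diff_const T H Ht * growth_const T Ht) +
    2 * (diff_const T H Ht * growth_const T Ht)) Dex zeros_isolated).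
- move=> z _; exists (S1t T z - S1 T z) => e e0.
  have [d d0 Hd] := holo_plim (holo_at_sub (hc1 z) (hc z)) e0.
  exists d => // w wz wd Dw; rewrite mixed_wronskian mulrC mulKf//; exact: Hd.
- have K1 : 0 < growth_const T Ht by exact: expR_gt0.
  by have := mulr_ge0 diff_const_ge0 (ltW K1); lra.
move=> rho t0 r1; have n0 : 0 < nsq rho by lra.
have h1 := diff_growth t0 r1 pi_in; have h2 := solution_growth_left hHt syst t0 r1 pi_in.
set l := rho ^+ 2 in h1 h2 *.
have -> : S pi l * S1t pi l - S1 pi l * St pi l =
  (S pi l - St pi l) * S1t pi l - (S1 pi l - S1t pi l) * St pi l by ring.
apply: le_trans (nsqB_le _ _) _; rewrite !nsqM.
have EE : expR (4 * pi * complex.Im rho) =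
  expR (2 * complex.Im rho * pi) * expR (2 * complex.Im rho * pi).
  by rewrite -expRD; congr expR; ring.
rewrite EE; set E := expR _ in h1 h2 *.
have E0 : 0 < E by exact: expR_gt0.
set r := nsq rho in n0 r1 h1 h2 *; set K := diff_const _ _ _ in h1 *;
  set Kt := growth_const _ _ in h2 *.
set A := nsq (S pi l - St pi l) in h1 *; set B := nsq (S1t pi l) in h2 *.
set A1 := nsq (S1 pi l - S1t pi l) in h1 *; set B1 := nsq (St pi l) in h2 *.
have A0 : 0 <= A by exact: nsq_ge0. have B0 : 0 <= B by exact: nsq_ge0.
have A10 : 0 <= A1 by exact: nsq_ge0. have B10 : 0 <= B1 by exact: nsq_ge0.
have rA := mulr_ge0 (ltW n0) A0; have rB := mulr_ge0 (ltW n0) B10.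
have k1 : r * A <= K / r * E by lra.
have k2 : B <= Kt * E by lra.
have k3 : A1 <= K / r * E by lra.
have k4 : r * B1 <= Kt * E by lra.
have m1 := ler_pM rA B0 k1 k2; have m2 := ler_pM A10 rB k3 k4.
have KK : K / r * E * (Kt * E) = r * (K * Kt * (E * E) / r ^+ 2).
  by field; rewrite gt_eqF.
have -> : (2 * (K * Kt) + 2 * (K * Kt)) * (E * E) / r ^+ 2 =
  2 * (K * Kt * (E * E) / r ^+ 2) + 2 * (K * Kt * (E * E) / r ^+ 2) by ring.
rewrite KK -mulrA ler_pM2l// in m1.
rewrite KK mulrCA ler_pM2l// in m2.
lra.
Qed.

Lemma end_derivative_eq l : S T l != 0 -> S1t T l = S1 T l.
Proof.
move=> Dl; have := mixed_wronskian l; rewrite mixed_wronskian0 => /esym/eqP.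
by rewrite mulf_eq0 (negbTE Dl) /= subr_eq0 => /eqP.
Qed.

(** (S1 (2 pi) psi + S) / S (2 pi) is the solution with data (1, 0) at 2 pi.
    Away from the zeros of S (2 pi) it depends on l in a Lipschitz way, with
    constants that do not see those zeros; so it has limits there. *)
Lemma eta_limit (q0 : R -> C) (H0 : R -> R) (S0 S10 psi0 psi10 : R -> C -> C) x z :
  sq_primitive T q0 H0 -> sol_system q0 S0 S10 psi0 psi10 ->
  (forall l, S0 T l = S T l) -> 0 <= x <= T -> S T z = 0 ->
  exists L, forall e : R, 0 < e -> exists2 d : R, 0 < d & forall w, w != z ->
    nrm (w - z) < d ->
    nrm ((S10 T w * psi0 x w + S0 x w) / S T w - L) < e.
Proof.
move=> hH0 sys0 S0S xT Sz; have [d d0 Hd] := zeros_isolated Sz.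
pose B := (nrm z + d) ^+ 2.
have bd w : nrm (w - z) < d -> nsq w <= B.
  move=> wd; rewrite -nrm_sqr /B ler_pXn2r// ?nnegrE ?nrm_ge0//.
    by have := nrmD (w - z) z; rewrite subrK; lra.
  by have := nrm_ge0 z; lra.
have eta w : S T w != 0 -> forced_sol 0 T w (fun x =>
  q0 x * ((S10 T w * psi0 x w + S0 x w) / S T w))
   (fun x => (S10 T w * psi0 x w + S0 x w) / S T w) (fun x =>
     (S10 T w * psi10 x w + S10 x w) / S T w).
  move=> Dw; have [hS _ _ [hp _ _]] := sys0 w.
  have [k1 k2] := forced_sol_scale (S T w)^-1 twopi_ge0 (forced_sol_add (forced_sol_scale
    (S10 T w) twopi_ge0 hp) hS).
  split; first by apply: cac_deriv_ext k1 _ _ => [u|]; [rewrite mulrC|apply: aeW => u _;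
    rewrite mulrC].
  by apply: cac_deriv_ext k2 _ _ => [u|]; [rewrite mulrC|apply: aeW => u _; field].
have data_at_end w : S T w != 0 -> (S10 T w * psi0 T w + S0 T w) / S T w = 1 /\
    (S10 T w * psi10 T w + S10 T w) / S T w = 0.
  move=> Dw; have [_ _ _ [_ p0 p1]] := sys0 w; rewrite p0 p1 S0S; split; by field.
pose K := Num.sqrt ((nsq (0 : C) + nsq (1 : C)) * param_const T H0 B ^+ 2).
have lip w w' : w != z -> w' != z -> nrm (w - z) < d -> nrm (w' - z) < d ->
   nrm ((S10 T w * psi0 x w + S0 x w) / S T w - (S10 T w' * psi0 x w' +
     S0 x w') / S T w') <= K * nrm (w - w').
  move=> wz w'z wd w'd; have Dw := Hd w wz wd; have Dw' := Hd w' w'z w'd.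
  have [d1 d2] := data_at_end w Dw; have [d1' d2'] := data_at_end w' Dw'.
  have := lip_pair hH0 twopi_ge0 (eta w Dw) (eta w' Dw') (bd w wd) (bd w' w'd) twopi_in xT.
  rewrite d1 d2 d1' d2' => /(_ erefl erefl) h.
  have := nsq_le_nrm (le_trans (ler_wpDl (nsq_ge0 _) (lexx _)) h).
  by rewrite sqrtrM ?nsq_ge0// [leRHS]mulrC.
have [L HL] := lip_limit d0 lip; exists L => e e0.
have K0 : 0 <= K by exact: sqrtr_ge0.
have K1 : 0 < K + 1 by lra.
exists (Num.min d (e / (K + 1))); first by rewrite lt_min d0 divr_gt0.
move=> w wz; rewrite lt_min ltr_pdivlMr// => /andP[wd we].
have h := HL (fun w => nrm (w - z) < d) K d K0 d0 (fun _ _ h => h)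
  (fun l l' lz l'z ld l'd => lip l l' lz l'z ld l'd) w wz wd.
have n0 : 0 < nrm (w - z) by rewrite nrm_gt0 subr_eq0.
by apply: le_lt_trans h _; lra.
Qed.

(** With eta and etat the solutions of eta_limit, the quotient by S (2 pi) is
    psi etat - eta psit: it has limits at the zeros of S (2 pi). *)
Lemma cross_zero x l : 0 <= x <= T -> psi x l * St x l - S x l * psit x l = 0.
Proof.
move=> xT.
have [[a ha] _] := sys_holo_S hH sys xT; have [[b hb] _] := sys_holo_S hHt syst xT.
have [[c hc] _] := sys_holo_psi hH sys xT; have [[d hd] _] := sys_holo_psi hHt syst xT.
move: l; apply: (char_vanish hH sys (N := fun l => psi x l * St x l - S x l * psit x l)
  (fun z => holo_at_sub (holo_at_mul (hc z) (hb z)) (holo_at_mul (ha z) (hd z)))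
  (K := 2 * (growth_const T H * growth_const T Ht) +
    2 * (growth_const T H * growth_const T Ht)) Dex zeros_isolated).
- move=> z Dz.
  have [L HL] := eta_limit hH sys (fun=> erefl) xT Dz.
  have [M HM] := eta_limit hHt syst char_eq xT Dz.
  exists (psi x z * M - L * psit x z) => e e0.
  have h := plim_sub (plim_mul (holo_plim (hc z)) HM) (plim_mul HL (holo_plim (hd z))).
  have [r r0 Hr] := h e e0; exists r => // w wz wd Dw.
  have := Hr w wz wd; congr (nrm (_ - _) < _).
  by rewrite end_derivative_eq//; field.
- have K0 : 0 < growth_const T H by exact: expR_gt0.
  have K1 : 0 < growth_const T Ht by exact: expR_gt0.
  by have := mulr_ge0 (ltW K0) (ltW K1); lra.
move=> rho t0 r1; have n0 : 0 < nsq rho by lra.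
have h1 := solution_growth_left hH sys t0 r1 xT;
  have h2 := solution_growth_left hHt syst t0 r1 xT.
have h3 := solution_growth_right hH sys t0 r1 xT;
  have h4 := solution_growth_right hHt syst t0 r1 xT.
set l := rho ^+ 2 in h1 h2 h3 h4 *.
apply: le_trans (nsqB_le _ _) _; rewrite !nsqM.
have EE : expR (4 * pi * complex.Im rho) =
  expR (2 * complex.Im rho * x) * expR (2 * complex.Im rho * (T - x)).
  by rewrite -expRD; congr expR; ring.
rewrite EE.
set E := expR (_ * x) in h1 h2 *; set F := expR (_ * (T - x)) in h3 h4 *.
set r := nsq rho in n0 r1 h1 h2 h3 h4 *; set K := growth_const T H in h1 h3 *;
  set Kt := growth_const T Ht in h2 h4 *.
have k1 : r * nsq (S x l) <= K * E by have := nsq_ge0 (S1 x l); lra.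
have k2 : r * nsq (St x l) <= Kt * E by have := nsq_ge0 (S1t x l); lra.
have k3 : r * nsq (psi x l) <= K * F by have := nsq_ge0 (psi1 x l); lra.
have k4 : r * nsq (psit x l) <= Kt * F by have := nsq_ge0 (psi1t x l); lra.
have pos (u : C) : 0 <= r * nsq u by apply: mulr_ge0; [exact: ltW|exact: nsq_ge0].
have m1 := ler_pM (pos _) (pos _) k3 k2; have m2 := ler_pM (pos _) (pos _) k1 k4.
rewrite ler_pdivlMr ?exprn_gt0//.
rewrite expr2; lra.
Qed.

End Two.

End System.

(** * Equality of the potentials *)

Section Final.
Context {R : realType}.
Local Notation mu := (@lebesgue_measure R).
Local Notation C := R[i].
Local Notation T := (2 * pi : R).

(** Differentiating p z = y r and eliminating with the two Wronskians gives D
    (y^2 - z^2) = 0. *)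
Lemma squares_eq (y y1 p p1 z z1 r r1 : R -> C) (D : C) (b : R) : D != 0 ->
  (forall x, 0 < x < b -> [/\ is_cderive y x (y1 x), is_cderive p x (p1 x),
     is_cderive z x (z1 x) & is_cderive r x (r1 x)]) ->
  (forall x, 0 < x < b -> [/\ p x * y1 x - p1 x * y x = D,
     r x * z1 x - r1 x * z x = D & p x * z x - y x * r x = 0]) ->
  forall x, 0 < x < b -> y x ^+ 2 - z x ^+ 2 = 0.
Proof.
move=> D0 der H x xb; have [dy dp dz dr] := der x xb; have [h1 h2 h3] := H x xb.
have h4 : p x * z1 x + p1 x * z x - (y x * r1 x + y1 x * r x) = 0.
  apply: (is_cderive_locally0 xb _ (is_cderive_sub (is_cderive_mul dp dz) (is_cderive_mul
    dy dr))).
  by move=> u /H[].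
apply/eqP; have : D * (y x ^+ 2 - z x ^+ 2) == 0; last by rewrite mulf_eq0 (negbTE D0).
apply/eqP; transitivity ((r x * z1 x - r1 x * z x) * y x ^+ 2 - (p x * y1 x - p1 x * y x)
  * z x ^+ 2).
  by rewrite h1 h2; ring.
transitivity (y x * z x * (p x * z1 x + p1 x * z x - (y x * r1 x + y1 x * r x))
   - (p x * z x - y x * r x) * (y x * z1 x + y1 x * z x)); first by ring.
by rewrite h3 h4; ring.
Qed.

(** Two derivatives of y^2 = z^2 give y^2 (q - qt) = z1^2 - y1^2, and the
    first derivative alone gives y^2 y1^2 = y^2 z1^2. *)
Lemma potential_eq_of_squares (q qt y y1 z z1 : R -> C) (l : C) (b : R) :
  forced_sol 0 b l (fun x => q x * y x) y y1 -> forced_sol 0 b l (fun x =>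
    qt x * z x) z z1 ->
  (forall x, 0 < x < b -> is_cderive y x (y1 x)) ->
  (forall x, 0 < x < b -> is_cderive z x (z1 x)) ->
  (forall x, 0 < x < b -> y x ^+ 2 - z x ^+ 2 = 0) ->
  {ae mu, forall x, 0 < x < b -> y x != 0 -> q x = qt x}.
Proof.
move=> [_ [[_ y2r] [_ y2i]]] [_ [[_ z2r] [_ z2i]]] dy dz sq.
have e1 u : 0 < u < b -> y u * y1 u - z u * z1 u = 0.
  move=> ub; have := is_cderive_locally0 ub sq (is_cderive_sub
     (is_cderive_mul (dy u ub) (dy u ub)) (is_cderive_mul (dz u ub) (dz u ub))).
  move=> h; have : 2 * (y u * y1 u - z u * z1 u) = 0 by rewrite -h; ring.
  by move/eqP; rewrite mulf_eq0 pnatr_eq0 => /eqP.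
have y2 : {ae mu, forall x, 0 < x < b -> is_cderive y1 x (- l * y x + q x * y x)}.
  by apply: (aeS2 y2r y2i) => x hr hi xb; split; [exact: hr|exact: hi].
have z2 : {ae mu, forall x, 0 < x < b -> is_cderive z1 x (- l * z x + qt x * z x)}.
  by apply: (aeS2 z2r z2i) => x hr hi xb; split; [exact: hr|exact: hi].
apply: (aeS2 y2 z2) => x hy hz xb yx; have {}hy := hy xb; have {}hz := hz xb.
have h := is_cderive_locally0 xb e1 (is_cderive_sub
   (is_cderive_mul (dy x xb) hy) (is_cderive_mul (dz x xb) hz)).
have s := sq x xb; have e := e1 x xb.
have zy : z x ^+ 2 = y x ^+ 2 by apply/esym/eqP; rewrite -subr_eq0 s.
have y0 : y x ^+ 2 != 0 by rewrite expf_neq0.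
have d : y1 x ^+ 2 = z1 x ^+ 2.
  apply: (mulfI y0); transitivity ((y x * y1 x) ^+ 2); first by ring.
  have -> : y x * y1 x = z x * z1 x by apply/eqP; rewrite -subr_eq0 e.
  by rewrite -zy; ring.
apply: (mulfI y0).
have h' : y x ^+ 2 * (q x - l) + y1 x ^+ 2 - (z x ^+ 2 * (qt x - l) + z1 x ^+ 2) = 0.
  by rewrite -h; ring.
rewrite zy d in h'.
by apply/eqP; rewrite -subr_eq0; apply/eqP; rewrite -h'; ring.
Qed.

(** On the ray l = - k^2 the solution is close to sinh (k x) / k. *)
Lemma solution_eventually_nonzero (q : R -> C) (H : R -> R) (S S1 psi psi1 : R -> C ->
  C) (x : R) :
  sq_primitive T q H -> sol_system q S S1 psi psi1 -> 0 < x <= T ->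
  exists K : R, forall k : R, K <= k -> S x (Complex 0 k ^+ 2) != 0.
Proof.
move=> hH sys /andP[x0 xT]; exists (Num.max (lower_radius H) x^-1) => k;
  rewrite ge_max => /andP[k1 k2].
have R1 := lower_radius_ge1 H.
have kk : k <= k ^+ 2 by rewrite expr2 ler_peMr; lra.
have n : nsq (Complex 0 k : C) = k ^+ 2 by rewrite /nsq /= expr0n add0r.
have [hS s0 s1 _] := sys (Complex 0 k ^+ 2).
have xT' : 0 <= x <= T by rewrite (ltW x0).
have := solution_lower_bound hH hS s0 s1 (rho := Complex 0 k) _ _ xT' _.
rewrite -nsq_gt0 => h; apply: lt_le_trans (h _ _ _).
- rewrite n divr_gt0 ?mulr_gt0 ?divr_gt0 ?free_const_gt0 ?expR_gt0 ?exprn_gt0//; lra.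
- by rewrite /=; lra.
- by rewrite n; rewrite /lower_radius in k1; lra.
- by left; rewrite /= mulrC -ler_pdivrMr// div1r.
Qed.

(** The equality of squares only compares the potentials where S does not
    vanish; countably many parameters l = - n^2 suffice to reach every x > 0. *)
Lemma half_potential (q qt : R -> C) (H : R -> R) (S S1 psi psi1 St S1t psit psi1t : R ->
  C -> C) :
  sq_primitive T q H -> sol_system q S S1 psi psi1 -> sol_system qt St S1t psit psi1t ->
  (forall l x, 0 < x < T -> [/\ is_cderive (S ^~ l) x (S1 x l),
    is_cderive (psi ^~ l) x (psi1 x l),
     is_cderive (St ^~ l) x (S1t x l) & is_cderive (psit ^~ l) x (psi1t x l)]) ->
  (forall l, St T l = S T l) ->
  (forall x l, 0 <= x <= T -> psi x l * St x l - S x l * psit x l = 0) ->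
  {ae mu, forall x, 0 < x < T -> q x = qt x}.
Proof.
move=> hH sys syst der DD cross.
(* rho = i n, that is l = - n^2 *)
pose l (n : nat) : C := Complex 0 n%:R ^+ 2.
have Q n : {ae mu, forall x, S T (l n) != 0 -> 0 < x < T -> S x (l n) != 0 -> q x = qt x}.
  have [D0|D0] := eqVneq (S T (l n)) 0; first by apply: aeW => x.
  have [hS _ _ _] := sys (l n); have [hSt _ _ _] := syst (l n).
  have cl x : 0 < x < T -> 0 <= x <= T by move=> /andP[? ?]; rewrite !ltW.
  have dS x : 0 < x < T -> is_cderive (S ^~ (l n)) x (S1 x (l n)) by move=> /(der (l n))[].
  have dSt x : 0 < x < T -> is_cderive (St ^~ (l n)) x (S1t x (l n)) by move=> /(der (l
    n))[].
  have sq := @squares_eq _ _ _ _ _ _ _ _ (S T (l n)) T D0 (der (l n)).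
  have := potential_eq_of_squares hS hSt dS dSt (sq _).
  move=> h; apply: (aeS (h _)) => [u ub|x Hx _ xT Sx]; last exact: Hx.
  split; first exact: (sys_wronskian sys _ (cl _ ub)).
    by rewrite (sys_wronskian syst _ (cl _ ub)) DD.
  exact: cross (cl _ ub).
have := ae_foralln Q; move=> h; apply: (aeS h) => x Hx xT.
have T0 : 0 < T by rewrite mulr_gt0// pi_gt0.
have xT' : 0 < x <= T by case/andP: xT => -> /ltW ->.
have [K1 HK1] := solution_eventually_nonzero hH sys xT'.
have [K2 HK2] : exists K : R, forall k : R, K <= k -> S T (Complex 0 k ^+ 2) != 0.
  by apply: (solution_eventually_nonzero hH sys); rewrite T0 lexx.
pose X := `|K1| + `|K2|.
have X0 : 0 <= X by rewrite addr_ge0.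
have XN := archi_boundP X0; set N := Num.bound X in XN.
have a1 := ler_norm K1; have a2 := ler_norm K2; have b1 := normr_ge0 K1;
  have b2 := normr_ge0 K2.
by apply: (Hx N) => //; [apply: HK2|apply: HK1]; rewrite /X in XN; lra.
Qed.

End Final.

Theorem theorem4p3 (R : realType) (q qt : R -> R[i]) (lam lamt : nat -> R[i])
    (hq : square_integrable 0 (2 * pi) q)
    (hqt : square_integrable 0 (2 * pi) qt)
    (hlam : dirichlet_spectrum q lam)
    (hlamt : dirichlet_spectrum qt lamt)
    (hright : {ae (@lebesgue_measure R),
                 forall x, pi < x < 2 * pi -> q x = qt x})
    (heq : forall n : nat, (0 < n)%N -> lam n = lamt n) :
  {ae (@lebesgue_measure R), forall x, 0 < x < pi -> q x = qt x}.
Proof.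
have [eig [D [S [S1 [psi [psi1 [sol DE]]]]] mult] _] := hlam.
have [eigt [Dt [St [S1t [psit [psi1t [solt DtE]]]]] multt] _] := hlamt.
have T0 := @twopi_ge0 R.
have [H hH] := sq_primitive_exists T0 hq; have [Ht hHt] := sq_primitive_exists T0 hqt.
have sys : sol_system q S S1 psi psi1.
  by move=> l; have [/is_solution_forced_sol h1 h2 h3 [/is_solution_forced_sol h4 h5 h6]]
    := sol l.
have syst : sol_system qt St S1t psit psi1t.
  by move=> l; have [/is_solution_forced_sol h1 h2 h3 [/is_solution_forced_sol h4 h5 h6]]
    := solt l.
have DS l : D l = S (2 * pi) l by rewrite DE (sys_wronskian sys _ pi_in).
have DSt l : Dt l = St (2 * pi) l by rewrite DtE (sys_wronskian syst _ pi_in).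
have zero_eig z : S (2 * pi) z = 0 -> dirichlet_eigenvalue q z.
  move=> Sz; have [hz s0 s1 _] := sol z; exists (S ^~ z), (S1 ^~ z); split => //.
  apply: contrapT => nx.
  have Sx x : 0 <= x <= 2 * pi -> S x z = 0.
    by move=> xT; apply: contrapT => Sx; apply: nx; exists x => //; exact/eqP.
  have p0 := @pi_gt0 R.
  have piT : 0 < (pi : R) < 2 * pi by apply/andP; split; lra.
  have [_ dS _ _] := hz.
  have S1pi : S1 pi z = 0.
    apply: (is_cderive_locally0 piT _ (dS _ piT)) => y /andP[y0 yT].
    by apply: Sx; rewrite !ltW.
  have [_ h] := solution_unique hH T0 (is_solution_forced_sol hz) (zero_forced_sol 0 _ z
    q) pi_in zero_in
    (Sx _ pi_in) S1pi.
  by move: h; rewrite s1 => /eqP; rewrite oner_eq0.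
have Dfacts z : S (2 * pi) z = 0 -> (exists n, z = lam n) /\ exists m (g gt : R[i] -> R[i]),
  [/\ entire g, entire gt, g z != 0, forall w, S (2 * pi) w = (w - z) ^+ m * g w &
      forall w, St (2 * pi) w = (w - z) ^+ m * gt w].
  move=> Sz; have [m [g [eg gz Dg]] card] := mult z (zero_eig z Sz).
  (* A zero of the characteristic function has positive multiplicity, so it
     appears in the sequence lam, hence in lamt with the same number of
     indices. *)
  have [n [n0 nz]] : exists n, (0 < n)%N /\ lam n = z.
    apply: contrapT => nn.
    have E : [set n | (0 < n)%N /\ lam n = z] = set0.
      by apply/seteqP; split => // n h; apply: nn; exists n.
    rewrite E in card; have m0 : m = 0%N.
      by apply/esym/card_eq_II; rewrite II0.
    by move/eqP: gz; apply; have := Dg z; rewrite DS Sz m0 expr0 mul1r.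
  split; first by exists n.
  have [mt [gt [egt gtz Dgt]] cardt] := multt z ltac:(by rewrite -nz heq//; exact: eigt).
  have E : [set n | (0 < n)%N /\ lamt n = z] = [set n | (0 < n)%N /\ lam n = z].
    by apply/seteqP; split => k /= [k0 <-]; rewrite heq.
  have mm : mt = m.
    by apply/card_eq_II; apply: card_eq_trans card; rewrite card_eq_sym -E.
  exists m, g, gt; split => // w; first by rewrite -DS Dg.
  by rewrite -DSt Dgt mm.
have Dex z (Dz : S (2 * pi) z = 0) := (Dfacts z Dz).1.
have Dmult z (Dz : S (2 * pi) z = 0) := (Dfacts z Dz).2.
have full : {ae (@lebesgue_measure R), forall x, 0 < x < 2 * pi -> q x = qt x}.
  apply: (half_potential hH sys syst).
  - move=> l x xT; have [[_ d1 _ _] _ _ [[_ d2 _ _] _ _]] := sol l.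
    have [[_ d3 _ _] _ _ [[_ d4 _ _] _ _]] := solt l.
    by split; [exact: d1|exact: d2|exact: d3|exact: d4].
  - move=> l; exact: (char_eq hH hHt sys syst Dex Dmult).
  - move=> x l xT; exact: (cross_zero hH hHt sys syst Dex Dmult hright).
apply: (aeS full) => x Hx /andP[x0 xpi]; apply: Hx.
by rewrite x0 /=; have := @pi_gt0 R; lra.
Qed.
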